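(* Let $\mathbf V,\mathbf Y,\mathcal M,g,\mathcal W$ satisfy the standing assumptions listed in the context, including the local consistency $\mathcal W[y,\tilde y]=\mathrm{dist}^2(y,\tilde y)+O(\mathrm{dist}^3(y,\tilde y))$. Let $m\in\mathbb N$, let $y\in\mathring{\mathcal M}$ (the interior of $\mathcal M$), let $w\in C^{m-1}(\mathcal M;\mathbf V)$ be a vector field, and let $\mathcal W\in C^m(\mathcal M\times\mathcal M;\mathbb R)$ (which, by the local consistency, automatically implies $g\in C^{m-2}(\mathcal M\times\mathbf V\times\mathbf V;\mathbb R)$). Fix a direction $v\in\mathbf V$, and let $D_vw(y)$, $\mathbf D^{\tau}_vw(y)$ and $\mathbf D^{\pm\tau}_vw(y)$ denote, respectively, the covariant derivative, the one-sided covariant difference quotient and the central covariant difference quotient of $w$ at $y$ in direction $v$. (i) If $m\ge 4$, then $$\left\|\mathbf D^{\tau}_v w(y)-D_v w(y)\right\|_{\mathbf V}\le C\,\tau$$ for all sufficiently small $\tau>0$. (ii) If $m\ge 5$, then $$\left\|\mathbf D^{\pm\tau}_v w(y)-D_v w(y)\right\|_{\mathbf V}\le C\,\tau^2$$ for all sufficiently small $\tau>0$. In both estimates the constant $C>0$ is independent of $\tau$ and, within sufficiently small balls $B\subset\mathring{\mathcal M}$, also independent of $y\in B$.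
   Context: Standing assumptions. $\mathbf V$ is a separable, reflexive Banach space compactly embedded in a Banach space $\mathbf Y$. $\mathcal M$ is the weak closure of an open path-connected subset of $\mathbf V$, potentially with a smooth boundary; the tangent space $T_y\mathcal M$ is identified with $\mathbf V$, so a vector field is a map $\mathcal M\to\mathbf V$. $g:\mathcal M\times\mathbf V\times\mathbf V\to\mathbb R$, $(y,v,w)\mapsto g_y(v,w)$, is a Riemannian metric which is uniformly bounded and coercive: $c^*\|v\|_{\mathbf V}^2\le g_y(v,v)\le C^*\|v\|_{\mathbf V}^2$ with constants $c^*,C^*>0$; moreover $g$ is $C^3(\mathbf Y\times\mathbf V\times\mathbf V;\mathbb R)$-smooth. $\mathrm{dist}(y_A,y_B)$ is the Riemannian distance, i.e. the square root of the minimum of $\int_0^1 g_{\mathbf y(t)}(\dot{\mathbf y}(t),\dot{\mathbf y}(t))\,dt$ over paths $\mathbf y:[0,1]\to\mathcal M$ with $\mathbf y(0)=y_A$, $\mathbf y(1)=y_B$. $\mathcal W:\mathcal M\times\mathcal M\to\mathbb R$ is a smooth functional (with the precise differentiability stated in the claim), extended by $\infty$ to $\mathbf Y\times\mathbf Y$, weakly lower semi-continuous, and locally consistent with the squared distance: $\mathcal W[y,\tilde y]=\mathrm{dist}^2(y,\tilde y)+O(\mathrm{dist}^3(y,\tilde y))$. It is not assumed symmetric. $\mathcal W_{,j}[\cdot,\cdot]\in\mathbf V'$ denotes the derivative of $\mathcal W$ with respect to its $j$th argument. Covariant derivative. The Christoffel operator $\Gamma_y:\mathbf V\times\mathbf V\to\mathbf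 V$ is defined by $2g_y(\Gamma_y(v,w),r)=(D_yg_y)(w)(v,r)-(D_yg_y)(r)(v,w)+(D_yg_y)(v)(w,r)$ for all $r\in\mathbf V$, where $(D_yg_y)(u)$ is the derivative of $y\mapsto g_y$ in direction $u$. For a vector field $w$, the covariant derivative $D_vw(y)\in\mathbf V$ at $y$ in direction $v$ is defined by $g_y(D_vw(y),r)=g_y\big(\tfrac{d}{dt}|_{t=0}w(y+tv),r\big)+g_y(\Gamma_y(w(y),v),r)$ for all $r\in\mathbf V$. Inverse discrete parallel transport. For $y\in\mathring{\mathcal M}$ and sufficiently small $u,\zeta\in\mathbf V$ let $(c,z)$ be the locally unique pair of points (near $(y,y)$) solving, in $\mathbf V'$, $$\mathcal W_{,2}[z,c]+\mathcal W_{,1}[c,y+u]=0,\qquad \mathcal W_{,2}[y,c]+\mathcal W_{,1}[c,y+u+\zeta]=0,$$ and set $\mathbf P^{-1}_{y+u,y}\,\zeta:=z-y\in\mathbf V$. Covariant difference quotients in direction $v\in\mathbf V$ (for $|\tau|\neq0$ small): $$\mathbf D^{\tau}_vw(y):=\frac{\mathbf P^{-1}_{y+\tau v,y}\big(\tau w(y+\tau v)\big)-\tau w(y)}{\tau^2},$$ $$\mathbf D^{\pm\tau}_vw(y):=\frac{\mathbf P^{-1}_{y+\tau v,y}\big(\tau w(y+\tau v)\big)+\mathbf P^{-1}_{y-\tau v,y}\big(-\tau w(y-\tau v)\big)}{2\tau^2}.$$ *)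

(* Defs.v *)
From HB Require Import structures.
From mathcomp Require Import all_boot all_order all_algebra.
From mathcomp Require Import all_classical all_reals all_analysis.

Set Implicit Arguments.
Unset Strict Implicit.
Unset Printing Implicit Defensive.
Import Order.TTheory GRing.Theory Num.Theory.
Import numFieldNormedType.Exports.

Local Open Scope classical_set_scope.
Local Open Scope ring_scope.

Section BoundedLinear.
Context {R : realType} (V W : normedModType R).

Definition clin_pred : {pred V -> W} :=
  fun f => `[< linear f /\ continuous f >].

Record clin := Clin { clin_fun :> V -> W ; clin_funP : clin_fun \in clin_pred }.

HB.instance Definition _ := [isSub for clin_fun].
HB.instance Definition _ := [Choice of clin by <:].

Lemma clin_predP (f : V -> W) :
  reflect (linear f /\ continuous f) (f \in clin_pred).
Proof. exact: asboolP. Qed.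

Lemma clin_pred_submod : GRing.submod_closed clin_pred.
Proof.
split=> [|a f h /clin_predP[lf cf] /clin_predP[lh ch]]; apply/clin_predP; split.
- by move=> k u v /=; rewrite scaler0 addr0.
- exact: cst_continuous.
- move=> k u v; rewrite !fctE lf lh !scalerDr !scalerA (mulrC k) -!addrA.
  by congr (_ + _); rewrite addrCA.
- by move=> x; apply: cvgD; [apply: cvgZl_tmp; exact: cf|exact: ch].
Qed.

HB.instance Definition _ :=
  GRing.isSubmodClosed.Build R (V -> W) clin_pred clin_pred_submod.
HB.instance Definition _ := [SubChoice_isSubLmodule of clin by <:].

Lemma clin_linear (f : clin) : linear f.
Proof. by have /clin_predP[] := clin_funP f. Qed.

Lemma clin_continuous (f : clin) : continuous f.
Proof. by have /clin_predP[] := clin_funP f. Qed.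

HB.instance Definition _ (f : clin) :=
  GRing.isLinear.Build R V W *:%R (clin_fun f) (clin_linear f).

Definition clin_bounds (f : clin) :=
  [set k : R | 0 <= k /\ forall x, `|f x| <= k * `|x|].

Definition clin_norm (f : clin) : R := inf (clin_bounds f).

Lemma clin_bounds_has_inf f : has_inf (clin_bounds f).
Proof.
split; last by exists 0 => k [].
have /linear_boundedP : bounded_near f (nbhs (0 : V)).
  by apply/linear_bounded_continuous; exact: clin_continuous.
by move=> /pinfty_ex_gt0[k k0 fk]; exists k; split => //; exact: ltW.
Qed.

Lemma clin_norm_ge0 f : 0 <= clin_norm f.
Proof. by apply: lb_le_inf; [exact: (clin_bounds_has_inf f).1|move=> k []]. Qed.

Lemma clin_normP (f : clin) x : `|f x| <= clin_norm f * `|x|.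
Proof.
have [->|x0] := eqVneq x 0; first by rewrite linear0 !normr0 mulr0.
rewrite -ler_pdivrMr ?normr_gt0//; apply: lb_le_inf.
  exact: (clin_bounds_has_inf f).1.
by move=> k [_ fk]; rewrite ler_pdivrMr ?normr_gt0.
Qed.

Lemma clin_norm_le (f : clin) k : 0 <= k -> (forall x, `|f x| <= k * `|x|) ->
  clin_norm f <= k.
Proof. by move=> k0 fk; apply: ge_inf => //; exact: (clin_bounds_has_inf f).2. Qed.

Lemma clin_norm_triangle f h : clin_norm (f + h) <= clin_norm f + clin_norm h.
Proof.
apply: clin_norm_le => [|x]; first by rewrite addr_ge0 ?clin_norm_ge0.
by rewrite mulrDl (le_trans (ler_normD _ _))// lerD ?clin_normP.
Qed.

Lemma clin_normZ_le a (f : clin) : clin_norm (a *: f) <= `|a| * clin_norm f.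
Proof.
apply: clin_norm_le => [|x]; first by rewrite mulr_ge0 ?clin_norm_ge0.
by rewrite normrZ -mulrA ler_wpM2l ?clin_normP.
Qed.

Lemma clin_normZ a (f : clin) : clin_norm (a *: f) = `|a| * clin_norm f.
Proof.
apply/eqP; rewrite eq_le clin_normZ_le/=.
have [->|a0] := eqVneq a 0; first by rewrite normr0 mul0r clin_norm_ge0.
rewrite -ler_pdivlMl ?normr_gt0//.
by rewrite -{1}(scalerK a0 f) (le_trans (clin_normZ_le _ _))// normfV.
Qed.

Lemma clin_norm_eq0 (f : clin) : clin_norm f = 0 -> f = 0.
Proof.
move=> f0; apply/val_inj/funext => x /=.
by apply/eqP; rewrite -normr_le0 (le_trans (clin_normP f x))// f0 mul0r.
Qed.

HB.instance Definition _ := Lmodule_isNormed.Build R clin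
  clin_norm_triangle clin_normZ clin_norm_eq0.

End BoundedLinear.

Notation "''L' ( V , W )" := (clin V W)
  (at level 8, format "''L' ( V ,  W )") : type_scope.

(* Junk value 0 when f is not linear and continuous. *)
Definition to_clin {R : realType} {V W : normedModType R} (f : V -> W) :
  'L(V, W) := insubd 0 f.

Section BanachNotions.
Context {R : realType}.

Definition separable (T : topologicalType) :=
  exists2 S : set T, countable S & dense S.

Definition reflexive_space (V : normedModType R) :=
  forall phi : 'L('L(V, R), R), exists v : V, forall f : 'L(V, R), phi f = f v.

Definition compact_embedding (V Y : normedModType R) (iota : 'L(V, Y)) :=
  injective iota /\
  forall A : set V, bounded_set A -> precompact (iota @` A).

(* The coarsest topology on V for which all elements of V' are continuous. *)
Definition weak (V : normedModType R) : topologicalType :=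
  initial_topology
    (fun v : V => (fun f : 'L(V, R) => f v) : {ptws 'L(V, R) -> R}).

Definition weak_closure (V : normedModType R) (A : set V) : set V :=
  @closure (weak V) A.

Definition path_connected (T : topologicalType) (A : set T) :=
  forall x y, A x -> A y -> exists p : R -> T,
    [/\ {within `[0, 1]%classic, continuous p}, p 0 = x, p 1 = y
      & forall t, t \in `[0, 1] -> A (p t)].

(* C^k on a set A that need not be open: f is k times continuously Frechet
   differentiable in the interior of A, and f and its derivatives up to order k
   have continuous extensions to A. *)
Fixpoint Ck (k : nat) (V W : normedModType R) (A : set V) (f : V -> W) : Prop :=
  {within A, continuous f} /\
  if k is k'.+1 then
    (forall x, A° x -> differentiable f x) /\
    exists2 Df : V -> 'L(V, W),
      forall x, A° x -> Df x = to_clin ('d f x) & Ck k' A Df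
  else True.

(* Near each of its boundary points M is the sublevel set of a smooth function
   with nonvanishing derivative. The boundary may be empty. *)
Definition smooth_boundary (V : normedModType R) (M : set V) :=
  forall y, (closure M `\` M°) y -> exists (U : set V) (phi : V -> R),
    [/\ open U /\ U y, (forall k, Ck k U phi), 'd phi y != 0 :> (V -> R)
      & M `&` U = [set x | U x /\ phi x <= 0]].

End BanachNotions.

Section Geometry.
Context {R : realType} {V Y : normedModType R}.
Implicit Types (M : set V) (g : V -> V -> V -> R) (W : V * V -> R).

Definition riemannian_metric M g :=
  forall y, M y ->
    [/\ forall u, linear (g y u), forall u v, g y u v = g y v u
      & forall v, v != 0 -> 0 < g y v v].

(* p is a W^{1,2} path with weak derivative u. Measurability, integrals and the
   fundamental theorem of calculus are tested with V'; for separable V this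
   amounts to Bochner measurability and the Bochner integral. *)
Definition velocity (p u : R -> V) :=
  [/\ forall f : 'L(V, R), measurable_fun (`[0, 1]%classic : set R) (f \o u),
      (\int[lebesgue_measure]_(t in `[0%R, 1%R]) (`|u t| ^+ 2)%:E < +oo)%E
    & forall (f : 'L(V, R)) t, t \in `[0, 1] ->
        f (p t) = f (p 0) + \int[lebesgue_measure]_(s in `[0, t]) f (u s)].

Definition path_energy g (p u : R -> V) : \bar R :=
  \int[lebesgue_measure]_(t in `[0, 1]) (g (p t) (u t) (u t))%:E.

(* The infimum is a minimum whenever minimizing paths exist, and +oo if no path
   in M connects the two points. *)
Definition riemannian_dist M g (yA yB : V) : \bar R :=
  sqrte (ereal_inf [set e | exists p u : R -> V,
    [/\ forall t, t \in `[0, 1] -> M (p t), p 0 = yA, p 1 = yB, velocity p u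
      & e = path_energy g p u]]).

(* W[y, y'] = dist^2(y, y') + O(dist^3(y, y')) as dist(y, y') -> 0, where the
   implied constant may depend on y. *)
Definition locally_consistent M g W :=
  forall y, M y -> exists C delta : R, 0 < delta /\
    forall y', M y' -> (riemannian_dist M g y y' < delta%:E)%E ->
      let d := fine (riemannian_dist M g y y') in
      `|W (y, y') - d ^+ 2| <= C * d ^+ 3.

(* W extended by +oo to Y x Y, M being identified with its image in Y. *)
Definition extend_pinfty (iota : 'L(V, Y)) M W (p : Y * Y) : \bar R :=
  ereal_inf [set e | exists y y',
    [/\ M y, M y', iota y = p.1, iota y' = p.2 & e = (W (y, y'))%:E]].

Definition weakly_lsc (F : Y * Y -> \bar R) :=
  lower_semicontinuous (F : weak Y * weak Y -> \bar R).

(* (D_y g_y)(u)(a, b) *)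
Definition metric_deriv g (y u a b : V) : R := 'D_u (fun x => g x a b) y.

Definition christoffel g (y v w : V) : V :=
  get [set x | forall r, 2 * g y x r =
    metric_deriv g y w v r - metric_deriv g y r v w + metric_deriv g y v w r].

Definition cov_deriv g (w : V -> V) (v y : V) : V :=
  get [set x | forall r,
    g y x r = g y ('D_v w y) r + g y (christoffel g y (w y) v) r].

(* W_{,1}[a, b] and W_{,2}[a, b] *)
Definition deriv1 W (a b : V) : 'L(V, R) :=
  to_clin ('d (fun x => W (x, b)) a).
Definition deriv2 W (a b : V) : 'L(V, R) :=
  to_clin ('d (fun x => W (a, x)) b).

(* The radius r makes precise that the solution (c, z) is sought near (y, y). *)
Definition transport_pair W (r : R) (y u zeta : V) (cz : V * V) :=
  [/\ ball (y, y) r cz,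
      deriv2 W cz.2 cz.1 + deriv1 W cz.1 (y + u) = 0
    & deriv2 W y cz.1 + deriv1 W cz.1 (y + u + zeta) = 0].

(* P^{-1}_{y + u, y} zeta *)
Definition inv_transport W r (y u zeta : V) : V :=
  (get (transport_pair W r y u zeta)).2 - y.

(* Within distance r of (y, y) the pair (c, z) exists and is unique for all
   small u and zeta, uniformly for y in B. *)
Definition inv_transport_well_defined W (B : set V) (r : R) :=
  exists2 delta : R, 0 < delta & forall y u zeta, B y ->
    `|u| < delta -> `|zeta| < delta ->
    exists! cz, transport_pair W r y u zeta cz.

Definition cov_quot W r (tau : R) (w : V -> V) (v y : V) : V :=
  (tau ^+ 2)^-1 *:
    (inv_transport W r y (tau *: v) (tau *: w (y + tau *: v)) - tau *: w y).

Definition cov_quot_sym W r (tau : R) (w : V -> V) (v y : V) : V :=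
  (2 * tau ^+ 2)^-1 *:
    (inv_transport W r y (tau *: v) (tau *: w (y + tau *: v)) +
     inv_transport W r y (- (tau *: v)) (- (tau *: w (y - tau *: v)))).

End Geometry.

(* Main.v *)
From HB Require Import structures.
Require Import Defs.
From mathcomp Require Import all_boot all_order all_algebra.
From mathcomp Require Import all_classical all_reals all_analysis.
From mathcomp Require Import measurable_realfun.
From mathcomp Require Import ring lra.

(** The inverse transport [z - y] is expanded in powers of the step [t], and the
    coefficient of [t^2] is identified.

    Local consistency gives [W (y, y + s h) = s^2 g_y(h, h) + o(s^2)]: the straight
    line bounds the distance from above, and any path of comparable energy stays
    close to [y], where the metric is almost constant ([path_energy_lower],
    [consistent_expansion]). Hence [W] and its differential vanish on the diagonal,
    its Hessian there is [2 g_y(a2 - a1, b2 - b1)], and differentiating along the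
    diagonal expresses the third derivative through the derivative of the metric,
    up to a single symmetric trilinear form [A] ([D2_diag], [D3_diag_formula]).

    The two transport equations are solved successively, first for [c] and then for
    [z]. Near the diagonal each is, after applying the Riesz isomorphism of the
    metric at [y0], a small perturbation of the identity. This yields existence and
    uniqueness in small balls, and the a posteriori estimate that the distance of an
    approximate solution to the exact one is bounded by its residuals
    ([transport_well_defined], [transport_stable]). Completeness and coercivity of
    the metric are all that is needed of the space.

    It remains to find an approximate solution with small residual. With
    [d = t v + t w(y + t v)], cubic curves [c = y + t p1 + t^2 p2 + t^3 p3] and
    [z = y + t w(y) + t^2 q2 + t^3 q3] are inserted in the Taylor expansion of the
    differential of [W] at [(y, y)]; the coefficients [p2], [p3], [q2], [q3] are
    chosen by the Riesz representation such that the terms up to [t^3] cancel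
    ([approximate_solution]). In the second order equations the form [A] drops out
    and the rest is the Christoffel operator, so that [q2] is the covariant
    derivative ([second_coefficient]). Consequently
    [z - y = t w(y) + t^2 D_v w(y) + t^3 q3 + O(t^N)] for both signs of [t],
    uniformly in [y], with [N = 3] if [W] is four times and [N = 4] if [W] is five
    times continuously differentiable ([manifold_expansion]). The one-sided quotient
    then has an error of order [t], and in the central one the odd powers of [t]
    cancel. *)

Set Implicit Arguments.
Unset Strict Implicit.
Unset Printing Implicit Defensive.
Import Order.TTheory GRing.Theory Num.Theory.
Import numFieldNormedType.Exports.

Local Open Scope classical_set_scope.
Local Open Scope ring_scope.

(** * Bounded linear and multilinear maps *)

Section LinearMaps.
Context {R : realType} {V W : normedModType R}.
Implicit Types f h : 'L(V, W).

Lemma clin_addE f h x : (f + h) x = f x + h x. Proof. by []. Qed.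
Lemma clin_oppE f x : (- f) x = - f x. Proof. by []. Qed.
Lemma clin_scaleE a f x : (a *: f) x = a *: f x. Proof. by []. Qed.
Lemma clin_zeroE x : (0 : 'L(V, W)) x = 0. Proof. by []. Qed.

Lemma clin_le f x : `|f x| <= `|f| * `|x|. Proof. exact: clin_normP. Qed.

Lemma clin_opnorm_le f k : 0 <= k -> (forall x, `|f x| <= k * `|x|) -> `|f| <= k.
Proof. exact: clin_norm_le. Qed.

Lemma clin_ext f h : (forall x, f x = h x) -> f = h.
Proof. by move=> fh; apply/val_inj/funext. Qed.

(** Converse of [clin_le]: a linear map with a linear bound is continuous. *)
Lemma bounded_linear_continuous (f : V -> W) (k : R) :
  linear f -> (forall x, `|f x| <= k * `|x|) -> continuous f.
Proof.
move=> lf fk.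
pose F : {linear V -> W} := HB.pack f (GRing.isLinear.Build R V W *:%R f lf).
have : bounded_near (F : V -> W) (nbhs (0 : V)).
  apply/linear_boundedP; near=> M => x; apply: le_trans (fk x) _.
  by apply: ler_wpM2r => //; near: M; exact: nbhs_pinfty_ge.
by move/linear_bounded_continuous.
Unshelve. all: by end_near. Qed.

Lemma to_clinE (f : V -> W) x : linear f -> continuous f -> to_clin f x = f x.
Proof. by move=> lf cf; rewrite /to_clin insubdK//; apply/clin_predP. Qed.

Lemma diff_to_clinE (f : V -> W) p x :
  differentiable f p -> to_clin ('d f p) x = 'd f p x.
Proof.
by move=> df; rewrite to_clinE//; [exact: linearP|exact: diff_continuous].
Qed.

End LinearMaps.

Definition clinE := (@clin_addE, @clin_oppE, @clin_scaleE, @clin_zeroE).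

Section MultilinearMaps.
Context {R : realType}.
Implicit Types V W : normedModType R.

Lemma clinD1 (V1 W : normedModType R) (f : 'L(V1, W)) u v : f (u + v) = f u + f v.
Proof. exact: linearD. Qed.
Lemma clinZ1 (V1 W : normedModType R) (f : 'L(V1, W)) a u : f (a *: u) = a *: f u.
Proof. exact: linearZ. Qed.
Lemma clinD2 (V1 V2 W : normedModType R) (f : 'L(V1, 'L(V2, W))) u v x : f (u + v) x = f u x + f v x.
Proof. by rewrite clinD1. Qed.
Lemma clinZ2 (V1 V2 W : normedModType R) (f : 'L(V1, 'L(V2, W))) a u x : f (a *: u) x = a *: f u x.
Proof. by rewrite clinZ1. Qed.
Lemma clinD3 (V1 V2 V3 W : normedModType R) (f : 'L(V1, 'L(V2, 'L(V3, W)))) u v x y :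
  f (u + v) x y = f u x y + f v x y.
Proof. by rewrite clinD2. Qed.
Lemma clinZ3 (V1 V2 V3 W : normedModType R) (f : 'L(V1, 'L(V2, 'L(V3, W)))) a u x y :
  f (a *: u) x y = a *: f u x y.
Proof. by rewrite clinZ2. Qed.
Lemma clinD4 (V1 V2 V3 V4 W : normedModType R) (f : 'L(V1, 'L(V2, 'L(V3, 'L(V4, W))))) u v x y z :
  f (u + v) x y z = f u x y z + f v x y z.
Proof. by rewrite clinD3. Qed.
Lemma clinZ4 (V1 V2 V3 V4 W : normedModType R) (f : 'L(V1, 'L(V2, 'L(V3, 'L(V4, W))))) a u x y z :
  f (a *: u) x y z = a *: f u x y z.
Proof. by rewrite clinZ3. Qed.

Lemma clin_le2 (V1 V2 W : normedModType R) (f : 'L(V1, 'L(V2, W))) x y : `|f x y| <= `|f| * `|x| * `|y|.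
Proof. by apply: le_trans (clin_le _ _) _; rewrite ler_wpM2r// clin_le. Qed.
Lemma clin_le3 (V1 V2 V3 W : normedModType R) (f : 'L(V1, 'L(V2, 'L(V3, W)))) x y z :
  `|f x y z| <= `|f| * `|x| * `|y| * `|z|.
Proof. by apply: le_trans (clin_le _ _) _; rewrite ler_wpM2r// clin_le2. Qed.
Lemma clin_le4 (V1 V2 V3 V4 W : normedModType R) (f : 'L(V1, 'L(V2, 'L(V3, 'L(V4, W))))) x y z t :
  `|f x y z t| <= `|f| * `|x| * `|y| * `|z| * `|t|.
Proof. by apply: le_trans (clin_le _ _) _; rewrite ler_wpM2r// clin_le3. Qed.
Lemma clin_le5 (V1 V2 V3 V4 V5 W : normedModType R) (f : 'L(V1, 'L(V2, 'L(V3, 'L(V4, 'L(V5, W)))))) x y z t u :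
  `|f x y z t u| <= `|f| * `|x| * `|y| * `|z| * `|t| * `|u|.
Proof. by apply: le_trans (clin_le _ _) _; rewrite ler_wpM2r// clin_le4. Qed.

End MultilinearMaps.

(** * Differentials along lines and a one-dimensional Taylor bound *)

Section Differentials.
Context {R : realType}.
Implicit Types V W U : normedModType R.

Lemma differentiable_eps V W (f : V -> W) p (e : R) : differentiable f p -> 0 < e ->
  exists2 d, 0 < d & forall h, `|h| < d ->
    `|f (p + h) - f p - 'd f p h| <= e * `|h|.
Proof.
move=> df e0; have /eqaddoP/(_ _ e0) := diff_locally df.
move=> /nbhs_ballP[d d0 H1]; exists d => // h hd.
have := H1 h; rewrite -ball_normE /= sub0r normrN => /(_ hd).
by rewrite !fctE /= opprD addrA (addrC h).
Qed.

Lemma is_derive_diff (W : normedModType R) (f : R -> W) (df : R -> W) t :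
  is_diff t f df -> is_derive t 1 f (df 1).
Proof.
move=> [df1 df2]; apply: DeriveDef; first exact: diff_derivable.
by rewrite deriveE// df2.
Qed.

Lemma is_diff_line V (p h : V) (t : R) :
  is_diff t (fun s : R => p + s *: h) (fun s => s *: h).
Proof.
by apply: (@is_diff_eq _ _ _ _ (cst 0 + (fun s : R => s *: h))); rewrite ?add0r.
Qed.

(** The chain rule for a map restricted to the line [s |-> p + s *: h]. *)
Lemma is_derive_line V W (f : V -> W) p h (t : R) :
  differentiable f (p + t *: h) ->
  is_derive t 1 (fun s : R => f (p + s *: h)) ('d f (p + t *: h) h).
Proof.
move=> df; have dl := is_diff_line p h t.
have df' := differentiableP df.
have /is_derive_diff := is_diff_comp dl df'.
by rewrite /= scale1r.
Qed.

(** Evaluation at a fixed vector is bounded linear, so it commutes with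
    differentiation of operator-valued maps. *)
Lemma is_diff_eval V W U (F : V -> 'L(U, W)) p r : differentiable F p ->
  is_diff p (fun x => F x r) (fun h => 'd F p h r).
Proof.
move=> dF.
have lev : linear (fun A : 'L(U, W) => A r) by [].
pose ev : {linear 'L(U, W) -> W} := HB.pack (fun A : 'L(U, W) => A r)
  (GRing.isLinear.Build R 'L(U, W) W *:%R (fun A : 'L(U, W) => A r) lev).
have cev : continuous ev.
  apply: (@bounded_linear_continuous _ _ _ _ `|r| lev) => A /=.
  by rewrite mulrC; exact: clin_le.
apply: (@is_diff_comp _ _ _ _ F ('d F p) ev ev); first exact: differentiableP.
split; first exact: linear_differentiable.
by rewrite diff_lin.
Qed.

End Differentials.

Section RealFunctions.
Context {R : realType}.
Implicit Types (phi dphi : R -> R).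

Lemma mvt_le phi dphi (s : R) : 0 <= s ->
  (forall t : R, 0 <= t <= s -> is_derive t 1 phi (dphi t)) ->
  exists2 c, 0 <= c <= s & phi s - phi 0 = dphi c * s.
Proof.
move=> s0 d; have [||c ci] := @MVT_segment _ phi dphi 0 s s0.
- by move=> t; rewrite in_itv /= => /andP[a b]; apply: d; rewrite !ltW.
- apply: derivable_within_continuous => t; rewrite in_itv /= => ti.
  by have [] := d _ ti.
by rewrite subr0 => E; exists c; rewrite // -in_itv.
Qed.

Lemma is_derive_powM (a : R) n (t : R) :
  is_derive t 1 (fun s : R => a * s ^+ n.+1) (a * n.+1%:R * t ^+ n).
Proof.
have -> : (fun s : R => a * s ^+ n.+1) = a \*: (@GRing.exp R ^~ n.+1) by [].
have d := @exprn_derivable R n.+1 t 1.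
split; first exact: derivableZ.
by rewrite deriveZ// exp_derive /GRing.scale /= mulr1 mulrA.
Qed.

(** Taylor's formula for a chain [phi 0, phi 1, ...] in which each function is the
    derivative of the previous one. Each induction step applies the mean value
    theorem on an interval of length at most 1, which keeps the constant [K] and
    does not gain the usual factorial. *)
Lemma taylor_bound n (phi : nat -> R -> R) (K s : R) : 0 <= s <= 1 ->
  (forall i (t : R), (i < n)%N -> 0 <= t <= 1 -> is_derive t 1 (phi i) (phi i.+1 t)) ->
  (forall t : R, 0 <= t <= 1 -> `|phi n t| <= K) ->
  `|phi 0 s - \sum_(i < n) phi i 0 / i`!%:R * s ^+ i| <= K.
Proof.
elim: n phi s => [|n IH] phi s /andP[s0 s1] dphi Kphi.
  by rewrite big_ord0 subr0 Kphi// s0.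
have K0 : 0 <= K by apply: le_trans (Kphi 0 _); rewrite ?lexx ?ler01.
pose psi t := phi 0%N t - \sum_(i < n.+1) phi i 0 / i`!%:R * t ^+ i.
pose dpsi t := phi 1%N t - \sum_(i < n) phi i.+1 0 / i`!%:R * t ^+ i.
have dpsiP t : 0 <= t <= s -> is_derive t 1 psi (dpsi t).
  move=> /andP[t0 ts]; have t01 : 0 <= t <= 1 by rewrite t0 (le_trans ts).
  pose S (t : R) := \sum_(i < n) phi i.+1 0 / i.+1`!%:R * t ^+ i.+1.
  have dS : is_derive t 1 S (\sum_(i < n) phi i.+1 0 / i`!%:R * t ^+ i).
    have -> : S = \sum_(i < n) (fun t : R => phi i.+1 0 / i.+1`!%:R * t ^+ i.+1).
      by apply/funext => u; rewrite fct_sumE.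
    apply: is_derive_eq.
      by apply: is_derive_sum => i; exact: is_derive_powM.
    apply: eq_bigr => i _; congr (_ * _).
    have n0 : i.+1%:R != 0 :> R by rewrite pnatr_eq0.
    by rewrite factS natrM invfM mulrA mulrAC mulfVK.
  have -> : psi = phi 0%N - (cst (phi 0%N 0) + S).
    apply/funext => u; rewrite /psi big_ord_recl /= !fctE /= divr1 expr0 mulr1.
    by [].
  have d0 := dphi 0%N t isT t01.
  by apply: is_derive_eq; rewrite add0r.
have [c /andP[c0 cs]] := mvt_le s0 dpsiP.
have -> : psi 0 = 0.
  rewrite /psi big_ord_recl /= divr1 expr0 mulr1 big1 ?addr0 ?subrr// => i _.
  by rewrite expr0n /= mulr0.
rewrite subr0 -/(psi s) => ->.
have H : `|dpsi c| <= K.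
  apply: (IH (fun i => phi i.+1)) => //; first by rewrite c0 (le_trans cs).
  by move=> i t ilt; exact: dphi.
by rewrite normrM (ger0_norm s0) -[leRHS]mulr1 ler_pM.
Qed.

End RealFunctions.

(** * Symmetry of second derivatives *)

Section SymmetryOfSecondDerivatives.
Context {R : realType} {V : normedModType R}.
Variables (f : V -> R) (Df B : V -> V -> R) (p : V) (rho : R).
Hypothesis rho0 : 0 < rho.
Hypothesis f_diff : forall x, `|x - p| < rho ->
  differentiable f x /\ forall h, 'd f x h = Df x h.
Hypothesis B_linear : forall h, linear (B ^~ h).
Hypothesis Df_diff : forall e, 0 < e -> exists2 d, 0 < d & forall k h,
  `|k| < d -> `|Df (p + k) h - Df p h - B k h| <= e * `|k| * `|h|.

(** The second difference is symmetric in [a] and [b], and the mean value theorem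
    in the direction [a] shows that it is [s ^+ 2 * B b a] up to an error that is
    small compared to [s ^+ 2]. Differentiability of the first derivative at the
    single point [p] suffices. *)
Let second_difference s a b :=
  f (p + s *: a + s *: b) - f (p + s *: a) - f (p + s *: b) + f p.

Lemma second_difference_approx (e : R) a b : 0 < e ->
  exists2 s0, 0 < s0 & forall s : R, 0 < s < s0 ->
    `|second_difference s a b - s ^+ 2 * B b a| <=
    2 * e * s ^+ 2 * (`|a| + `|b|) ^+ 2.
Proof.
move=> e0; have [d d0 Hd] := Df_diff e0.
set N := `|a| + `|b|; have N0 : 0 <= N by rewrite addr_ge0.
have N1 : 0 < N + 1 by rewrite ltr_wpDl.
exists (Num.min d rho / (N + 1)); first by rewrite divr_gt0// lt_min d0.
move=> s /andP[s0]; rewrite ltr_pdivlMr// lt_min => /andP[sd sr].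
have sN : s * N <= s * (N + 1) by rewrite ler_wpM2l ?(ltW s0)// lerDl.
have small (c : R) : 0 <= c <= s -> `|s *: b + c *: a| <= s * N /\ `|c *: a| <= s * N.
  move=> /andP[c0 cs]; have ca : `|c *: a| <= s * `|a|.
    by rewrite normrZ ger0_norm// ler_wpM2r.
  split; last by rewrite (le_trans ca)// ler_wpM2l ?(ltW s0)// lerDl.
  rewrite (le_trans (ler_normD _ _))// /N mulrDr addrC lerD//.
  by rewrite normrZ gtr0_norm.
have inr (h : V) : `|h| <= s * N -> `|p + h - p| < rho.
  by move=> hs; rewrite addrC addKr (le_lt_trans hs)// (le_lt_trans sN).
have ind (h : V) : `|h| <= s * N -> `|h| < d.
  by move=> hs; rewrite (le_lt_trans hs)// (le_lt_trans sN).
pose phi (t : R) := f (p + s *: b + t *: a) - f (p + t *: a).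
pose dphi (t : R) := Df (p + s *: b + t *: a) a - Df (p + t *: a) a.
have dphiP (t : R) : 0 <= t <= s -> is_derive t 1 phi (dphi t).
  move=> ts; have [n1 n2] := small _ ts.
  have [d1 e1] := f_diff (inr _ n1); have [d2 e2] := f_diff (inr _ n2).
  rewrite addrA in d1 e1.
  rewrite /dphi -e1 -e2.
  by apply: is_deriveB; exact: is_derive_line.
have [c cs] := mvt_le (ltW s0) dphiP.
have -> : phi s - phi 0 = second_difference s a b.
  rewrite /phi /second_difference !scale0r !addr0 opprB addrA.
  by rewrite [p + s *: b + _]addrAC; ring.
move=> ->; have [n1 n2] := small _ cs.
have H1 := Hd _ a (ind _ n1); have H2 := Hd _ a (ind _ n2).
have -> : dphi c * s - s ^+ 2 * B b a =
  s * ((Df (p + (s *: b + c *: a)) a - Df p a - B (s *: b + c *: a) a) -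
       (Df (p + c *: a) a - Df p a - B (c *: a) a)).
  have -> : B (s *: b + c *: a) a = s * B b a + B (c *: a) a by exact: B_linear.
  by rewrite /dphi addrA; ring.
rewrite normrM (gtr0_norm s0).
have -> : 2 * e * s ^+ 2 * N ^+ 2 = s * (e * (s * N) * N + e * (s * N) * N) by ring.
have aN : `|a| <= N by rewrite lerDl.
apply: ler_wpM2l; first exact: ltW.
apply: le_trans (ler_normB _ _) _; apply: lerD.
  by apply: le_trans H1 _; apply: ler_pM => //; rewrite ?mulr_ge0 ?(ltW e0)// ler_wpM2l// ltW.
by apply: le_trans H2 _; apply: ler_pM => //; rewrite ?mulr_ge0 ?(ltW e0)// ler_wpM2l// ltW.
Qed.

Lemma second_derivative_sym a b : B a b = B b a.
Proof.
apply/eqP; rewrite -subr_eq0 -normr_le0; apply/ler_addgt0Pl => e e0.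
rewrite addr0; set N := (`|a| + `|b|) ^+ 2.
have N0 : 0 <= N by rewrite exprn_ge0// addr_ge0.
pose e' := e / (4 * (N + 1)).
have e'0 : 0 < e' by rewrite divr_gt0// mulr_gt0// ltr_wpDl.
have [s1 s10 H1] := second_difference_approx a b e'0.
have [s2 s20 H2] := second_difference_approx b a e'0.
pose s := Num.min s1 s2 / 2.
have s0 : 0 < s by rewrite divr_gt0// lt_min s10.
have sm : s < Num.min s1 s2 by rewrite /s ltr_pdivrMr// ltr_pMr ?ltr1n// lt_min s10.
move: (sm); rewrite lt_min => /andP[l1 l2].
have := H1 s; rewrite s0 l1 => /(_ isT) h1.
have := H2 s; rewrite s0 l2 => /(_ isT) h2.
have sE : second_difference s b a = second_difference s a b.
  by rewrite /second_difference [p + s *: b + _]addrAC; ring.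
rewrite sE [`|b| + _]addrC -/N in h2; rewrite -/N in h1.
have ss : 0 < s ^+ 2 by rewrite exprn_gt0.
have : s ^+ 2 * `|B a b - B b a| <= s ^+ 2 * e.
  rewrite -{1}(gtr0_norm ss) -normrM.
  have -> : s ^+ 2 * (B a b - B b a) =
    (second_difference s a b - s ^+ 2 * B b a) -
    (second_difference s a b - s ^+ 2 * B a b) by ring.
  apply: le_trans (ler_normB _ _) _; apply: le_trans (lerD h1 h2) _.
  have -> : 2 * e' * s ^+ 2 * N + 2 * e' * s ^+ 2 * N = s ^+ 2 * (4 * e' * N) by ring.
  apply: ler_wpM2l; first exact: ltW.
  have -> : e = e' * (4 * (N + 1)) by rewrite /e' divfK// gt_eqF// mulr_gt0// ltr_wpDl.
  by rewrite [4 * e']mulrC -mulrA ler_wpM2l ?(ltW e'0)// ler_wpM2l// lerDl.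
by rewrite ler_pM2l.
Qed.

End SymmetryOfSecondDerivatives.

(** * Differentiability classes and Taylor estimates near a point *)

Section DifferentiabilityClasses.
Context {R : realType} {V W : normedModType R}.

Lemma Ck_continuous k (A : set V) (f : V -> W) x :
  Ck k A f -> A° x -> {for x, continuous f}.
Proof.
move=> Cf Ax; have : {within A, continuous f} by case: k Cf => [|k] [].
move=> /(continuous_subspaceW (@interior_subset _ A)).
by rewrite continuous_open_subspace; [apply; rewrite inE|exact: open_interior].
Qed.

Lemma Ck_succ k (A : set V) (f : V -> W) : Ck k.+1 A f ->
  exists2 Df : V -> 'L(V, W), Ck k A Df &
    forall x, A° x -> is_diff x f (Df x).
Proof.
move=> [_ [df [Df DfE CDf]]]; exists Df => // x Ax.
split; first exact: df.
by apply/funext => h; rewrite DfE// diff_to_clinE//; exact: df.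
Qed.

Lemma continuous_bounded (f : V -> W) x : {for x, continuous f} ->
  exists rho K : R, [/\ 0 < rho, 0 <= K & forall y, `|y - x| < rho -> `|f y| <= K].
Proof.
move=> /cvgrPdist_lt/(_ 1 ltr01)/nbhs_ballP[d /= d0 H].
exists d, (`|f x| + 1); split=> // y yx.
have := H y; rewrite -ball_normE /= distrC => /(_ yx) fy.
rewrite -[f y](subrK (f x)) addrC (le_trans (ler_normD _ _))// lerD2l distrC.
exact: ltW.
Qed.

Lemma continuous_dist (f : V -> W) x (e : R) : {for x, continuous f} -> 0 < e ->
  exists2 rho : R, 0 < rho & forall y, `|y - x| < rho -> `|f y - f x| <= e.
Proof.
move=> /cvgrPdist_lt H e0; have /nbhs_ballP[d /= d0 Hd] := H e e0.
exists d => // y yx; rewrite distrC; apply/ltW.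
by apply: Hd; rewrite -ball_normE /= distrC.
Qed.

(** Balls are convex; this is the form used along the segment from [p] to [p + h]. *)
Lemma ball_segment (q p h : V) (rho t : R) : 0 <= t <= 1 ->
  `|p - q| < rho -> `|p + h - q| < rho -> `|p + t *: h - q| < rho.
Proof.
move=> /andP[t0 t1] p1 p2.
have -> : p + t *: h - q = (1 - t) *: (p - q) + t *: (p + h - q).
  rewrite -[p + h - q]addrAC [t *: (_ + h)]scalerDr addrA -scalerDl subrK scale1r.
  by rewrite addrAC.
have [->|tn] := eqVneq t 1.
  by rewrite subrr scale0r add0r scale1r.
have t1' : 0 < 1 - t by rewrite subr_gt0 lt_neqAle tn.
rewrite (le_lt_trans (ler_normD _ _))// !normrZ (gtr0_norm t1') ger0_norm//.
have -> : rho = (1 - t) * rho + t * rho by ring.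
by rewrite ltr_leD ?ltr_pM2l// ler_wpM2l// ltW.
Qed.

End DifferentiabilityClasses.

Lemma mulr3_le (R : realDomainType) (a b h : R) : a <= b -> 0 <= h ->
  a * h * h * h <= b * h ^+ 3.
Proof.
by move=> ab h0; rewrite !exprSr expr0 mul1r !mulrA !ler_wpM2r.
Qed.

Section TaylorEstimates.
Context {R : realType} {V : normedModType R}.
Variables (P : V) (rho : R).
Variables (F : V -> 'L(V, R)) (D2 : V -> 'L(V, 'L(V, R))).
Hypothesis F_diff : forall x, `|x - P| < rho -> is_diff x F (D2 x).

Lemma diff_lin1 (U : normedModType R) (G : V -> 'L(V, U)) (dG : V -> 'L(V, 'L(V, U))) x h :
  is_diff x G (dG x) -> is_diff x (fun z => G z h) (fun k => dG x k h).
Proof.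
move=> [d1 e1]; have := is_diff_eval h d1.
by rewrite e1.
Qed.

Lemma is_derive_line1 (f : V -> R) (df : V -> R) p h (t : R) :
  is_diff (p + t *: h) f df -> is_derive t 1 (fun s : R => f (p + s *: h)) (df h).
Proof. by move=> [d1 <-]; exact: is_derive_line. Qed.

Lemma is_derive_F p h r (t : R) : `|p + t *: h - P| < rho ->
  is_derive t 1 (fun s : R => F (p + s *: h) r) (D2 (p + t *: h) h r).
Proof.
move=> /F_diff/(diff_lin1 r)/is_derive_line1; exact.
Qed.

(** If the derivative stays within [e] of a fixed map [B], increments of [F] are
    within relative error [e] of those of [B]. Testing with vectors [r] reduces
    the operator-valued mean value inequality to the scalar one. *)
Lemma strict_differentiability (B : 'L(V, 'L(V, R))) (e : R) p p' :
  (forall x, `|x - P| < rho -> `|D2 x - B| <= e) ->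
  `|p - P| < rho -> `|p' - P| < rho -> `|F p' - F p - B (p' - p)| <= e * `|p' - p|.
Proof.
have pK : p + (p' - p) = p' by rewrite addrC subrK.
move=> DB pP pP'; have e0 : 0 <= e by exact: le_trans (DB _ pP).
apply: clin_opnorm_le => [|r]; first by rewrite mulr_ge0.
have [t t01|c c01] := @mvt_le _ (fun t : R => F (p + t *: (p' - p)) r)
   (fun t : R => D2 (p + t *: (p' - p)) (p' - p) r) 1 ler01.
  by apply: is_derive_F; apply: ball_segment => //; rewrite pK.
rewrite scale1r scale0r addr0 pK mulr1 => E.
rewrite !clinE E.
have := DB (p + c *: (p' - p)); rewrite ball_segment ?pK// => /(_ isT) DBc.
have -> : D2 (p + c *: (p' - p)) (p' - p) r - B (p' - p) r =
  (D2 (p + c *: (p' - p)) - B) (p' - p) r by [].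
apply: le_trans (clin_le _ _) _; apply: ler_wpM2r => //.
by apply: le_trans (clin_le _ _) _; apply: ler_wpM2r.
Qed.

Variables (D3 : V -> 'L(V, 'L(V, 'L(V, R))))
  (D4 : V -> 'L(V, 'L(V, 'L(V, 'L(V, R))))).
Hypothesis D2_diff : forall x, `|x - P| < rho -> is_diff x D2 (D3 x).
Hypothesis D3_diff : forall x, `|x - P| < rho -> is_diff x D3 (D4 x).

Lemma is_derive_D2 p h r (t : R) : `|p + t *: h - P| < rho ->
  is_derive t 1 (fun s : R => D2 (p + s *: h) h r) (D3 (p + t *: h) h h r).
Proof.
move=> /D2_diff/(diff_lin1 h) d.
apply: (@is_derive_line1 (fun z => D2 z h r) (fun k => D3 (p + t *: h) k h r)).
have [d1 e1] := d; have := is_diff_eval r d1; by rewrite e1.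
Qed.

Lemma is_derive_D3 p h r (t : R) : `|p + t *: h - P| < rho ->
  is_derive t 1 (fun s : R => D3 (p + s *: h) h h r) (D4 (p + t *: h) h h h r).
Proof.
move=> /D3_diff/(diff_lin1 h) [d1 e1].
have [d2 e2] := is_diff_eval h d1.
apply: (@is_derive_line1 (fun z => D3 z h h r) (fun k => D4 (p + t *: h) k h h r)).
by have := is_diff_eval r d2; rewrite e2 e1.
Qed.

Lemma taylor_order3 K p h : 
  (forall x, `|x - P| < rho -> `|D4 x| <= K) ->
  `|p - P| < rho -> `|p + h - P| < rho ->
  `|F (p + h) - F p - D2 p h - 2^-1 *: D3 p h h| <= K * `|h| ^+ 3.
Proof.
move=> DK p1 p2; have K0 : 0 <= K by exact: le_trans (DK _ p1).
have seg t : 0 <= t <= 1 -> `|p + t *: h - P| < rho by move=> t01; exact: ball_segment.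
apply: clin_opnorm_le => [|r]; first by rewrite mulr_ge0// exprn_ge0.
rewrite !clinE.
pose phi (i : nat) (t : R) : R := match i with
  | 0 => F (p + t *: h) r | 1 => D2 (p + t *: h) h r
  | 2 => D3 (p + t *: h) h h r | _ => D4 (p + t *: h) h h h r end.
have := @taylor_bound _ 3 phi (K * `|h| ^+ 3 * `|r|) 1.
rewrite ler01 lexx => /(_ isT).
rewrite !big_ord_recl big_ord0 /= /bump /= !scale0r !addr0 scale1r !expr1n !mulr1 /= !divr1.
rewrite [2^-1 *: _]mulrC !opprD !addrA; apply.
- move=> [|[|[|//]]] t _ t01; [exact: is_derive_F (seg _ _)|exact: is_derive_D2 (seg _ _)|].
  exact: is_derive_D3 (seg _ _).
- move=> t /seg/DK Dt /=; apply: le_trans (clin_le4 _ _ _ _ _) _; apply: ler_wpM2r => //.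
  exact: mulr3_le.
Qed.

(** [D5 x h r k] is the derivative in the direction [k] of [z |-> D4 z h h h r]. *)
Variable D5 : V -> V -> V -> V -> R.
Hypothesis D4_diff : forall x h r, `|x - P| < rho ->
  is_diff x (fun z => D4 z h h h r) (D5 x h r).

Lemma taylor_order4 K p h :
  0 <= K -> (forall x h r, `|x - P| < rho -> `|D5 x h r h| <= K * `|h| ^+ 4 * `|r|) ->
  `|p - P| < rho -> `|p + h - P| < rho ->
  `|F (p + h) - F p - D2 p h - 2^-1 *: D3 p h h - 6^-1 *: D4 p h h h| <= K * `|h| ^+ 4.
Proof.
move=> K0 DK p1 p2.
have seg t : 0 <= t <= 1 -> `|p + t *: h - P| < rho by move=> t01; exact: ball_segment.
apply: clin_opnorm_le => [|r]; first by rewrite mulr_ge0// exprn_ge0.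
rewrite !clinE.
pose phi (i : nat) (t : R) : R := match i with
  | 0 => F (p + t *: h) r | 1 => D2 (p + t *: h) h r
  | 2 => D3 (p + t *: h) h h r | 3 => D4 (p + t *: h) h h h r
  | _ => D5 (p + t *: h) h r h end.
have := @taylor_bound _ 4 phi (K * `|h| ^+ 4 * `|r|) 1.
rewrite ler01 lexx => /(_ isT).
rewrite !big_ord_recl big_ord0 /= /bump /= !scale0r !addr0 scale1r !expr1n !mulr1 /= !divr1.
rewrite [2^-1 *: _]mulrC [6^-1 *: _]mulrC !opprD !addrA; apply.
- move=> [|[|[|[|//]]]] t _ t01; [exact: is_derive_F (seg _ _)|exact: is_derive_D2 (seg _ _)|exact: is_derive_D3 (seg _ _)|].
  exact: is_derive_line1 (D4_diff _ _ (seg _ _)).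
- by move=> t /seg/DK.
Qed.

End TaylorEstimates.

(** * Coercive forms and the Riesz representation *)

(** A symmetric form with [c1 * |v|^2 <= B v v <= c2 * |v|^2] makes the Banach
    space a Hilbert space up to equivalence of norms. Testing with [B u] replaces
    every use of the Hahn-Banach theorem below. *)
Section CoerciveForms.
Context {R : realType} {V : completeNormedModType R}.
Variables (B : V -> V -> R) (c1 c2 : R).
Hypothesis (c1_gt0 : 0 < c1) (c2_gt0 : 0 < c2).
Hypothesis B_linear : forall u, linear (B u).
Hypothesis B_sym : forall u v, B u v = B v u.
Hypothesis B_coercive : forall v, c1 * `|v| ^+ 2 <= B v v <= c2 * `|v| ^+ 2.

Lemma formDr u v w : B u (v + w) = B u v + B u w.
Proof. by have := B_linear u 1 v w; rewrite !scale1r. Qed.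
Lemma form0r u : B u 0 = 0.
Proof. by have := B_linear u (-1) 0 0; rewrite scaler0 addr0 scaleN1r addNr. Qed.
Lemma formZr a u v : B u (a *: v) = a * B u v.
Proof. by have := B_linear u a v 0; rewrite !addr0 form0r addr0. Qed.
Lemma formNr u v : B u (- v) = - B u v.
Proof. by rewrite -scaleN1r formZr mulN1r. Qed.
Lemma formBr u v w : B u (v - w) = B u v - B u w.
Proof. by rewrite formDr formNr. Qed.
Lemma formDl u v w : B (u + v) w = B u w + B v w.
Proof. by rewrite !(B_sym _ w) formDr. Qed.
Lemma formZl a u v : B (a *: u) v = a * B u v.
Proof. by rewrite !(B_sym _ v) formZr. Qed.
Lemma formNl u v : B (- u) v = - B u v.
Proof. by rewrite !(B_sym _ v) formNr. Qed.
Lemma formBl u v w : B (u - v) w = B u w - B v w.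
Proof. by rewrite !(B_sym _ w) formBr. Qed.
Lemma form0l u : B 0 u = 0.
Proof. by rewrite B_sym form0r. Qed.

Lemma form_ge0 v : 0 <= B v v.
Proof.
have /andP[h _] := B_coercive v; apply: le_trans h.
by rewrite mulr_ge0 ?exprn_ge0// ltW.
Qed.

Lemma form_bound u v : `|B u v| <= c2 * `|u| * `|v|.
Proof.
have [->|u0] := eqVneq u 0; first by rewrite form0l !normr0 mulr0 mul0r.
have [->|v0] := eqVneq v 0; first by rewrite form0r !normr0 mulr0.
have nu : 0 < `|u| by rewrite normr_gt0.
have nv : 0 < `|v| by rewrite normr_gt0.
pose a := `|u|^-1 *: u; pose b := `|v|^-1 *: v.
have na : `|a| = 1 by rewrite /a normrZ gtr0_norm ?invr_gt0// mulVf// gt_eqF.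
have nb : `|b| = 1 by rewrite /b normrZ gtr0_norm ?invr_gt0// mulVf// gt_eqF.
have -> : B u v = `|u| * `|v| * B a b.
  rewrite /a /b formZl formZr; field; by rewrite !gt_eqF.
have Bab : `|B a b| <= c2.
  have /andP[_ ha] := B_coercive a; have /andP[_ hb] := B_coercive b.
  rewrite na expr1n mulr1 in ha; rewrite nb expr1n mulr1 in hb.
  have h1 := form_ge0 (a - b); have h2 := form_ge0 (a + b).
  rewrite !formBr !formBl (B_sym b a) in h1; rewrite !formDr !formDl (B_sym b a) in h2.
  by rewrite ler_norml; apply/andP; split; lra.
rewrite normrM ger0_norm ?mulr_ge0// mulrC -mulrA; apply: ler_wpM2r => //.
Qed.

Lemma form_continuous u : continuous (B u).
Proof. by apply: (@bounded_linear_continuous _ _ _ _ (c2 * `|u|)) => // x; exact: form_bound. Qed.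

Lemma form_clin u : exists f : 'L(V, R), forall v, f v = B u v.
Proof.
exists (to_clin (B u)) => v; rewrite to_clinE//.
exact: form_continuous.
Qed.

Lemma form_inj x y : (forall r, B x r = B y r) -> x = y.
Proof.
move=> xy; apply/eqP; rewrite -subr_eq0 -normr_eq0 -sqrf_eq0 eq_le exprn_ge0// andbT.
have /andP[h _] := B_coercive (x - y).
rewrite -(ler_pM2l c1_gt0) mulr0 (le_trans h)// formBl xy -formBl subrr form0l//.
Qed.

(** Representation of a bounded functional by the minimizer of the quadratic energy
    [J x = B x x - 2 * phi x]: the parallelogram identity makes minimizing
    sequences Cauchy. *)
Section Riesz.
Variable phi : 'L(V, R).
Let J x := B x x - 2 * phi x.
Let phiD u v : phi (u + v) = phi u + phi v. Proof. exact: linearD. Qed.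
Let phiZ a u : phi (a *: u) = a * phi u. Proof. exact: linearZ. Qed.

Lemma energy_lower_bound x : - (`|phi| ^+ 2 / c1) <= J x.
Proof.
have /andP[h _] := B_coercive x; have := clin_le phi x; rewrite ler_norml => /andP[_ p].
rewrite /J lerBrDr -subr_ge0.
have : 0 <= c1 * (`|x| - `|phi| / c1) ^+ 2 by rewrite mulr_ge0 ?sqr_ge0// ltW.
have -> : c1 * (`|x| - `|phi| / c1) ^+ 2 =
  c1 * `|x| ^+ 2 - 2 * (`|phi| * `|x|) + `|phi| ^+ 2 / c1.
  by field; rewrite gt_eqF.
lra.
Qed.

Let m := inf (range J).

Lemma energy_has_inf : has_inf (range J).
Proof.
split; first by exists (J 0); exists 0.
by exists (- (`|phi| ^+ 2 / c1)) => _ [x _ <-]; exact: energy_lower_bound.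
Qed.

Lemma inf_energy_le x : m <= J x.
Proof. by apply: ge_inf; [exact: energy_has_inf.2|exists x]. Qed.

Lemma minimizer_exists n : exists x, J x < m + n.+1%:R^-1.
Proof.
have e0 : 0 < n.+1%:R^-1 :> R by rewrite invr_gt0.
by have [_ [x _ <-] h] := inf_adherent e0 energy_has_inf; exists x.
Qed.

Let x_ n := sval (cid (minimizer_exists n)).
Lemma minimizer_energy n : J (x_ n) < m + n.+1%:R^-1.
Proof. exact: (svalP (cid (minimizer_exists n))). Qed.

Lemma minimizer_dist n k : c1 * `|x_ n - x_ k| ^+ 2 <= 2 * n.+1%:R^-1 + 2 * k.+1%:R^-1.
Proof.
have /andP[h _] := B_coercive (x_ n - x_ k); apply: (le_trans h).
have := inf_energy_le (2^-1 *: (x_ n + x_ k)); have := minimizer_energy n; have := minimizer_energy k.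
rewrite /J formZr formZl !formDr !formDl ?formNr ?formNl phiZ phiD.
rewrite (B_sym (x_ k) (x_ n)).
move: (n.+1%:R^-1) (k.+1%:R^-1) => en ek h1 h2 h3; lra.
Qed.

(** Comparing the energy at [x_ n] and at [x_ n + t *: r] with the optimal [t]. *)
Lemma minimizer_residual n r : (B (x_ n) r - phi r) ^+ 2 <= (B r r) * n.+1%:R^-1.
Proof.
have [->|r0] := eqVneq r 0.
  by rewrite !form0r linear0 subrr expr0n /= mul0r.
have Br : 0 < B r r.
  have /andP[h _] := B_coercive r; apply: lt_le_trans h.
  by rewrite mulr_gt0// exprn_gt0// normr_gt0.
set d := B (x_ n) r - phi r; pose t := - d / B r r.
have := inf_energy_le (x_ n + t *: r); have := minimizer_energy n.
rewrite /J !formDr !formDl !formZr !formZl phiD phiZ (B_sym r (x_ n)).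
move=> h1 h2.
have : 0 <= 2 * t * d + t ^+ 2 * B r r + n.+1%:R^-1.
  rewrite /d; move: (n.+1%:R^-1) h1 h2 => en h1 h2; lra.
have -> : 2 * t * d + t ^+ 2 * B r r = - (d ^+ 2 / B r r).
  by rewrite /t; field; rewrite gt_eqF.
by rewrite addrC subr_ge0 ler_pdivrMr// mulrC.
Qed.

Lemma minimizer_cvg : exists x : V, x_ @ \oo --> x.
Proof.
suff : cauchy_ex (x_ @ \oo) by move=> /cauchy_exP/cauchy_cvg/cvg_ex.
move=> e e0; pose eta := c1 * e ^+ 2 / 4.
have eta0 : 0 < eta by rewrite divr_gt0// mulr_gt0// exprn_gt0.
have H := near_infty_natSinv_lt (PosNum eta0).
have [N HN] := filter_ex H; exists (x_ N).
apply: filterS H => n /= Hn; rewrite -ball_normE /=.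
rewrite -(ltr_pXn2r (n := 2)) ?nnegrE ?(ltW e0)// -(ltr_pM2l c1_gt0).
rewrite (le_lt_trans (minimizer_dist _ _))//.
have -> : c1 * e ^+ 2 = 2 * eta + 2 * eta by rewrite /eta; field.
by rewrite ltrD// ltr_pM2l.
Qed.

Lemma riesz : exists x, forall r, B x r = phi r.
Proof.
have [x xl] := minimizer_cvg; exists x => r.
apply/eqP; rewrite -subr_eq0 -normr_le0; apply/ler_addgt0Pl => e e0; rewrite addr0.
have H1 : \forall n \near \oo, c2 * `|x - x_ n| * `|r| < e / 2.
  have k0 : 0 < c2 * `|r| + 1 by rewrite ltr_wpDl// mulr_ge0// ltW.
  have d0 : 0 < e / 2 / (c2 * `|r| + 1) by rewrite !divr_gt0.
  move/cvgrPdist_lt : xl => /(_ _ d0); apply: filterS => n.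
  rewrite ltr_pdivlMr//; apply: le_lt_trans.
  by rewrite mulrAC mulrC ler_wpM2l// lerDl.
have H2 : \forall n \near \oo, (B r r) * n.+1%:R^-1 < (e / 2) ^+ 2.
  have k0 : 0 < B r r + 1 by rewrite ltr_wpDl// form_ge0.
  have d0 : 0 < (e / 2) ^+ 2 / (B r r + 1) by rewrite divr_gt0// exprn_gt0// divr_gt0.
  have := near_infty_natSinv_lt (PosNum d0); apply: filterS => n /=.
  rewrite ltr_pdivlMr//; apply: le_lt_trans.
  by rewrite mulrC ler_wpM2l// lerDl.
near \oo => n.
have h1 : c2 * `|x - x_ n| * `|r| < e / 2 by near: n.
have h2 : (B r r) * n.+1%:R^-1 < (e / 2) ^+ 2 by near: n.
have -> : B x r - phi r = B (x - x_ n) r + (B (x_ n) r - phi r) by rewrite formBl; ring.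
rewrite (le_trans (ler_normD _ _))// [e]splitr lerD//.
  by apply: (le_trans (form_bound _ _)); exact: ltW.
have := le_lt_trans (minimizer_residual n r) h2.
move=> h; apply: ltW; rewrite -(ltr_pXn2r (n := 2)) ?nnegrE ?divr_ge0 ?(ltW e0)//.
by rewrite real_normK ?num_real.
Unshelve. all: by end_near. Qed.
End Riesz.

End CoerciveForms.

(** * The energy of paths *)

Section Integrals.
Context {R : realType}.
Local Notation mu := (@lebesgue_measure R).

(** Neither function is assumed measurable: the integral of a nonnegative function
    is a supremum over the simple functions below it. The energy density of a path
    need not be measurable, as only functionals of its velocity are. *)
Lemma ge0_le_integral_dominated d (T : measurableType d) (nu : {measure set T -> \bar R})
    (D : set T) (f1 f2 : T -> \bar R) :
  (forall x, D x -> (0 <= f1 x)%E) -> (forall x, D x -> (f1 x <= f2 x)%E) ->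
  (\int[nu]_(x in D) f1 x <= \int[nu]_(x in D) f2 x)%E.
Proof.
move=> f10 f12; rewrite !ge0_integralE//; last by move=> x Dx; exact: le_trans (f10 _ Dx) (f12 _ Dx).
apply: le_ereal_sup => _ [h /= hf <-]; exists h => // x.
apply: le_trans (hf x) _; rewrite /patch; case: ifPn => // xD.
by apply: f12; rewrite -inE.
Qed.

(** Only the minorant [phi] has to be measurable. *)
Lemma integral_le_scaled (D : set R) (phi G : R -> R) (K : R) :
  measurable D -> 0 < K -> measurable_fun D phi ->
  (forall t, D t -> 0 <= phi t <= K * G t) ->
  (\int[mu]_(t in D) (phi t)%:E <= K%:E * \int[mu]_(t in D) (G t)%:E)%E.
Proof.
move=> mD K0 mphi H.
have -> : (\int[mu]_(t in D) (phi t)%:E = K%:E * \int[mu]_(t in D) (K^-1 * phi t)%:E)%E.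
  under [in RHS]eq_integral do rewrite EFinM.
  rewrite ge0_integralZl_EFin//.
  - by rewrite muleA -EFinM mulfV ?gt_eqF// mul1e.
  - by move=> x /H/andP[h _]; rewrite lee_fin.
  - exact/measurable_EFinP.
  - by rewrite invr_ge0 ltW.
apply: lee_wpmul2l; first by rewrite lee_fin ltW.
apply: ge0_le_integral_dominated => t /H/andP[h1 h2]; rewrite lee_fin.
  by rewrite mulr_ge0// invr_ge0 ltW.
by rewrite mulrC ler_pdivrMr// mulrC.
Qed.

Lemma integral_unit_cst (c : R) : (\int[mu]_(t in `[0%R, 1%R]) c%:E = c%:E)%E.
Proof.
by rewrite integral_cst//= lebesgue_measure_itv/= lte_fin ltr01 -EFinB subr0 mule1.
Qed.

End Integrals.

Section PathEnergy.
Context {R : realType} {V : completeNormedModType R}.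
Variables (M : set V) (g : V -> V -> V -> R) (c1 c2 : R).
Hypothesis g_metric : riemannian_metric M g.
Hypothesis (c1_gt0 : 0 < c1) (c2_gt0 : 0 < c2).
Hypothesis g_bounds : forall y v, M y -> c1 * `|v| ^+ 2 <= g y v v <= c2 * `|v| ^+ 2.
Local Notation mu := (@lebesgue_measure R).
Local Notation I01 := (`[0%R, 1%R]%classic : set R).

Section Path.
Variables (y : V) (p u : R -> V).
Hypothesis Mp : forall t : R, t \in `[0, 1] -> M (p t).
Hypothesis p0 : p 0 = y.
Hypothesis pu : velocity p u.
Let E := path_energy g p u.
Let G t := g (p t) (u t) (u t).

Lemma path_integrand_ge0 t : I01 t -> 0 <= G t.
Proof.
move=> t01; have /andP[h _] := g_bounds (u t) (Mp t01).
by apply: le_trans h; rewrite mulr_ge0 ?exprn_ge0// ltW.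
Qed.

Lemma path_energy_ge0 : (0 <= E)%E.
Proof. by apply: integral_ge0 => t t01; rewrite lee_fin path_integrand_ge0. Qed.

Lemma path_functional_measurable (f : 'L(V, R)) : measurable_fun I01 (fun t => f (u t)).
Proof. by case: pu => H _ _; exact: H. Qed.

Lemma path_functional_sqr (f : 'L(V, R)) (F : R) : 0 < F -> `|f| <= F ->
  (\int[mu]_(t in I01) ((f (u t)) ^+ 2)%:E <= (F ^+ 2 / c1)%:E * E)%E.
Proof.
move=> F0 fF; apply: integral_le_scaled => //.
- by rewrite divr_gt0// exprn_gt0.
- by apply: measurable_funX; exact: path_functional_measurable.
- move=> t t01; rewrite sqr_ge0/=.
  have /andP[h _] := g_bounds (u t) (Mp t01).
  apply: (@le_trans _ _ (F ^+ 2 * `|u t| ^+ 2)).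
    rewrite -exprMn -real_normK ?num_real// ler_pXn2r ?nnegrE ?mulr_ge0 ?(ltW F0)//.
    by rewrite (le_trans (clin_le _ _))// ler_wpM2r.
  rewrite -mulrA ler_wpM2l ?exprn_ge0 ?(ltW F0)//.
  by rewrite mulrC ler_pdivlMr// mulrC.
Qed.

(** Integrates [a <= lam + a ^ 2 / lam]; the free parameter [lam] replaces the
    Cauchy-Schwarz inequality. *)
Lemma path_functional_abs (f : 'L(V, R)) (F lam : R) : 0 < F -> `|f| <= F -> 0 < lam ->
  (\int[mu]_(t in I01) `|f (u t)|%:E <= lam%:E + (F ^+ 2 / c1 / lam)%:E * E)%E.
Proof.
move=> F0 fF l0.
have mf := path_functional_measurable f.
have mf2 : measurable_fun I01 (fun t => lam^-1 * f (u t) ^+ 2).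
  by apply: measurable_funM => //; exact: measurable_funX.
apply: (@le_trans _ _ (\int[mu]_(t in I01) (lam%:E + (lam^-1 * f (u t) ^+ 2)%:E))%E).
  apply: ge0_le_integral_dominated => t _; first by rewrite lee_fin.
  rewrite -EFinD lee_fin.
  have [h|h] := leP `|f (u t)| lam.
    by rewrite (le_trans h)// lerDl mulr_ge0 ?sqr_ge0// invr_ge0 ltW.
  apply: ler_wpDl; first exact: ltW.
  rewrite mulrC ler_pdivlMr// -real_normK ?num_real// expr2.
  by apply: ler_wpM2l => //; exact: ltW.
rewrite ge0_integralD//; last 3 first.
- by move=> t _; rewrite lee_fin ltW.
- by move=> t _; rewrite lee_fin mulr_ge0 ?sqr_ge0// invr_ge0 ltW.
- exact/measurable_EFinP.
rewrite integral_unit_cst; apply: leeD2l.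
under eq_integral do rewrite EFinM.
rewrite ge0_integralZl_EFin//; last 3 first.
- by move=> t _; rewrite lee_fin sqr_ge0.
- by apply/measurable_EFinP; exact: measurable_funX.
- by rewrite invr_ge0 ltW.
rewrite mulrC EFinM -muleA; apply: lee_wpmul2l; first by rewrite lee_fin invr_ge0 ltW.
exact: path_functional_sqr.
Qed.

Lemma path_functional_integrable (f : 'L(V, R)) : (E < +oo)%E ->
  mu.-integrable I01 (EFin \o (fun t => f (u t))).
Proof.
move=> Eoo; apply/integrableP; split.
  by apply/measurable_EFinP; exact: path_functional_measurable.
have F0 : 0 < `|f| + 1 by rewrite ltr_wpDl.
have fF : `|f| <= `|f| + 1 by rewrite lerDl.
apply: (le_lt_trans (path_functional_abs F0 fF ltr01)).
by rewrite lte_add_pinfty ?ltry// lte_mul_pinfty// lee_fin divr_ge0// divr_ge0 ?exprn_ge0 ?(ltW F0) ?ltW.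
Qed.

(** A path of finite energy moves by a controlled amount, as seen by a functional. *)
Lemma path_functional_displacement (f : 'L(V, R)) (F lam : R) (t : R) :
  (E < +oo)%E -> t \in `[0, 1] -> 0 < F -> `|f| <= F -> 0 < lam ->
  `|f (p t - y)| <= lam + F ^+ 2 / c1 / lam * fine E.
Proof.
move=> Eoo t01 F0 fF l0; case: (pu) => _ _ /(_ f t t01); rewrite p0 => ft.
have -> : f (p t - y) = \int[mu]_(s in `[0, t]) f (u s).
  by rewrite linearB /= ft addrC addKr.
have fi := path_functional_integrable f Eoo.
have sub : (`[0, t]%classic : set R) `<=` I01.
  move: t01; rewrite in_itv /= => /andP[_ t1] s /=; rewrite !in_itv /= => /andP[-> h] /=.
  exact: le_trans h t1.
have fit : mu.-integrable (`[0, t]%classic) (EFin \o (fun t => f (u t))).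
  exact: integrableS fi.
apply: le_trans (le_normr_Rintegral _ _) _ => //.
have Efin : E = (fine E)%:E by rewrite fineK// ge0_fin_numE// path_energy_ge0.
have := path_functional_abs F0 fF l0; rewrite Efin -EFinM -EFinD => H.
rewrite -lee_fin; apply: le_trans H.
rewrite /Rintegral fineK; last first.
  by have fn := integrable_norm fit; exact: (integrable_fin_num _ fn).
apply: ge0_subset_integral => //.
by apply/measurable_EFinP/measurableT_comp => //; exact: path_functional_measurable.
Qed.

End Path.
End PathEnergy.

(** * Second order expansion of the Riemannian distance *)

Section DistanceExpansion.
Context {R : realType} {V : completeNormedModType R}.
Variables (M : set V) (g : V -> V -> V -> R) (c1 c2 : R).
Hypothesis g_metric : riemannian_metric M g.
Hypothesis (c1_gt0 : 0 < c1) (c2_gt0 : 0 < c2).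
Hypothesis g_bounds : forall y v, M y -> c1 * `|v| ^+ 2 <= g y v v <= c2 * `|v| ^+ 2.
Local Notation mu := (@lebesgue_measure R).
Local Notation I01 := (`[0%R, 1%R]%classic : set R).

Lemma metric_linear y : M y -> forall u, linear (g y u).
Proof. by move=> /g_metric[]. Qed.
Lemma metric_sym y : M y -> forall u v, g y u v = g y v u.
Proof. by move=> /g_metric[]. Qed.
Lemma metric_coercive y : M y -> forall v, c1 * `|v| ^+ 2 <= g y v v <= c2 * `|v| ^+ 2.
Proof. by move=> My v; exact: g_bounds. Qed.

Variables (y : V).
Hypothesis My : M y.
Variables (L eta : R).
Hypothesis (L_ge0 : 0 <= L) (eta_gt0 : 0 < eta).
Hypothesis g_lip : forall z a, M z -> `|z - y| < eta ->
  `|g z a a - g y a a| <= L * `|z - y| * `|a| ^+ 2.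

Let gl := metric_linear My.
Let gs := metric_sym My.
Let gc := metric_coercive My.
Let K := (1 + c2 ^+ 3 / c1) / c1.

Let K_gt0 : 0 < K.
Proof. by rewrite divr_gt0// addr_gt0// divr_gt0// exprn_gt0. Qed.

(** A path whose energy does not exceed that of the straight line stays within a
    multiple of [|k|] of its starting point; its displacement [x] is tested with
    the functional [g y x]. *)
Lemma low_energy_path_stays (k : V) (p u : R -> V) (t : R) :
  (forall t : R, t \in `[0, 1] -> M (p t)) -> p 0 = y -> velocity p u ->
  (path_energy g p u <= (g y k k)%:E)%E -> k != 0 -> t \in `[0, 1] ->
  `|p t - y| <= K * `|k|.
Proof.
move=> Mp p0 pu Ek k0 t01.
set x := p t - y.
have [->|x0] := eqVneq x 0; first by rewrite normr0 mulr_ge0 ?(ltW K_gt0).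
have nx : 0 < `|x| by rewrite normr_gt0.
have nk : 0 < `|k| by rewrite normr_gt0.
have [f fE] := form_clin c1_gt0 gl gs gc x.
have F0 : 0 < c2 * `|x| by rewrite mulr_gt0.
have fF : `|f| <= c2 * `|x|.
  apply: clin_opnorm_le => [|v]; first exact: ltW.
  by rewrite fE; exact: (form_bound c1_gt0 gl gs gc).
have l0 : 0 < `|k| * `|x| by rewrite mulr_gt0.
have E0 := path_energy_ge0 c1_gt0 g_bounds u Mp.
have Eoo : (path_energy g p u < +oo)%E by apply: le_lt_trans Ek _; rewrite ltry.
have Efin : path_energy g p u \is a fin_num by rewrite ge0_fin_numE.
have fE2 : fine (path_energy g p u) <= c2 * `|k| ^+ 2.
  rewrite -(fineK Efin) lee_fin in Ek; apply: le_trans Ek _.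
  by have /andP[] := gc k.
have := path_functional_displacement c1_gt0 g_bounds Mp p0 pu Eoo t01 F0 fF l0.
rewrite -/x fE (ger0_norm (form_ge0 c1_gt0 gc x)).
have /andP[gx _] := gc x; move=> h.
have h2 : c1 * `|x| ^+ 2 <= `|k| * `|x| * (1 + c2 ^+ 3 / c1).
  apply: le_trans gx _; apply: le_trans h _.
  rewrite mulrDr mulr1 lerD2l.
  apply: le_trans (ler_wpM2l _ fE2) _.
    by rewrite !divr_ge0 ?exprn_ge0// ?ltW.
  rewrite le_eqVlt; apply/orP; left; apply/eqP; field.
  by rewrite !gt_eqF.
rewrite /K mulrAC ler_pdivlMr// -(ler_pM2r nx); lra.
Qed.

(** On such a path the metric differs little from [g y], and pointwise
    [g y u u >= 2 * g y k u - g y k k], whose right-hand side is affine in the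
    velocity and integrates to [g y k k]. *)
Lemma path_energy_lower (k : V) (p u : R -> V) : (K * `|k| < eta) ->
  (forall t : R, t \in `[0, 1] -> M (p t)) -> p 0 = y -> p 1 = y + k -> velocity p u ->
  ((g y k k * (1 - L * K * `|k| / c1))%:E <= path_energy g p u)%E.
Proof.
move=> Keta Mp p0 p1 pu.
set th := L * K * `|k| / c1.
have th0 : 0 <= th.
  by apply: divr_ge0 (ltW c1_gt0); apply: mulr_ge0 => //; exact: mulr_ge0 L_ge0 (ltW K_gt0).
have gk0 : 0 <= g y k k by exact: (form_ge0 c1_gt0 gc).
have E0 := path_energy_ge0 c1_gt0 g_bounds u Mp.
have [k0|k0] := eqVneq k 0.
  by rewrite /th k0 (form0l gl gs) mul0r.
have [Ek|Ek] := leP (path_energy g p u) (g y k k)%:E; last first.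
  apply: le_trans (ltW Ek); rewrite lee_fin ler_piMr// gerDl oppr_le0//.
have [f fE] := form_clin c1_gt0 gl gs gc k.
have Eoo : (path_energy g p u < +oo)%E by apply: le_lt_trans Ek _; rewrite ltry.
have Efin : path_energy g p u \is a fin_num by rewrite ge0_fin_numE.
have fi := path_functional_integrable c1_gt0 g_bounds Mp pu f Eoo.
have mf := path_functional_measurable pu f.
(* Positive part of the affine minorant: a measurable nonnegative function below
   the energy density. *)
pose phi t := Num.max 0 (2 * f (u t) - g y k k).
have H1 : (\int[mu]_(t in I01) (phi t)%:E <= (1 + th)%:E * path_energy g p u)%E.
  apply: integral_le_scaled => //.
  - by rewrite ltr_wpDr.
  - apply: measurable_maxr => //; apply: measurable_funB => //.
    exact: measurable_funM.
  - move=> t t01; rewrite /phi le_max lexx /= ge_max.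
    have stay := low_energy_path_stays Mp p0 pu Ek k0 t01.
    have Gt0 : 0 <= g (p t) (u t) (u t) 
      by exact: (@path_integrand_ge0 _ _ M g c1 c2 c1_gt0 g_bounds p u Mp t t01).
    rewrite mulr_ge0 ?addr_ge0//=.
    have := form_ge0 c1_gt0 gc (u t - k).
    rewrite (formDr gl) !(formDl gl gs) !(formNr gl) !(formNl gl gs) (gs (u t) k) -(fE (u t)) => h.
    have h2 := g_lip (u t) (Mp _ t01) (le_lt_trans stay Keta).
    have h3 : `|g (p t) (u t) (u t) - g y (u t) (u t)| <= th * g (p t) (u t) (u t).
      apply: (le_trans h2).
      have /andP[h4 _] := g_bounds (u t) (Mp _ t01).
      rewrite /th -[leRHS]mulrA ler_pM//; rewrite ?mulr_ge0//.
      + by rewrite -mulrA ler_wpM2l.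
      + by rewrite mulrC ler_pdivlMr// mulrC.
    move: h3; rewrite ler_norml => /andP[h3 _]; move: h h3; rewrite /th; lra.
have H2 : ((g y k k)%:E <= \int[mu]_(t in I01) (phi t)%:E)%E.
  pose psi t := 2 * f (u t) - g y k k.
  have mI : measurable (I01 : set (measurableTypeR R)) by exact: measurable_itv.
  have f2i : mu.-integrable I01 (EFin \o (fun t => 2 * f (u t))).
    by have := integrableZl mI 2 fi; apply: eq_integrable => // t _ /=; rewrite EFinM.
  have ci : mu.-integrable I01 (EFin \o (fun _ : R => g y k k)).
    apply/integrableP; split; first exact: measurable_cst.
    by rewrite /= (integral_unit_cst `|g y k k|) ltry.
  have psii : mu.-integrable I01 (EFin \o psi).
    by have := integrableB mI f2i ci; apply: eq_integrable => // t _ /=; rewrite EFinB.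
  have -> : (g y k k)%:E = (\int[mu]_(t in I01) (psi t)%:E)%E.
    rewrite -(fineK (integrable_fin_num mI psii)) -/(Rintegral mu I01 psi).
    rewrite RintegralB// RintegralZl// Rintegral_cst//.
    case: (pu) => _ _ /(_ f 1); rewrite in_itv /= ler01 lexx => /(_ isT).
    rewrite p0 p1 linearD /= => /addrI <-; rewrite fE.
    rewrite /= lebesgue_measure_itv/= lte_fin ltr01 -EFinB subr0 /= mulr1; congr EFin; ring.
  rewrite integralE.
  have -> : (\int[mu]_(t in I01) (phi t)%:E = \int[mu]_(t in I01) ((fun t => (psi t)%:E)^\+ t))%E.
    by apply: eq_integral => t _; rewrite funeposE /phi EFin_max maxC.
  rewrite -[leRHS]sube0; apply: leeB => //.
  exact: integral_ge0.
have H3 := le_trans H2 H1.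
rewrite -(fineK Efin) -EFinM lee_fin in H3; rewrite -(fineK Efin) lee_fin.
have fE0 : 0 <= fine (path_energy g p u) by rewrite fine_ge0.
have [t1|t1] := leP 1 th.
  by apply: le_trans fE0; rewrite mulr_ge0_le0// subr_le0.
nra.
Qed.

End DistanceExpansion.

Section StraightPath.
Context {R : realType} {V : completeNormedModType R}.
Local Notation mu := (@lebesgue_measure R).

Lemma straight_velocity (y k : V) : velocity (fun t : R => y + t *: k) (cst k).
Proof.
split.
- by move=> f; exact: (measurable_cst (f k)).
- by rewrite (integral_unit_cst (`|k| ^+ 2)) ltry.
- move=> f t; rewrite in_itv /= => /andP[t0 t1].
  rewrite scale0r addr0 linearD linearZ /=; congr (_ + _).
  rewrite Rintegral_cst//= lebesgue_measure_itv /= lte_fin.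
  move: t0; rewrite le_eqVlt => /orP[/eqP<-|->].
    by rewrite ltxx /= mulr0 scale0r.
  by rewrite -EFinB subr0 /= mulrC.
Qed.

End StraightPath.

Section DistanceAsymptotics.
Context {R : realType} {V : completeNormedModType R}.
Variables (M : set V) (g : V -> V -> V -> R) (c1 c2 : R).
Hypothesis g_metric : riemannian_metric M g.
Hypothesis (c1_gt0 : 0 < c1) (c2_gt0 : 0 < c2).
Hypothesis g_bounds : forall y v, M y -> c1 * `|v| ^+ 2 <= g y v v <= c2 * `|v| ^+ 2.

Variables (y : V).
Hypothesis My : M° y.
Variables (L eta : R).
Hypothesis (L_ge0 : 0 <= L) (eta_gt0 : 0 < eta).
Hypothesis g_lip : forall z a, M z -> `|z - y| < eta ->
  `|g z a a - g y a a| <= L * `|z - y| * `|a| ^+ 2.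

Let My' : M y := interior_subset My.
Let gl := metric_linear g_metric My'.
Let gs := metric_sym g_metric My'.
Let gc := metric_coercive g_bounds My'.
Let K := (1 + c2 ^+ 3 / c1) / c1.

Let K_gt0 : 0 < K.
Proof. by rewrite divr_gt0// addr_gt0// divr_gt0// exprn_gt0. Qed.

(** The straight line bounds the distance from above. *)
Lemma straight_energy_le (k : V) :
  (forall t : R, 0 <= t <= 1 -> M (y + t *: k)) -> `|k| < eta ->
  (path_energy g (fun t : R => y + t *: k)%R (cst k) <= (g y k k + L * `|k| ^+ 3)%:E)%E.
Proof.
move=> Mt keta; rewrite /path_energy -(integral_unit_cst (_ + _)).
apply: ge0_le_integral_dominated => t /=; rewrite in_itv /= => t01; rewrite lee_fin.
  have /andP[h _] := g_bounds k (Mt t t01).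
  by apply: le_trans h; rewrite mulr_ge0// ?exprn_ge0// ltW.
have tk : `|y + t *: k - y| <= `|k|.
  case/andP: t01 => t0 t1.
  by rewrite addrC addKr normrZ ger0_norm// ler_piMl.
have kt := le_lt_trans tk keta; have := g_lip k (Mt _ t01) kt.
rewrite ler_norml => /andP[_]; rewrite lerBlDl => h; apply: (le_trans h).
rewrite lerD2l (exprS _ 2) [leRHS]mulrA ler_wpM2r ?exprn_ge0//.
by rewrite ler_wpM2l.
Qed.

(** The squared distance [q] to [y + s *: h] is [s ^+ 2 * g y h h] up to an error
    that is small compared to [s ^+ 2]. *)
Lemma dist_expansion (h : V) (e : R) : 0 < e -> exists2 s0, 0 < s0 &
  forall s : R, `|s| < s0 -> M (y + s *: h) /\
    exists q, [/\ 0 <= q, riemannian_dist M g y (y + s *: h) = (Num.sqrt q)%:E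
      & `|q - s ^+ 2 * g y h h| <= e * s ^+ 2].
Proof.
move=> e0; have [r r0 Mr] : exists2 r : R, 0 < r & forall x, `|x - y| < r -> M x.
  have /nbhs_ballP[r /= r0 H] : nbhs y M by exact: My.
  by exists r => // x xy; apply: H; rewrite -ball_normE /= distrC.
(* Sum of the third order errors of the lower and the upper energy bound. *)
pose A := c2 * `|h| ^+ 2 * (L * K * `|h| / c1) + L * `|h| ^+ 3.
have A0 : 0 <= A.
  have hh : 0 <= L * K * `|h| / c1.
    by rewrite divr_ge0 ?(ltW c1_gt0)//; apply: mulr_ge0 => //; exact: mulr_ge0 L_ge0 (ltW K_gt0).
  by rewrite addr_ge0// mulr_ge0// ?exprn_ge0// mulr_ge0 ?exprn_ge0// ltW.
have h1 : 0 < `|h| + 1 by rewrite ltr_wpDl.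
have A1 : 0 < A + 1 by rewrite ltr_wpDl.
exists (Num.min (Num.min (r / (`|h| + 1)) (eta / (`|h| + 1)))
        (Num.min (eta / K / (`|h| + 1)) (e / (A + 1)))).
  rewrite !lt_min (divr_gt0 r0)// (divr_gt0 eta_gt0)// (divr_gt0 e0)// !andbT /=.
  exact: divr_gt0 (divr_gt0 eta_gt0 K_gt0) h1.
move=> s; rewrite !lt_min => /andP[/andP[]].
rewrite !(ltr_pdivlMr _ _ h1) (ltr_pdivlMr _ _ A1) => sr seta /andP[sK sA].
have kle : `|s *: h| <= `|s| * (`|h| + 1) by rewrite normrZ ler_wpM2l// lerDl.
have k1 : `|s *: h| < r by exact: le_lt_trans kle sr.
have k2 : `|s *: h| < eta by exact: le_lt_trans kle seta.
have k3 : K * `|s *: h| < eta by rewrite mulrC -(ltr_pdivlMr _ _ K_gt0); exact: le_lt_trans kle sK.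
have Mt t : 0 <= t <= 1 -> M (y + t *: (s *: h)).
  case/andP => t0 t1; apply: Mr; rewrite addrC addKr normrZ ger0_norm//.
  by apply: le_lt_trans k1; rewrite ler_piMl.
set k := s *: h in k1 k2 k3 Mt *.
have Mk : M (y + k) by have := Mt 1; rewrite scale1r; apply; rewrite ler01 lexx.
split => //.
set S := [set e | exists p u : R -> V,
    [/\ forall t, t \in `[0, 1] -> M (p t), p 0 = y, p 1 = y + k, velocity p u
      & e = path_energy g p u]].
have up : (ereal_inf S <= (g y k k + L * `|k| ^+ 3)%:E)%E.
  apply: le_trans (straight_energy_le Mt k2); apply: ereal_inf_lbound.
  exists (fun t : R => y + t *: k), (cst k); split => //.
  - by rewrite scale0r addr0.
  - by rewrite scale1r.
  - exact: straight_velocity.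
have lo : ((g y k k * (1 - L * K * `|k| / c1))%:E <= ereal_inf S)%E.
  apply: le_ereal_inf_tmp => _ [p [u [Mp p0 p1 pu ->]]].
  exact: (path_energy_lower g_metric c1_gt0 c2_gt0 g_bounds My' L_ge0 g_lip k3).
have lo0 : (0 <= ereal_inf S)%E.
  apply: le_ereal_inf_tmp => _ [p [u [Mp p0 p1 pu ->]]].
  exact: (path_energy_ge0 c1_gt0 g_bounds u Mp).
have fS : ereal_inf S \is a fin_num.
  by rewrite ge0_fin_numE// (le_lt_trans up)// ltry.
exists (fine (ereal_inf S)); split; first exact: fine_ge0.
  by rewrite /riemannian_dist -/S -{1}(fineK fS).
move: up lo; rewrite -(fineK fS) !lee_fin /=.
move: (fine _) => q.
have -> : g y k k = s ^+ 2 * g y h h by rewrite /k (formZr gl) (formZl gl gs) expr2 mulrA.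
have -> : `|k| = `|s| * `|h| by rewrite normrZ.
move=> up lo.
have s2 : s ^+ 2 = `|s| ^+ 2 by rewrite real_normK ?num_real.
have gh : 0 <= g y h h <= c2 * `|h| ^+ 2.
  by rewrite (form_ge0 c1_gt0 gc); have /andP[] := gc h.
have As : A * `|s| <= e by rewrite mulrC (le_trans _ (ltW sA))// ler_wpM2l// lerDl.
have As2 : A * `|s| * s ^+ 2 <= e * s ^+ 2 by rewrite ler_wpM2r// sqr_ge0.
have a1 : L * (`|s| * `|h|) ^+ 3 <= A * `|s| * s ^+ 2.
  rewrite s2 /A.
  have -> : L * (`|s| * `|h|) ^+ 3 = (L * `|h| ^+ 3) * `|s| * `|s| ^+ 2 by ring.
  rewrite !mulrDl lerDr.
  have hh : 0 <= L * K * `|h| / c1.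
    by rewrite divr_ge0 ?(ltW c1_gt0)//; apply: mulr_ge0 => //; exact: mulr_ge0 L_ge0 (ltW K_gt0).
  apply: mulr_ge0; last exact: exprn_ge0.
  apply: mulr_ge0 => //; apply: mulr_ge0 hh.
  by apply: mulr_ge0 (exprn_ge0 _ _) => //; exact: ltW.
have a2 : s ^+ 2 * g y h h * (L * K * (`|s| * `|h|) / c1) <= A * `|s| * s ^+ 2.
  have hh : 0 <= L * K * `|h| / c1.
    by rewrite divr_ge0 ?(ltW c1_gt0)//; apply: mulr_ge0 => //; exact: mulr_ge0 L_ge0 (ltW K_gt0).
  have -> : s ^+ 2 * g y h h * (L * K * (`|s| * `|h|) / c1) =
     (g y h h * (L * K * `|h| / c1)) * `|s| * s ^+ 2 by ring.
  rewrite ler_wpM2r ?sqr_ge0// ler_wpM2r// /A.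
  have [_ gh2] := andP gh.
  apply: le_trans (ler_wpM2r hh gh2) _; rewrite lerDl mulr_ge0// exprn_ge0//.
rewrite ler_norml; apply/andP; split.
  move: lo; rewrite mulrBr mulr1 => lo; lra.
lra.
Qed.

Variable W : V * V -> R.
Hypothesis W_consistent : locally_consistent M g W.

(** The same expansion for [W], by local consistency. It is needed only pointwise
    in [y]: all uniformity comes from the smoothness of [W]. *)
Lemma consistent_expansion (h : V) (e : R) : 0 < e -> exists2 s0, 0 < s0 &
  forall s : R, `|s| < s0 -> `|W (y, y + s *: h) - s ^+ 2 * g y h h| <= e * s ^+ 2.
Proof.
move=> e0; have [C [d [d0 HW]]] := W_consistent My'.
have e20 : 0 < e / 2 by rewrite divr_gt0.
have [s0 s00 Hs] := dist_expansion h e20.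
pose G := g y h h + e.
have G0 : 0 < G by rewrite ltr_wpDl// (form_ge0 c1_gt0 gc).
pose D := `|C| * (G * Num.sqrt G) + 1.
have D0 : 0 < D by rewrite ltr_wpDl// !mulr_ge0 ?sqrtr_ge0// ltW.
have sG : 0 < Num.sqrt G by rewrite sqrtr_gt0.
exists (Num.min s0 (Num.min (d / Num.sqrt G) (e / 2 / D))).
  by rewrite !lt_min s00 !divr_gt0.
move=> s; rewrite !lt_min => /andP[ss0]; rewrite (ltr_pdivlMr _ _ sG) (ltr_pdivlMr _ _ D0) => /andP[sd sD].
have [Ms [q [q0 dq qs]]] := Hs s ss0.
have qG : q <= s ^+ 2 * G.
  move: qs; rewrite ler_norml => /andP[_].
  have := sqr_ge0 s; rewrite /G; move: (s ^+ 2) => S S0; nra.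
have sqG : Num.sqrt q <= `|s| * Num.sqrt G.
  by apply: le_trans (ler_wsqrtr qG) _; rewrite sqrtrM ?sqr_ge0// sqrtr_sqr.
have := HW _ Ms; rewrite dq lte_fin (le_lt_trans sqG)// => /(_ isT) /=.
rewrite sqr_sqrtr// => H.
have b1 : C * Num.sqrt q ^+ 3 <= e / 2 * s ^+ 2.
  apply: (@le_trans _ _ (`|C| * ((`|s| * Num.sqrt G) ^+ 3))).
    apply: le_trans (ler_norm _) _; rewrite normrM ler_wpM2l//.
    by rewrite ger0_norm ?exprn_ge0 ?sqrtr_ge0// lerXn2r ?nnegrE ?mulr_ge0 ?sqrtr_ge0.
  have -> : `|C| * (`|s| * Num.sqrt G) ^+ 3 = (`|s| * (`|C| * (Num.sqrt G ^+ 2 * Num.sqrt G))) * `|s| ^+ 2 by ring.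
  rewrite sqr_sqrtr ?(ltW G0)// real_normK ?num_real//.
  rewrite ler_wpM2r ?sqr_ge0//; apply: le_trans (ltW sD).
  by rewrite ler_wpM2l// lerDl.
have -> : W (y, y + s *: h) - s ^+ 2 * g y h h = (W (y, y + s *: h) - q) + (q - s ^+ 2 * g y h h) by ring.
apply: le_trans (ler_normD _ _) _.
have -> : e * s ^+ 2 = e / 2 * s ^+ 2 + e / 2 * s ^+ 2 by field.
by apply: lerD => //; exact: le_trans H b1.
Qed.

End DistanceAsymptotics.

Section MetricLipschitz.
Context {R : realType} {V Y : completeNormedModType R}.
Variables (M : set V) (g : V -> V -> V -> R) (iota : 'L(V, Y)) (G : Y * V * V -> R).
Hypothesis g_metric : riemannian_metric M g.
Hypothesis G_smooth : Ck 3 setT G.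
Hypothesis Gg : forall y v w, M y -> G (iota y, v, w) = g y v w.

(** The derivative of [G] is bounded near [(iota y, 0, 0)], which gives the estimate
    for short vectors [a]; homogeneity of the quadratic form extends it to all [a]. *)
Lemma metric_locally_lipschitz y : M y -> exists L eta : R,
  [/\ 0 <= L, 0 < eta & forall z a, M z -> `|z - y| < eta ->
  `|g z a a - g y a a| <= L * `|z - y| * `|a| ^+ 2].
Proof.
move=> My; have [DG CDG GD] := Ck_succ G_smooth.
pose P : Y * V * V := (iota y, 0, 0).
have intT (q : Y * V * V) : setT° q by rewrite interiorT.
have [rho [K [rho0 K0 DK]]] := continuous_bounded (Ck_continuous CDG (intT P)).
pose sig := rho / 2; have sig0 : 0 < sig by rewrite divr_gt0.
have i0 : 0 < `|iota| + 1 by rewrite ltr_wpDl.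
exists (K * `|iota| / sig ^+ 2), (rho / (`|iota| + 1)); split.
- exact: divr_ge0 (mulr_ge0 K0 (normr_ge0 _)) (exprn_ge0 _ (ltW sig0)).
- exact: divr_gt0.
move=> z a Mz; rewrite ltr_pdivlMr// => zy.
have izy : `|iota z - iota y| <= `|iota| * `|z - y|.
  by rewrite -linearB; exact: clin_le.
have small b : `|b| = sig -> `|g z b b - g y b b| <= K * `|iota| * `|z - y|.
  move=> bs.
  pose h : Y * V * V := (iota z - iota y, 0, 0).
  have seg (t : R) : 0 <= t <= 1 -> `|((iota y, b, b) : Y * V * V) + t *: h - P| < rho.
    have bsig : `|b| < rho by rewrite bs ltr_pdivrMr// ltr_pMr// ltr1n.
    move=> t01; apply: ball_segment => //.
      by rewrite !prod_normE /= !gt_max subrr normr0 subr0 rho0 bsig.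
    rewrite !prod_normE /= !gt_max !addr0 !subr0 bsig !andbT addrC addKr.
    rewrite (le_lt_trans izy)// mulrC (le_lt_trans _ zy)// ler_wpM2l// lerDl//.
  have dphi (t : R) : 0 <= t <= 1 ->
      is_derive t 1 (fun s : R => G ((iota y, b, b) + s *: h)) (DG ((iota y, b, b) + t *: h) h).
    by move=> t01; apply: is_derive_line1; exact: GD.
  have [c c01] := mvt_le ler01 dphi.
  have -> : G ((iota y, b, b) + 1 *: h) = g z b b.
    rewrite scale1r -Gg//; congr G; rewrite /h.
    by congr ((_, _), _); rewrite /= ?addr0// addrC subrK.
  rewrite scale0r addr0 Gg// => ->; rewrite mulr1.
  apply: le_trans (clin_le _ _) _; rewrite -mulrA ler_pM//; first exact/DK/seg.
  by rewrite !prod_normE /= !ge_max izy normr0 !mulr_ge0.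
have gz := metric_linear g_metric Mz; have gy := metric_linear g_metric My.
have gzs := metric_sym g_metric Mz; have gys := metric_sym g_metric My.
have [->|a0] := eqVneq a 0.
  by rewrite (form0r gz) (form0r gy) subrr !normr0 expr0n /= mulr0.
have na : 0 < `|a| by rewrite normr_gt0.
pose b := (sig / `|a|) *: a.
have nb : `|b| = sig.
  by rewrite /b normrZ (ger0_norm (divr_ge0 (ltW sig0) (ltW na))) divfK// gt_eqF.
have ab : a = (`|a| / sig) *: b.
  by rewrite /b scalerA [X in X *: _](_ : _ = 1) ?scale1r//; field; rewrite !gt_eqF.
clearbody b; have := small b nb; rewrite {1 2 3 4}ab.
rewrite !(formZr gz) !(formZr gy) !(formZl gz gzs) !(formZl gy gys).
move: (g z b b) (g y b b) => A B AB.
have -> : `|a| / sig * (`|a| / sig * A) - `|a| / sig * (`|a| / sig * B) = (`|a| / sig) ^+ 2 * (A - B) by ring.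
rewrite normrM ger0_norm ?sqr_ge0//.
have -> : K * `|iota| / sig ^+ 2 * `|z - y| * `|a| ^+ 2 = (`|a| / sig) ^+ 2 * (K * `|iota| * `|z - y|).
  by field; rewrite gt_eqF.
by rewrite ler_wpM2l ?sqr_ge0.
Qed.

End MetricLipschitz.

(** * Derivatives of the functional on the diagonal *)

Section DirectionalDerivatives.
Context {R : realType} {V U : normedModType R}.

Lemma derive_line_eq (f : V -> U) (y k : V) (d : U) :
  is_derive (0 : R) 1 (fun t : R => f (y + t *: k)) d -> 'D_k f y = d.
Proof.
move=> [_ <-]; rewrite /derive.
suff -> : (fun h : R => h^-1 *: ((f \o shift y) (h *: k) - f y)) =
  (fun h : R => h^-1 *: (((fun t : R => f (y + t *: k)) \o shift 0) (h *: 1) - f (y + 0 *: k))) by [].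
by apply/funext => h /=; rewrite scale0r !addr0 [h *: 1]mulr1 (addrC y).
Qed.

Lemma diff_locally_constant (f : V -> U) (df : V -> U) (p h : V) (c : U) (d : R) :
  is_diff p f df -> 0 < d -> (forall t : R, `|t| < d -> f (p + t *: h) = c) -> df h = 0.
Proof.
move=> fd d0 fc.
have H : is_derive (0 : R) 1 (fun t : R => f (p + t *: h)) (df h).
  have p0 : p + (0 : R) *: h = p by rewrite scale0r addr0.
  have [d1 <-] : is_diff (p + (0 : R) *: h) f df by rewrite p0.
  exact: is_derive_line.
have C : is_derive (0 : R) 1 (fun t : R => f (p + t *: h)) 0.
  apply: (@near_eq_is_derive _ _ _ (cst c)).
  by have := @nbhs0_lt R R _ d0; apply: filterS => t td; rewrite /= fc.
by rewrite -(@derive_val _ _ _ _ _ _ _ H) (@derive_val _ _ _ _ _ _ _ C).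
Qed.

End DirectionalDerivatives.

(** A polynomial [s * a + s ^+ 2 * b] that is small compared to [s ^+ 2] vanishes. *)
Lemma quadratic_zero (R : realType) (a b : R) :
  (forall e, 0 < e -> exists2 s0, 0 < s0 &
    forall s, `|s| < s0 -> `|s * a + s ^+ 2 * b| <= e * s ^+ 2) -> a = 0 /\ b = 0.
Proof.
move=> H.
have b0 : b = 0.
  apply/eqP; rewrite -normr_le0; apply/ler_addgt0Pl => e e0; rewrite addr0.
  have [s0 s00 Hs] := H e e0; pose s := s0 / 2.
  have sp : 0 < s by rewrite divr_gt0.
  have ss0 : `|s| < s0 by rewrite gtr0_norm// ltr_pdivrMr// ltr_pMr// ltr1n.
  have h1 := Hs s ss0; have := Hs (- s); rewrite normrN sqrrN => /(_ ss0) h2.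
  have s2 : 0 < s ^+ 2 by rewrite exprn_gt0.
  rewrite -(ler_pM2l s2) -{1}(gtr0_norm s2) -normrM.
  move: h1 h2; rewrite !ler_norml mulNr => /andP[h1 h2] /andP[h3 h4].
  by apply/andP; split; lra.
split=> //; rewrite b0 in H.
apply/eqP; rewrite -normr_le0; apply/ler_addgt0Pl => e e0; rewrite addr0.
have [s0 s00 Hs] := H 1 ltr01.
pose s := Num.min (s0 / 2) e.
have sp : 0 < s by rewrite lt_min divr_gt0.
have ss0 : `|s| < s0.
  by rewrite gtr0_norm// (@le_lt_trans _ _ (s0 / 2)) ?ge_min ?lexx// ltr_pdivrMr// ltr_pMr// ltr1n.
have := Hs s ss0; rewrite mulr0 addr0 mul1r normrM gtr0_norm// expr2 ler_pM2l//.
by move=> /le_trans; apply; rewrite ge_min lexx orbT.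
Qed.

(** The expansion of [W (y, y + s *: h)] determines the value, the gradient and one
    second derivative of [W] on the diagonal; differentiating these identities
    along the diagonal gives the remaining derivatives used below. *)
Section DerivativesOnDiagonal.
Context {R : realType} {V : completeNormedModType R}.
Let E := (V * V)%type.
Variables (W : E -> R) (D1 : E -> 'L(E, R)) (D2 : E -> 'L(E, 'L(E, R)))
  (D3 : E -> 'L(E, 'L(E, 'L(E, R)))).
Variables (y0 : V) (rho : R).
Let P : E := (y0, y0).
Hypothesis W_diff : forall x, `|x - P| < rho -> is_diff x W (D1 x).
Hypothesis D1_diff : forall x, `|x - P| < rho -> is_diff x D1 (D2 x).
Hypothesis D2_diff : forall x, `|x - P| < rho -> is_diff x D2 (D3 x).
Hypothesis D3_bounded : exists K, forall x, `|x - P| < rho -> `|D3 x| <= K.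
Variable g : V -> V -> V -> R.
Hypothesis g_linear : forall y, `|y - y0| < rho -> forall u, linear (g y u).
Hypothesis g_sym : forall y, `|y - y0| < rho -> forall u v, g y u v = g y v u.
Hypothesis W_expansion : forall y, `|y - y0| < rho -> forall h e, 0 < e ->
  exists2 s0, 0 < s0 & forall s : R, `|s| < s0 ->
    `|W (y, y + s *: h) - s ^+ 2 * g y h h| <= e * s ^+ 2.

Lemma diag_ball y : `|y - y0| < rho -> `|((y, y) : E) - P| < rho.
Proof. by move=> yr; rewrite prod_normE /= gt_max yr. Qed.

Lemma line_in_ball (N : normedModType R) (x q h : N) : `|x - q| < rho ->
  exists2 d : R, 0 < d & forall t, `|t| < d -> `|x + t *: h - q| < rho.
Proof.
move=> xq; have h1 : 0 < `|h| + 1 by rewrite ltr_wpDl.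
exists ((rho - `|x - q|) / (`|h| + 1)); first by rewrite divr_gt0// subr_gt0.
move=> t; rewrite ltr_pdivlMr// => th.
rewrite addrAC (le_lt_trans (ler_normD _ _))// -ltrBrDl normrZ.
by rewrite (le_lt_trans _ th)// ler_wpM2l// lerDl.
Qed.

Lemma D2_sym x a b : `|x - P| < rho -> D2 x a b = D2 x b a.
Proof.
move=> xr; have [d d0 _] := line_in_ball 0 xr.
have r0 : 0 < rho - `|x - P| by rewrite subr_gt0.
apply: (@second_derivative_sym _ _ W (fun x h => D1 x h) (fun k h => D2 x k h) x _ r0).
- move=> z zx; have zr : `|z - P| < rho.
    have -> : z - P = (z - x) + (x - P) by rewrite addrA subrK.
    by rewrite (le_lt_trans (ler_normD _ _))// -ltrBrDr.
  by have [d1 ->] := W_diff zr.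
- by move=> h k u v; rewrite clinD2 clinZ2.
- move=> e e0; have [d1 e1] := D1_diff xr.
  have [dd dd0 H] := differentiable_eps d1 e0; exists dd => // k h kd.
  have -> : D1 (x + k) h - D1 x h - D2 x k h = (D1 (x + k) - D1 x - D2 x k) h by [].
  apply: (le_trans (clin_le _ _)); rewrite ler_wpM2r//.
  by have := H k kd; rewrite e1.
Qed.

Lemma D3_sym12 x a b c : `|x - P| < rho -> D3 x a b c = D3 x b a c.
Proof.
move=> xr; have r0 : 0 < rho - `|x - P| by rewrite subr_gt0.
apply: (@second_derivative_sym _ _ (fun z => D1 z c) (fun x h => D2 x h c)
  (fun k h => D3 x k h c) x _ r0).
- move=> z zx; have zr : `|z - P| < rho.
    have -> : z - P = (z - x) + (x - P) by rewrite addrA subrK.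
    by rewrite (le_lt_trans (ler_normD _ _))// -ltrBrDr.
  by have [d1 ->] := diff_lin1 c (D1_diff zr).
- by move=> h k u v; rewrite clinD3 clinZ3.
- move=> e e0; pose e' := e / (`|c| + 1).
  have c1 : 0 < `|c| + 1 by rewrite ltr_wpDl.
  have e'0 : 0 < e' by rewrite divr_gt0.
  have [d1 e1] := D2_diff xr.
  have [dd dd0 H] := differentiable_eps d1 e'0; exists dd => // k h kd.
  have -> : D2 (x + k) h c - D2 x h c - D3 x k h c = (D2 (x + k) - D2 x - D3 x k) h c by [].
  apply: (le_trans (clin_le _ _)).
  apply: (@le_trans _ _ (e' * `|k| * `|h| * `|c|)).
    rewrite ler_wpM2r//; apply: (le_trans (clin_le _ _)); rewrite ler_wpM2r//.
    by have := H k kd; rewrite e1.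
  rewrite mulrC mulrA mulrA ler_wpM2r// ler_wpM2r//.
  by rewrite /e' mulrA ler_pdivrMr// mulrC ler_wpM2l ?(ltW e0)// lerDl.
Qed.

Lemma D3_sym23 x a b c : `|x - P| < rho -> D3 x a b c = D3 x a c b.
Proof.
move=> xr; apply/eqP; rewrite -subr_eq0; apply/eqP.
have [d d0 H] := line_in_ball a xr.
have e1 (u v : E) : is_diff x (fun z => D2 z u v) (fun k => D3 x k u v).
  by have [dd ee] := diff_lin1 u (D2_diff xr); have := is_diff_eval v dd; rewrite ee.
apply: (@diff_locally_constant _ _ _ ((fun z => D2 z b c) - (fun z => D2 z c b))
  ((fun k => D3 x k b c) - (fun k => D3 x k c b)) x a 0 d) => // t /H tr.
by rewrite !fctE D2_sym// subrr.
Qed.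

(** A function that is constant on the diagonal has zero derivative along it. *)
Lemma diag_constant (N : normedModType R) (f : E -> N) (df : E -> N) y k (c : N) :
  `|y - y0| < rho -> (forall x, `|x - y0| < rho -> f (x, x) = c) ->
  is_diff ((y, y) : E) f df -> df (k, k) = 0.
Proof.
move=> yr fc fd; have [d d0 H] := line_in_ball k yr.
apply: (diff_locally_constant fd d0) => t /H tr.
by apply: fc.
Qed.

Lemma second_order_expansion y h : `|y - y0| < rho ->
  W (y, y) = 0 /\ D1 (y, y) (0, h) = 0 /\ D2 (y, y) (0, h) (0, h) = 2 * g y h h.
Proof.
move=> yr.
have W0 : W (y, y) = 0.
  have [s0 s00] := W_expansion yr h ltr01.
  move=> /(_ 0); rewrite normr0 scale0r addr0 expr0n /= mul0r subr0 mulr0 normr_le0.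
  by move=> /(_ s00)/eqP.
split=> //.
pose k : E := (0, h).
have [K DK] := D3_bounded.
have [d d0 Hd] := line_in_ball k (diag_ball yr).
suff [-> B0] : D1 (y, y) k = 0 /\ 2^-1 * D2 (y, y) k k - g y h h = 0.
  split=> //; move/eqP: B0; rewrite subr_eq0 => /eqP <-; rewrite mulrA divff ?mul1r//.
apply: quadratic_zero => e e0.
have [s0 s00 Hs] := W_expansion yr h (divr_gt0 e0 (ltr0Sn R 1) : 0 < e / 2).
pose C := `|K| * `|k| ^+ 3 + 1.
have C0 : 0 < C by rewrite ltr_wpDl// mulr_ge0 ?exprn_ge0.
exists (Num.min s0 (Num.min d (e / 2 / C))); first by rewrite !lt_min s00 d0 !divr_gt0.
move=> s; rewrite !lt_min => /andP[ss0 /andP[sd]]; rewrite (ltr_pdivlMr _ _ C0) => sC.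
have Hw := Hs s ss0.
pose phi (i : nat) (t : R) : R := match i with
  | 0 => W ((y, y) + t *: (s *: k)) | 1 => D1 ((y, y) + t *: (s *: k)) (s *: k)
  | 2 => D2 ((y, y) + t *: (s *: k)) (s *: k) (s *: k)
  | _ => D3 ((y, y) + t *: (s *: k)) (s *: k) (s *: k) (s *: k) end.
have seg (t : R) : 0 <= t <= 1 -> `|((y, y) : E) + t *: (s *: k) - P| < rho.
  move=> /andP[t0 t1]; rewrite scalerA; apply: Hd; rewrite normrM ger0_norm//.
  by apply: le_lt_trans sd; rewrite ler_piMl.
have T := @taylor_bound _ 3 phi (e / 2 * s ^+ 2) 1.
have {T} : `|W (y, y + s *: h) - s * D1 (y, y) k - s ^+ 2 * (2^-1 * D2 (y, y) k k)| <= e / 2 * s ^+ 2.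
  have -> : W (y, y + s *: h) - s * D1 (y, y) k - s ^+ 2 * (2^-1 * D2 (y, y) k k) =
     phi 0%N 1 - \sum_(i < 3) phi i 0 / (i`!)%:R * 1 ^+ i.
    rewrite !big_ord_recl big_ord0 /= /bump /= !scale0r !addr0 scale1r !expr1n !mulr1 /= !divr1.
    rewrite W0 add0r.
    have -> : ((y, y) : E) + s *: k = (y, y + s *: h).
      by rewrite /k; congr (_, _); rewrite /= scaler0 addr0.
    rewrite clinZ1 clinZ2 (clinZ1 (D2 (y, y) k)) /GRing.scale /=; ring.
  apply: T; rewrite ?ler01 ?lexx//.
  - move=> [|[|[|//]]] t _ t01.
    + by have Wd := W_diff (seg _ t01); exact: (is_derive_line1 Wd).
    + exact: (is_derive_F D1_diff (s *: k) (seg _ t01)).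
    + exact: (is_derive_D2 D2_diff (s *: k) (seg _ t01)).
  - move=> t t01 /=; have DKt := DK _ (seg t t01).
    apply: (@le_trans _ _ (K * `|s *: k| * `|s *: k| * `|s *: k|)).
      by apply: le_trans (clin_le3 _ _ _ _) _; rewrite !ler_wpM2r.
    rewrite normrZ.
    have -> : K * (`|s| * `|k|) * (`|s| * `|k|) * (`|s| * `|k|) =
      `|s| * (K * `|k| ^+ 3) * `|s| ^+ 2 by ring.
    rewrite real_normK ?num_real// ler_wpM2r ?sqr_ge0// (le_trans _ (ltW sC))//.
    rewrite ler_wpM2l// /C ler_wpDr// ler_wpM2r ?exprn_ge0//; exact: ler_norm.
move: Hw; move: (W _) (D1 _ _) (D2 _ _ _) (g y h h) => w d1 d2 gh.
rewrite !ler_norml => /andP[a1 a2] /andP[a3 a4]; apply/andP; split; lra.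
Qed.

Lemma D1_diag y : `|y - y0| < rho -> D1 (y, y) = 0.
Proof.
move=> yr; apply: clin_ext => -[a b].
have -> : ((a, b) : E) = (a, a) + (0, b - a).
  by congr (_, _); rewrite /= ?addr0// addrC subrK.
rewrite clinD1 (second_order_expansion (b - a) yr).2.1 addr0.
apply: (diag_constant a yr _ (W_diff (diag_ball yr))) => x xr.
exact: (second_order_expansion 0 xr).1.
Qed.

Lemma D2_diag0 y k : `|y - y0| < rho -> D2 (y, y) (k, k) = 0.
Proof.
move=> yr; apply: (diag_constant k yr _ (D1_diff (diag_ball yr))) => x xr.
exact: D1_diag.
Qed.

(** A diagonal direction plus a variation of the second argument. *)
Lemma pair_split (a : E) : a = (a.1, a.1) + (0, a.2 - a.1).
Proof. by case: a => a b; congr (_, _); rewrite /= ?addr0// addrC subrK. Qed.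

(** All second derivatives on the diagonal are given by the metric. *)
Lemma D2_diag y a b : `|y - y0| < rho ->
  D2 (y, y) a b = 2 * g y (a.2 - a.1) (b.2 - b.1).
Proof.
move=> yr; have yP := diag_ball yr.
rewrite {1}(pair_split a) clinD2 D2_diag0// clinE add0r.
rewrite D2_sym// {1}(pair_split b) clinD2 D2_diag0// clinE add0r.
set u := a.2 - a.1; set v := b.2 - b.1; clearbody u v.
have gl := g_linear yr; have gs := g_sym yr.
have H := (second_order_expansion (u + v) yr).2.2.
have Hu := (second_order_expansion u yr).2.2; have Hv := (second_order_expansion v yr).2.2.
have E0 : ((0, u + v) : E) = (0, u) + (0, v) by congr (_, _); rewrite /= addr0.
move: H; rewrite E0 [D2 _ (_ + _) _]clinD2 ![D2 _ _ (_ + _)]clinD1 Hu Hv.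
rewrite [D2 _ (0, u) (0, v)]D2_sym//.
rewrite !(formDr gl) !(formDl gl gs) (gs v u).
move: (D2 _ _ _) (g y u u) (g y v v) (g y u v) => A B C D; lra.
Qed.

(** Differentiating [D2_diag] along the diagonal also shows that the metric is
    differentiable. *)
Lemma D3_diag y k a b : `|y - y0| < rho ->
  D3 (y, y) (k, k) a b = 2 * metric_deriv g y k (a.2 - a.1) (b.2 - b.1).
Proof.
move=> yr; set u := a.2 - a.1; set v := b.2 - b.1.
have [d d0 H] := line_in_ball k yr.
have dl : is_diff ((y, y) : E) (fun z => D2 z a b) (fun h => D3 (y, y) h a b).
  by have [dd ee] := diff_lin1 a (D2_diff (diag_ball yr)); have := is_diff_eval b dd; rewrite ee.
have d1 : is_derive (0 : R) 1 (fun t : R => D2 ((y, y) + t *: ((k, k) : E)) a b) (D3 (y, y) (k, k) a b).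
  have p0 : ((y, y) : E) + (0 : R) *: (k, k) = (y, y) by rewrite scale0r addr0.
  by apply: (@is_derive_line1 _ _ (fun z => D2 z a b) (fun h => D3 (y, y) h a b)); rewrite p0.

have -> : metric_deriv g y k u v = 2^-1 * D3 (y, y) (k, k) a b; last by rewrite mulrA divff ?mul1r.
apply: derive_line_eq.
have d2 : is_derive (0 : R) 1 (2^-1 \*: (fun t : R => D2 ((y, y) + t *: ((k, k) : E)) a b))
   (2^-1 *: D3 (y, y) (k, k) a b) by exact: is_deriveZ.
apply: (near_eq_is_derive _ d2).
have := @nbhs0_lt R R _ d0; apply: filterS => t /H tr /=.
by rewrite (D2_diag _ _ tr : D2 ((y, y) + t *: ((k, k) : E)) a b = _) [_ *: _]mulrA mulVf ?mul1r.
Qed.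

Lemma metric_derivE y k u v : `|y - y0| < rho ->
  metric_deriv g y k u v = 2^-1 * D3 (y, y) (k, k) (0, u) (0, v).
Proof. by move=> yr; rewrite D3_diag//= !subr0 mulrA mulVf ?mul1r. Qed.

Lemma metric_derivC y k u v : `|y - y0| < rho ->
  metric_deriv g y k u v = metric_deriv g y k v u.
Proof. by move=> yr; rewrite !metric_derivE// D3_sym23//; exact: diag_ball. Qed.

(** The metric determines the third derivative on the diagonal up to one symmetric
    trilinear form of the differences; the latter cancels in the transport system. *)
Lemma D3_diag_formula y a b c : `|y - y0| < rho ->
  let a' := a.2 - a.1 in let b' := b.2 - b.1 in let c' := c.2 - c.1 in
  D3 (y, y) a b c = 2 * metric_deriv g y a.1 b' c' + 2 * metric_deriv g y b.1 a' c'
    + 2 * metric_deriv g y c.1 a' b' + D3 (y, y) (0, a') (0, b') (0, c').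
Proof.
move=> yr a' b' c'; have yP := diag_ball yr.
rewrite {1}(pair_split a) clinD3 D3_diag// -!addrA; congr (_ + _).
rewrite D3_sym12// {1}(pair_split b) clinD3 D3_diag//= subr0; congr (_ + _).
rewrite D3_sym23// D3_sym12// {1}(pair_split c) clinD3 D3_diag//= !subr0.
rewrite -/a' -/b' -/c' (metric_derivC _ b' a' yr); congr (_ + _).
by rewrite [LHS]D3_sym12// [LHS]D3_sym23// [LHS]D3_sym12.
Qed.

End DerivativesOnDiagonal.

(** * Zeros of small perturbations of the identity *)

Section NewtonBall.
Context {R : realType} {V : completeNormedModType R}.
Variables (H : V -> V) (y : V) (r : R).
Hypothesis r0 : 0 < r.
Hypothesis H_near_id : forall x x', `|x - y| < r -> `|x' - y| < r ->
  `|H x - H x' - (x - x')| <= 2^-1 * `|x - x'|.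

Lemma near_id_stable x x' : `|x - y| < r -> `|x' - y| < r ->
  `|x - x'| <= 2 * `|H x - H x'|.
Proof.
move=> xr xr'; have h := H_near_id xr xr'.
have : `|x - x'| <= `|H x - H x'| + 2^-1 * `|x - x'|.
  rewrite -{1}(subKr (H x - H x') (x - x')).
  by apply: le_trans (ler_normB _ _) _; rewrite lerD2l.
lra.
Qed.

(** [x |-> x - H x] is a contraction of the closed ball of radius [r / 2]. *)
Lemma near_id_zero : `|H y| < r / 4 -> exists2 x, `|x - y| < r & H x = 0.
Proof.
move=> Hy; pose U := closed_ball_ (@Num.norm _ V) y (r / 2).
have Ur x : U x -> `|x - y| < r.
  rewrite /U /closed_ball_ /= distrC => /le_lt_trans; apply.
  by rewrite ltr_pdivrMr// ltr_pMr// ltr1n.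
have Uy : U y by rewrite /U /closed_ball_ /= subrr normr0 divr_ge0// ltW.
pose T x := x - H x.
have TU : forall x, U x -> U (T x).
  move=> x Ux; have := H_near_id (Ur _ Ux) (Ur _ Uy).
  move: (Ux); rewrite /U /closed_ball_ /= [`|y - x|]distrC [`|y - T x|]distrC => xy h.
  have -> : T x - y = - (H x - H y - (x - y)) - H y.
    have -> : - (H x - H y - (x - y)) - H y = x - y - H x.
      by rewrite opprB opprB [H y - H x]addrC addrA addrK.
    by rewrite /T addrAC.
  apply: le_trans (ler_normB _ _) _; rewrite normrN.
  have : 2^-1 * `|x - y| <= r / 4 by lra.
  lra.
pose Tf : {fun U >-> U} := HB.pack T (isFun.Build V V U U T TU).
have ctr : is_contraction Tf.
  exists (2^-1)%:nng; split => /=; first by rewrite invf_lt1// ltr1n.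
  move=> [a b] [/= Ua Ub]; have := H_near_id (Ur _ Ua) (Ur _ Ub).
  rewrite -normrN; congr (_ <= _); congr (`|_|).
  by rewrite /T /= opprB opprD addrACA -opprD.
have clU : closed U by exact: closed_closed_ball_.
have [|p Up pT] := @banach_fixed_point _ _ U Tf ctr clU; first by exists y.
exists p; first exact: Ur.
by move: pT => /= /eqP; rewrite eq_sym /T -subr_eq0 addrAC subrr add0r oppr_eq0 => /eqP.
Qed.

End NewtonBall.

(** * Solvability and stability of the transport system *)

(** The norm of [w] is controlled by the norm of the functional [B w]. *)
Lemma form_dual_bound (R : realType) (V : completeNormedModType R) (B : V -> V -> R)
    (c1 c2 k : R) (w : V) : 0 < c1 ->
  (forall v, c1 * `|v| ^+ 2 <= B v v <= c2 * `|v| ^+ 2) -> 0 <= k ->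
  (forall r, `|B w r| <= k * `|r|) -> `|w| <= k / c1.
Proof.
move=> c10 Bc k0 Bk; rewrite ler_pdivlMr//.
have [->|w0] := eqVneq w 0; first by rewrite normr0 mul0r.
have nw : 0 < `|w| by rewrite normr_gt0.
have /andP[h _] := Bc w; have := le_trans (ler_norm _) (Bk w) => h2.
rewrite -(ler_pM2r nw); have -> : `|w| * c1 * `|w| = c1 * `|w| ^+ 2 by ring.
exact: le_trans h h2.
Qed.

Lemma form_comb (R : realType) (V : completeNormedModType R) (B : V -> V -> R)
    (t : R) (u v k r : V) :
  (forall u, linear (B u)) -> (forall u v, B u v = B v u) ->
  B (t *: u - t *: v - k) r = t * B u r - t * B v r - B k r.
Proof. by move=> Bl Bs; rewrite !(formBl Bl Bs) !(formZl Bl Bs). Qed.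

Lemma quarter_combE (R : realFieldType) (A B G : R) :
  4^-1 * A - 4^-1 * B - G = 4^-1 * (A - B - 4 * G).
Proof. by field. Qed.

Lemma half_combE (R : realFieldType) (A B G : R) :
  - 2^-1 * A - - 2^-1 * B - G = - (2^-1 * (A - B + 2 * G)).
Proof. by field. Qed.

Lemma quarter_normE (R : realFieldType) (A B G : R) :
  4^-1 * (2 * A * B * G) <= 2^-1 * A * B * G.
Proof. by rewrite le_eqVlt; apply/orP; left; apply/eqP; field. Qed.

Lemma quarter_double (R : realFieldType) (A B : R) :
  A <= 4^-1 * B -> 2 * A <= 2^-1 * B.
Proof. lra. Qed.

Lemma half_double (R : realFieldType) (A B : R) : A <= 2^-1 * B -> 2 * A <= B.
Proof. lra. Qed.

Lemma stability_bound (R : realFieldType) (c1 L ce ze R1 R2 R3 : R) :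
  0 < c1 -> 0 <= L -> 0 <= R1 -> 0 <= R2 -> ce <= 2^-1 * (R2 / c1) ->
  ze <= R3 / c1 -> R3 <= R1 + 2 * L * ce -> ze <= (1 + L / c1) / c1 * (R2 + R1).
Proof.
move=> c0 L0 R10 R20 hce hze hR3.
have l1 : R3 <= R1 + L / c1 * R2.
  apply: le_trans hR3 _; rewrite lerD2l.
  apply: le_trans (ler_wpM2l _ hce) _; first by rewrite mulr_ge0.
  by rewrite le_eqVlt; apply/orP; left; apply/eqP; field; rewrite gt_eqF.
apply: le_trans hze _; rewrite [leRHS]mulrAC ler_wpM2r ?invr_ge0 ?(ltW c0)//.
apply: le_trans l1 _; have K0 : 0 <= L / c1 by rewrite divr_ge0 ?L0// ltW.
by move: (L / c1) K0 => K K0; nra.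
Qed.

Lemma smallness1 (R : realFieldType) (L d : R) : 0 <= L -> 0 <= d ->
  L * d <= L * (2 * L + 2) * d.
Proof. by move=> L0 d0; nra. Qed.

Lemma smallness2 (R : realFieldType) (L d : R) : 0 <= L -> 0 <= d ->
  L * (2 * (L * d) + d) <= L * (2 * L + 2) * d.
Proof. by move=> L0 d0; nra. Qed.

Section PartialDerivatives.
Context {R : realType} {V : normedModType R}.
Let E := (V * V)%type.

Lemma deriv1E (W : E -> R) (a b : V) (df : E -> R) r :
  is_diff ((a, b) : E) W df -> deriv1 W a b r = df (r, 0).
Proof.
move=> Wd.
have pd : is_diff a (fun x : V => (x, b) : E) (fun h => (h, 0)).
  by apply: is_diff_pair.
have [d1 e1] : is_diff a (fun x => W (x, b)) (fun h => df (h, 0)) by exact: (is_diff_comp pd Wd).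
by rewrite /deriv1 diff_to_clinE// e1.
Qed.

Lemma deriv2E (W : E -> R) (a b : V) (df : E -> R) r :
  is_diff ((a, b) : E) W df -> deriv2 W a b r = df (0, r).
Proof.
move=> Wd.
have pd : is_diff b (fun x : V => (a, x) : E) (fun h => (0, h)).
  by apply: is_diff_pair.
have [d1 e1] : is_diff b (fun x => W (a, x)) (fun h => df (0, h)) by exact: (is_diff_comp pd Wd).
by rewrite /deriv2 diff_to_clinE// e1.
Qed.

End PartialDerivatives.

(** Both equations have the form [residual a b c = 0], one with unknown [b] and
    one with unknown [a]. Near the diagonal the derivative of the residual is close
    to [4 * g0] in [b] and to [-2 * g0] in [a], where [g0] is the metric at [y0],
    so after applying the Riesz isomorphism of [g0] each equation is a small
    perturbation of the identity. *)
Section Transport.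
Context {R : realType} {V : completeNormedModType R}.
Let E := (V * V)%type.
Variables (W : E -> R) (D1 : E -> 'L(E, R)) (D2 : E -> 'L(E, 'L(E, R))).
Variables (y0 : V) (rho : R) (g0 : V -> V -> R) (c1 c2 : R).
Let P : E := (y0, y0).
Hypothesis rho_gt0 : 0 < rho.
Hypothesis (c1_gt0 : 0 < c1) (c2_gt0 : 0 < c2).
Hypothesis g0_linear : forall u, linear (g0 u).
Hypothesis g0_sym : forall u v, g0 u v = g0 v u.
Hypothesis g0_coercive : forall v, c1 * `|v| ^+ 2 <= g0 v v <= c2 * `|v| ^+ 2.
Hypothesis W_diff : forall x, `|x - P| < rho -> is_diff x W (D1 x).
Hypothesis D1_diff : forall x, `|x - P| < rho -> is_diff x D1 (D2 x).
Hypothesis D2_P : forall a b, D2 P a b = 2 * g0 (a.2 - a.1) (b.2 - b.1).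
Hypothesis D2_close : forall x, `|x - P| < rho -> `|D2 x - D2 P| <= c1.
Hypothesis D1_diag0 : forall y, `|y - y0| < rho -> D1 (y, y) = 0.

(** The left-hand side [W_{,2}[a, b] + W_{,1}[b, c]] of the transport equations. *)
Definition residual (a b c : V) : 'L(V, R) := deriv2 W a b + deriv1 W b c.

Lemma pair_ball a b : `|a - y0| < rho -> `|b - y0| < rho -> `|((a, b) : E) - P| < rho.
Proof. by move=> ar br; rewrite prod_normE /= gt_max ar br. Qed.

(** The same functional as a real function of the test vector [r]. *)
Definition res a b c (r : V) : R := residual a b c r.

Lemma resE a b c r : `|a - y0| < rho -> `|b - y0| < rho -> `|c - y0| < rho ->
  res a b c r = D1 (a, b) (0, r) + D1 (b, c) (r, 0).
Proof.
move=> ar br cr; rewrite /res /residual clinE; congr (_ + _).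
  by apply: deriv2E; apply: W_diff; exact: pair_ball.
by apply: deriv1E; apply: W_diff; exact: pair_ball.
Qed.

Lemma norm_inl (r : V) : `|((r, 0) : E)| = `|r|.
Proof. by rewrite prod_normE /= normr0 max_l. Qed.
Lemma norm_inr (r : V) : `|((0, r) : E)| = `|r|.
Proof. by rewrite prod_normE /= normr0 max_r. Qed.

Lemma D1_strict p p' (x : E) : `|p - P| < rho -> `|p' - P| < rho ->
  `|D1 p x - D1 p' x - D2 P (p - p') x| <= c1 * `|p - p'| * `|x|.
Proof.
move=> pr pr'; have := strict_differentiability D1_diff D2_close pr' pr => h.
have -> : D1 p x - D1 p' x - D2 P (p - p') x = (D1 p - D1 p' - D2 P (p - p')) x by [].
by apply: le_trans (clin_le _ _) _; rewrite ler_wpM2r.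
Qed.

Let lip_const := `|D2 P| + c1.

Lemma lip_const_ge0 : 0 <= lip_const. Proof. by rewrite addr_ge0// ltW. Qed.

Lemma D1_lipschitz p p' (x : E) : `|p - P| < rho -> `|p' - P| < rho ->
  `|D1 p x - D1 p' x| <= lip_const * `|p - p'| * `|x|.
Proof.
move=> pr pr'; have h := D1_strict x pr pr'.
have -> : D1 p x - D1 p' x = D2 P (p - p') x + (D1 p x - D1 p' x - D2 P (p - p') x) by ring.
apply: le_trans (ler_normD _ _) _; rewrite /lip_const !mulrDl lerD//.
exact: clin_le2.
Qed.

Lemma residual_mid a b b' c r : `|a - y0| < rho -> `|b - y0| < rho ->
  `|b' - y0| < rho -> `|c - y0| < rho ->
  `|res a b c r - res a b' c r - 4 * g0 (b - b') r| <= 2 * c1 * `|b - b'| * `|r|.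
Proof.
move=> ar br br' cr; rewrite !resE//.
have h1 := D1_strict (0, r) (pair_ball ar br) (pair_ball ar br').
have h2 := D1_strict (r, 0) (pair_ball br cr) (pair_ball br' cr).
rewrite D2_P /= !subrr !subr0 norm_inr in h1.
rewrite D2_P /= !subrr !sub0r norm_inl in h2.
have e1 : ((a, b) : E) - (a, b') = (0, b - b') by congr (_, _); rewrite /= subrr.
have e2 : ((b, c) : E) - (b', c) = (b - b', 0) by congr (_, _); rewrite /= subrr.
rewrite e1 norm_inr in h1; rewrite e2 norm_inl (formNr g0_linear) (formNl g0_linear g0_sym) opprK in h2.
move: h1 h2; move: (D1 (a, b) _) (D1 (a, b') _) (D1 (b, c) _) (D1 (b', c) _) (g0 _ _) => A B C D G.
move=> h1 h2.
have -> : A + C - (B + D) - 4 * G = (A - B - 2 * G) + (C - D - 2 * G) by ring.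
apply: le_trans (ler_normD _ _) _.
have -> : 2 * c1 * `|b - b'| * `|r| = c1 * `|b - b'| * `|r| + c1 * `|b - b'| * `|r| by ring.
exact: lerD.
Qed.

Lemma residual_left a a' b c r : `|a - y0| < rho -> `|a' - y0| < rho ->
  `|b - y0| < rho -> `|c - y0| < rho ->
  `|res a b c r - res a' b c r + 2 * g0 (a - a') r| <= c1 * `|a - a'| * `|r|.
Proof.
move=> ar ar' br cr; rewrite !resE//.
have h1 := D1_strict (0, r) (pair_ball ar br) (pair_ball ar' br).
rewrite D2_P /= !subrr !sub0r !subr0 norm_inr in h1.
have e1 : ((a, b) : E) - (a', b) = (a - a', 0) by congr (_, _); rewrite /= subrr.
rewrite e1 norm_inl (formNl g0_linear g0_sym) in h1.
move: h1; move: (D1 (a, b) _) (D1 (a', b) _) (D1 (b, c) _) (g0 _ _) => A B C G.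
have -> : A + C - (B + C) + 2 * G = A - B - 2 * - G by ring.
by [].
Qed.

Lemma residual_lipschitz a a' b b' c c' m :
  `|a - y0| < rho -> `|a' - y0| < rho -> `|b - y0| < rho -> `|b' - y0| < rho ->
  `|c - y0| < rho -> `|c' - y0| < rho ->
  `|a - a'| <= m -> `|b - b'| <= m -> `|c - c'| <= m ->
  `|residual a b c - residual a' b' c'| <= 2 * lip_const * m.
Proof.
move=> ar ar' br br' cr cr' am bm cm; have m0 : 0 <= m by exact: le_trans am.
apply: clin_opnorm_le => [|r]; first by rewrite !mulr_ge0// lip_const_ge0.
have -> : (residual a b c - residual a' b' c') r = res a b c r - res a' b' c' r by [].
rewrite !resE//.
have h1 := D1_lipschitz (0, r) (pair_ball ar br) (pair_ball ar' br').
have h2 := D1_lipschitz (r, 0) (pair_ball br cr) (pair_ball br' cr').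
rewrite norm_inr in h1; rewrite norm_inl in h2.
have k1 : `|((a, b) : E) - (a', b')| <= m by rewrite prod_normE /= ge_max am bm.
have k2 : `|((b, c) : E) - (b', c')| <= m by rewrite prod_normE /= ge_max bm cm.
have {}h1 : `|D1 (a, b) (0, r) - D1 (a', b') (0, r)| <= lip_const * m * `|r|.
  by apply: le_trans h1 _; rewrite ler_wpM2r// ler_wpM2l ?lip_const_ge0.
have {}h2 : `|D1 (b, c) (r, 0) - D1 (b', c') (r, 0)| <= lip_const * m * `|r|.
  by apply: le_trans h2 _; rewrite ler_wpM2r// ler_wpM2l ?lip_const_ge0.
have -> : D1 (a, b) (0, r) + D1 (b, c) (r, 0) - (D1 (a', b') (0, r) + D1 (b', c') (r, 0)) =
  (D1 (a, b) (0, r) - D1 (a', b') (0, r)) + (D1 (b, c) (r, 0) - D1 (b', c') (r, 0)) by ring.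
have -> : 2 * lip_const * m * `|r| = lip_const * m * `|r| + lip_const * m * `|r| by ring.
by apply: le_trans (ler_normD _ _) _; exact: lerD.
Qed.

Lemma residual_diag y : `|y - y0| < rho -> residual y y y = 0.
Proof.
move=> yr; apply: clin_ext => r; change (res y y y r = 0).
by rewrite resE// D1_diag0// addr0.
Qed.

Let riesz_rep (phi : 'L(V, R)) : V :=
  sval (cid (riesz c1_gt0 c2_gt0 g0_linear g0_sym g0_coercive phi)).

Lemma riesz_repE phi r : g0 (riesz_rep phi) r = phi r.
Proof. exact: (svalP (cid (riesz c1_gt0 c2_gt0 g0_linear g0_sym g0_coercive phi))). Qed.

Lemma riesz_rep_bound phi : `|riesz_rep phi| <= `|phi| / c1.
Proof.
by apply: (form_dual_bound c1_gt0 g0_coercive) => // r; rewrite riesz_repE clin_le.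
Qed.

Lemma riesz_rep_eq0 phi : riesz_rep phi = 0 -> phi = 0.
Proof. by move=> riesz_rep0; apply: clin_ext => r; rewrite -riesz_repE riesz_rep0 (form0l g0_linear g0_sym). Qed.

Lemma riesz_rep0 : riesz_rep 0 = 0.
Proof. by apply/eqP; rewrite -normr_le0 (le_trans (riesz_rep_bound 0))// normr0 mul0r. Qed.

Lemma riesz_rep_comb t a b c a' b' c' k r :
  g0 (t *: riesz_rep (residual a b c) - t *: riesz_rep (residual a' b' c') - k) r =
  t * res a b c r - t * res a' b' c' r - g0 k r.
Proof.
rewrite (form_comb _ _ _ _ _ g0_linear g0_sym).
by congr (_ * _ - _ * _ - _); exact: riesz_repE.
Qed.

Let mid_map a c b := 4^-1 *: riesz_rep (residual a b c).
Let end_map b c a := - 2^-1 *: riesz_rep (residual a b c).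

Lemma mid_map_near_id a c b b' : `|a - y0| < rho -> `|b - y0| < rho ->
  `|b' - y0| < rho -> `|c - y0| < rho ->
  `|mid_map a c b - mid_map a c b' - (b - b')| <= 2^-1 * `|b - b'|.
Proof.
move=> ar br br' cr.
have -> : 2^-1 * `|b - b'| = (2^-1 * c1 * `|b - b'|) / c1 by field; rewrite gt_eqF.
apply: (form_dual_bound c1_gt0 g0_coercive) => [|r].
  by rewrite !mulr_ge0// ltW.
have h := residual_mid r ar br br' cr.
rewrite riesz_rep_comb.
rewrite quarter_combE normrM ger0_norm//; apply: le_trans (ler_wpM2l _ h) _ => //.
by rewrite quarter_normE.
Qed.

Lemma end_map_near_id b c a a' : `|a - y0| < rho -> `|a' - y0| < rho ->
  `|b - y0| < rho -> `|c - y0| < rho ->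
  `|end_map b c a - end_map b c a' - (a - a')| <= 2^-1 * `|a - a'|.
Proof.
move=> ar ar' br cr.
have -> : 2^-1 * `|a - a'| = (2^-1 * c1 * `|a - a'|) / c1 by field; rewrite gt_eqF.
apply: (form_dual_bound c1_gt0 g0_coercive) => [|r].
  by rewrite !mulr_ge0// ltW.
have h := residual_left r ar ar' br cr.
rewrite riesz_rep_comb.
rewrite half_combE normrN normrM ger0_norm//; apply: le_trans (ler_wpM2l _ h) _ => //.
by rewrite !mulrA.
Qed.


Lemma mid_map_bound a c b : `|mid_map a c b| <= 4^-1 * (`|residual a b c| / c1).
Proof. by rewrite normrZ ger0_norm// ler_wpM2l// riesz_rep_bound. Qed.

Lemma end_map_bound a c b : `|end_map b c a| <= 2^-1 * (`|residual a b c| / c1).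
Proof. by rewrite normrZ normrN ger0_norm// ler_wpM2l// riesz_rep_bound. Qed.

Lemma mid_map_eq0 a c b : mid_map a c b = 0 -> residual a b c = 0.
Proof. by move/eqP; rewrite scaler_eq0 invr_eq0 pnatr_eq0 /= => /eqP/riesz_rep_eq0. Qed.

Lemma end_map_eq0 a c b : end_map b c a = 0 -> residual a b c = 0.
Proof. by move/eqP; rewrite scaler_eq0 oppr_eq0 invr_eq0 pnatr_eq0 /= => /eqP/riesz_rep_eq0. Qed.

Lemma mid_map_of0 a c b : residual a b c = 0 -> mid_map a c b = 0.
Proof. by rewrite /mid_map => ->; rewrite riesz_rep0 scaler0. Qed.

Lemma end_map_of0 a c b : residual a b c = 0 -> end_map b c a = 0.
Proof. by rewrite /end_map => ->; rewrite riesz_rep0 scaler0. Qed.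

Lemma transport_pairP r y u zeta (cz : V * V) :
  transport_pair W r y u zeta cz <->
  [/\ `|cz.1 - y| < r, `|cz.2 - y| < r, residual cz.2 cz.1 (y + u) = 0 &
    residual y cz.1 (y + u + zeta) = 0].
Proof.
rewrite /transport_pair ball_prod_normE /ball_ /= prod_normE /= gt_max.
rewrite ![`|y - _|]distrC.
split=> [[/andP[h1 h2] h3 h4]|[h1 h2 h3 h4]]; first exact: And4 h1 h2 h3 h4.
by apply: And3 h3 h4; rewrite h1 h2.
Qed.

Section AtPoint.
Variables (y u zeta : V) (r : R).
Hypothesis yr : `|y - y0| < rho / 2.
Hypothesis r_gt0 : 0 < r.
Hypothesis r_le : r <= rho / 2.
Hypothesis u_small : `|u| < rho / 4.
Hypothesis zeta_small : `|zeta| < rho / 4.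

Lemma near_y x : `|x - y| < r -> `|x - y0| < rho.
Proof.
move=> xy; have -> : x - y0 = (x - y) + (y - y0) by rewrite addrA subrK.
apply: le_lt_trans (ler_normD _ _) _; rewrite [rho]splitr.
by rewrite ltrD// (lt_le_trans xy).
Qed.

Lemma in_y : `|y - y0| < rho.
Proof. by apply: near_y; rewrite subrr normr0. Qed.

Lemma in_yu : `|y + u - y0| < rho.
Proof.
rewrite addrAC; apply: le_lt_trans (ler_normD _ _) _; rewrite [rho]splitr.
by rewrite ltrD// (lt_trans u_small)// ltr_pM2l// ltf_pV2 ?posrE// ltr_nat.
Qed.

Lemma in_yuz : `|y + u + zeta - y0| < rho.
Proof.
rewrite -(addrA y u) addrAC; apply: le_lt_trans (ler_normD _ _) _; rewrite [rho]splitr.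
rewrite ltrD//; apply: le_lt_trans (ler_normD _ _) _.
have -> : rho / 2 = rho / 4 + rho / 4 by field.
exact: ltrD.
Qed.

(** A posteriori estimate: approximate solutions are close to the exact one, up to a
    constant times their residuals. The constant does not depend on the radius [r]. *)
Lemma transport_stable (cz : V * V) ch zh : transport_pair W r y u zeta cz ->
  `|ch - y| < r -> `|zh - y| < r ->
  `|cz.2 - zh| <= (1 + lip_const / c1) / c1 *
    (`|residual y ch (y + u + zeta)| + `|residual zh ch (y + u)|).
Proof.
case: cz => c z /transport_pairP[/= cr zr eq1 eq2] chr zhr.
have ce : `|c - ch| <= 2^-1 * (`|residual y ch (y + u + zeta)| / c1).
  have near2 x x' : `|x - y| < r -> `|x' - y| < r ->
     `|mid_map y (y + u + zeta) x - mid_map y (y + u + zeta) x' - (x - x')| <= 2^-1 * `|x - x'|.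
    move=> xr xr'; apply: mid_map_near_id; [exact: in_y|exact: near_y|exact: near_y|exact: in_yuz].
  have := near_id_stable near2 cr chr; rewrite (mid_map_of0 eq2) sub0r normrN => h.
  exact: le_trans h (quarter_double (mid_map_bound _ _ _)).
have ze : `|z - zh| <= `|residual zh c (y + u)| / c1.
  have near2 x x' : `|x - y| < r -> `|x' - y| < r ->
     `|end_map c (y + u) x - end_map c (y + u) x' - (x - x')| <= 2^-1 * `|x - x'|.
    move=> xr xr'; apply: end_map_near_id; [exact: near_y|exact: near_y|exact: near_y|exact: in_yu].
  have := near_id_stable near2 zr zhr; rewrite (end_map_of0 eq1) sub0r normrN => h.
  exact: le_trans h (half_double (end_map_bound _ _ _)).
have rl : `|residual zh c (y + u) - residual zh ch (y + u)| <= 2 * lip_const * `|c - ch|.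
  by apply: residual_lipschitz; rewrite ?subrr ?normr0//; try exact: near_y; exact: in_yu.
have : `|residual zh c (y + u)| <= `|residual zh ch (y + u)| + 2 * lip_const * `|c - ch|.
  rewrite -[X in `|X| <= _](subrK (residual zh ch (y + u))) addrC.
  by apply: le_trans (ler_normD _ _) _; rewrite lerD2l.
move=> rl'; apply: (stability_bound c1_gt0 lip_const_ge0 _ _ ce ze rl'); exact: normr_ge0.
Qed.

Lemma transport_unique (cz cz' : V * V) :
  transport_pair W r y u zeta cz -> transport_pair W r y u zeta cz' -> cz = cz'.
Proof.
case: cz cz' => c z [c' z'] /transport_pairP[/= cr zr eq1 eq2] /transport_pairP[/= cr' zr' eq1' eq2'].
have near2 x x' : `|x - y| < r -> `|x' - y| < r ->
     `|mid_map y (y + u + zeta) x - mid_map y (y + u + zeta) x' - (x - x')| <= 2^-1 * `|x - x'|.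
  by move=> xr xr'; apply: mid_map_near_id; [exact: in_y|exact: near_y|exact: near_y|exact: in_yuz].
have := near_id_stable near2 cr cr'; rewrite (mid_map_of0 eq2) (mid_map_of0 eq2') subrr normr0 mulr0.
rewrite normr_le0 subr_eq0 => /eqP cc; rewrite -cc in eq1' *.
have near1 x x' : `|x - y| < r -> `|x' - y| < r ->
     `|end_map c (y + u) x - end_map c (y + u) x' - (x - x')| <= 2^-1 * `|x - x'|.
  by move=> xr xr'; apply: end_map_near_id; [exact: near_y|exact: near_y|exact: near_y|exact: in_yu].
have := near_id_stable near1 zr zr'; rewrite (end_map_of0 eq1) (end_map_of0 eq1') subrr normr0 mulr0.
by rewrite normr_le0 subr_eq0 => /eqP ->.
Qed.

Lemma transport_exists (del : R) : `|u| < del -> `|zeta| < del ->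
  (lip_const / c1) * (2 * (lip_const / c1) + 2) * del < r / 4 ->
  exists cz, transport_pair W r y u zeta cz.
Proof.
move=> ud zd dr; have d0 : 0 < del by exact: le_lt_trans ud.
set L := lip_const / c1; have L0 : 0 <= L by rewrite divr_ge0 ?lip_const_ge0// ltW.
rewrite -/L in dr.
have near2 x x' : `|x - y| < r -> `|x' - y| < r ->
     `|mid_map y (y + u + zeta) x - mid_map y (y + u + zeta) x' - (x - x')| <= 2^-1 * `|x - x'|.
  by move=> xr xr'; apply: mid_map_near_id; [exact: in_y|exact: near_y|exact: near_y|exact: in_yuz].
have mid_y : `|mid_map y (y + u + zeta) y| <= L * del.
  apply: le_trans (mid_map_bound _ _ _) _.
  have h : `|residual y y (y + u + zeta) - residual y y y| <= 2 * lip_const * (del + del).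
    apply: residual_lipschitz; rewrite ?subrr ?normr0 ?addr_ge0 ?(ltW d0)//; try exact: in_y.
      exact: in_yuz.
    have -> : y + u + zeta - y = u + zeta by rewrite -(addrA y u) [LHS]addrC addKr.
    apply: le_trans (ler_normD _ _) _.
    by rewrite lerD// ltW.
  rewrite (residual_diag in_y) subr0 in h.
  have h' : 4^-1 * (`|residual y y (y + u + zeta)| / c1) <= 4^-1 * (2 * lip_const * (del + del) / c1).
    by rewrite ler_wpM2l// ler_wpM2r// invr_ge0 ltW.
  apply: le_trans h' _; rewrite le_eqVlt; apply/orP; left; apply/eqP.
  by rewrite /L; field; rewrite gt_eqF.
have [c cr c0] : exists2 c, `|c - y| < r & mid_map y (y + u + zeta) c = 0.
  by apply: near_id_zero => //; apply: le_lt_trans mid_y _; apply: le_lt_trans (smallness1 L0 (ltW d0)) dr.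
have cy : `|c - y| <= 2 * (L * del).
  have := near_id_stable near2 cr (_ : `|y - y| < r).
  rewrite subrr normr0 => /(_ r_gt0); rewrite c0 sub0r normrN => h.
  by apply: le_trans h _; rewrite ler_wpM2l.
have near1 x x' : `|x - y| < r -> `|x' - y| < r ->
     `|end_map c (y + u) x - end_map c (y + u) x' - (x - x')| <= 2^-1 * `|x - x'|.
  by move=> xr xr'; apply: end_map_near_id; [exact: near_y|exact: near_y|exact: near_y|exact: in_yu].
have end_y : `|end_map c (y + u) y| <= L * (2 * (L * del) + del).
  apply: le_trans (end_map_bound _ _ _) _.
  have Ld : 0 <= 2 * (L * del) := mulr_ge0 (ler0n R 2) (mulr_ge0 L0 (ltW d0)).
  have h : `|residual y c (y + u) - residual y y y| <= 2 * lip_const * (2 * (L * del) + del).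
    apply: residual_lipschitz; rewrite ?subrr ?normr0 ?addr_ge0 ?(ltW d0)//; try exact: in_y.
    - exact: near_y.
    - exact: in_yu.
    - by rewrite ler_wpDr// ltW.
    - by rewrite addrC addKr ler_wpDl// ltW.
  rewrite (residual_diag in_y) subr0 in h.
  have h' : 2^-1 * (`|residual y c (y + u)| / c1) <= 2^-1 * (2 * lip_const * (2 * (L * del) + del) / c1).
    by rewrite ler_wpM2l// ler_wpM2r// invr_ge0 ltW.
  apply: le_trans h' _; rewrite le_eqVlt; apply/orP; left; apply/eqP.
  by rewrite /L; field; rewrite gt_eqF.
have [z zr z0] : exists2 z, `|z - y| < r & end_map c (y + u) z = 0.
  by apply: near_id_zero => //; apply: le_lt_trans end_y _; apply: le_lt_trans (smallness2 L0 (ltW d0)) dr.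
exists (c, z); apply/transport_pairP.
exact: And4 cr zr (end_map_eq0 z0) (mid_map_eq0 c0).
Qed.

End AtPoint.

Lemma transport_well_defined r : 0 < r <= rho / 2 ->
  inv_transport_well_defined W (ball y0 (rho / 2)) r.
Proof.
move=> /andP[r0 rr].
pose A := (lip_const / c1) * (2 * (lip_const / c1) + 2) + 1.
have L0 : 0 <= lip_const / c1 by rewrite divr_ge0 ?lip_const_ge0// ltW.
have A0 : 0 < A by rewrite ltr_wpDl// mulr_ge0// addr_ge0// mulr_ge0.
pose del := Num.min (rho / 4) (r / 4 / A).
exists del; first by rewrite lt_min !divr_gt0.
move=> y u zeta; rewrite -ball_normE /= distrC => yr ud zd.
have ur : `|u| < rho / 4 by rewrite (lt_le_trans ud)// ge_min lexx.
have zr : `|zeta| < rho / 4 by rewrite (lt_le_trans zd)// ge_min lexx.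
have ud' : `|u| < r / 4 / A by rewrite (lt_le_trans ud)// ge_min lexx orbT.
have zd' : `|zeta| < r / 4 / A by rewrite (lt_le_trans zd)// ge_min lexx orbT.
have [cz czP] : exists cz, transport_pair W r y u zeta cz.
  apply: (transport_exists yr r0 rr ur zr ud' zd').
  rewrite [ltLHS]mulrA (ltr_pdivrMr _ _ A0) mulrC ltr_pM2l ?divr_gt0//.
  by rewrite /A ltrDl.
exists cz; split => // cz' czP'.
exact: (transport_unique yr r0 rr ur zr czP czP').
Qed.

End Transport.

(** * Uniform orders in the step size *)

Section UniformOrder.
Context {R : realType} {I : Type}.
Variable B : set I.

(** [e i t] is of order [|t|^n] as [t] tends to 0, with both signs of [t] and with
    the constant and the range of [t] uniform for [i] in [B]. *)
Definition uniform_O (V : normedModType R) (n : nat) (e : I -> R -> V) :=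
  exists K t0 : R, [/\ 0 <= K, 0 < t0 & forall i t, B i -> `|t| < t0 ->
    `|e i t| <= K * `|t| ^+ n].

Section Module.
Context {V : normedModType R}.
Implicit Types e f : I -> R -> V.

Lemma uniform_O_eq n e f : (forall i t, e i t = f i t) -> uniform_O n e -> uniform_O n f.
Proof. by move=> ef [K [t0 [K0 t00 H]]]; exists K, t0; split => // i t Bi tt; rewrite -ef H. Qed.

Lemma uniform_OD n e f : uniform_O n e -> uniform_O n f ->
  uniform_O n (fun i t => e i t + f i t).
Proof.
move=> [K [t0 [K0 t00 H]]] [K' [t0' [K0' t00' H']]].
exists (K + K'), (Num.min t0 t0'); split; rewrite ?addr_ge0// ?lt_min ?t00//.
move=> i t Bi; rewrite lt_min => /andP[h h'].
by apply: le_trans (ler_normD _ _) _; rewrite mulrDl lerD// ?H ?H'.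
Qed.

Lemma uniform_OZ n m (s : I -> R -> R) e :
  (exists2 C, 0 <= C & forall i t, B i -> `|s i t| <= C * `|t| ^+ m) ->
  uniform_O n e -> uniform_O (m + n) (fun i t => s i t *: e i t).
Proof.
move=> [C C0 sC] [K [t0 [K0 t00 H]]]; exists (C * K), t0; split; rewrite ?mulr_ge0//.
move=> i t Bi tt; rewrite normrZ exprD.
have -> : C * K * (`|t| ^+ m * `|t| ^+ n) = (C * `|t| ^+ m) * (K * `|t| ^+ n) by ring.
by apply: ler_pM => //; [exact: sC|exact: H].
Qed.

Lemma uniform_O_pow n m e : uniform_O n e -> uniform_O (m + n) (fun i t => t ^+ m *: e i t).
Proof.
by apply: uniform_OZ; exists 1 => // i t _; rewrite mul1r normrX.
Qed.

Lemma uniform_O_cstM n c e : uniform_O n e -> uniform_O n (fun i t => c *: e i t).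
Proof.
apply: (@uniform_OZ n 0); exists `|c| => // i t _.
by rewrite expr0 mulr1.
Qed.

Lemma uniform_ON n e : uniform_O n e -> uniform_O n (fun i t => - e i t).
Proof.
by move=> [K [t0 [K0 t00 H]]]; exists K, t0; split => // i t Bi tt; rewrite normrN H.
Qed.

Lemma uniform_O_le n m e : (m <= n)%N -> uniform_O n e -> uniform_O m e.
Proof.
move=> mn [K [t0 [K0 t00 H]]]; exists K, (Num.min t0 1); split => //.
  by rewrite lt_min t00 ltr01.
move=> i t Bi; rewrite lt_min => /andP[tt t1]; apply: le_trans (H i t Bi tt) _.
by rewrite ler_wpM2l// ler_wiXn2l// ltW.
Qed.

Lemma uniform_O_bounded (a : I -> V) :
  (exists K : R, forall i, B i -> `|a i| <= K) -> uniform_O 0 (fun i _ => a i).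
Proof.
move=> [K aK]; exists `|K|, 1; split => // i t Bi _.
by rewrite expr0 mulr1 (le_trans (aK i Bi))// ler_norm.
Qed.

End Module.

Lemma uniform_O_bilinear (X Y Z : normedModType R) n m (T : I -> X -> Y -> Z) e f :
  (exists2 K, 0 <= K & forall i x y, B i -> `|T i x y| <= K * `|x| * `|y|) ->
  uniform_O n e -> uniform_O m f -> uniform_O (n + m) (fun i t => T i (e i t) (f i t)).
Proof.
move=> [C C0 TC] [K [t0 [K0 t00 H]]] [K' [t0' [K0' t00' H']]].
exists (C * K * K'), (Num.min t0 t0'); split; rewrite ?mulr_ge0// ?lt_min ?t00//.
move=> i t Bi; rewrite lt_min => /andP[h h']; apply: le_trans (TC _ _ _ Bi) _.
have -> : C * K * K' * `|t| ^+ (n + m) = C * (K * `|t| ^+ n) * (K' * `|t| ^+ m).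
  by rewrite exprD; ring.
rewrite ler_pM//; first by rewrite mulr_ge0.
  by rewrite ler_wpM2l// H.
exact: H'.
Qed.

Lemma uniform_O_linear (X Z : normedModType R) n (T : I -> X -> Z) e :
  (exists2 K, 0 <= K & forall i x, B i -> `|T i x| <= K * `|x|) ->
  uniform_O n e -> uniform_O n (fun i t => T i (e i t)).
Proof.
move=> [C C0 TC] [K [t0 [K0 t00 H]]]; exists (C * K), t0; split; rewrite ?mulr_ge0//.
move=> i t Bi tt; apply: le_trans (TC _ _ Bi) _; rewrite -mulrA ler_wpM2l//.
exact: H.
Qed.

Lemma uniform_O_trilinear (X Z : normedModType R) n m k (T : I -> X -> X -> X -> Z) e f g :
  (exists2 K, 0 <= K & forall i x y z, B i -> `|T i x y z| <= K * `|x| * `|y| * `|z|) ->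
  uniform_O n e -> uniform_O m f -> uniform_O k g ->
  uniform_O (n + m + k) (fun i t => T i (e i t) (f i t) (g i t)).
Proof.
move=> [C C0 TC] [K [t0 [K0 t00 H]]] [K' [t0' [K0' t00' H']]] [K2 [t2 [K20 t20 H2]]].
exists (C * K * K' * K2), (Num.min t0 (Num.min t0' t2)); split; rewrite ?mulr_ge0// ?lt_min ?t00 ?t00'//.
move=> i t Bi; rewrite !lt_min => /and3P[h h' h2]; apply: le_trans (TC _ _ _ _ Bi) _.
have -> : C * K * K' * K2 * `|t| ^+ (n + m + k) =
  C * (K * `|t| ^+ n) * (K' * `|t| ^+ m) * (K2 * `|t| ^+ k).
  by rewrite !exprD; ring.
rewrite ler_pM//; first by rewrite !mulr_ge0.
  rewrite ler_pM//; first by rewrite mulr_ge0.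
    by rewrite ler_wpM2l// H.
  exact: H'.
exact: H2.
Qed.

(** Substitution of a curve [t a + t^2 b + t^3 c + O(t^N)] into a map with Taylor
    polynomial [T2 + T3 / 2 + T4]; the trilinear term [T4] already contains its
    factor 1/6, and is 0 when only the third order remainder is available. *)
Section CurveExpansion.
Context {X : normedModType R}.
Variables (F : I -> X -> R) (T2 : I -> X -> R) (T3 : I -> X -> X -> R)
  (T4 : I -> X -> X -> X -> R) (N : nat).
Hypothesis N3 : (3 <= N)%N.
Hypothesis N4 : (N <= 4)%N.
Hypothesis T2D : forall i x y, T2 i (x + y) = T2 i x + T2 i y.
Hypothesis T2Z : forall i s x, T2 i (s *: x) = s * T2 i x.
Hypothesis T3D1 : forall i x y z, T3 i (x + y) z = T3 i x z + T3 i y z.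
Hypothesis T3Z1 : forall i s x z, T3 i (s *: x) z = s * T3 i x z.
Hypothesis T3D2 : forall i x y z, T3 i z (x + y) = T3 i z x + T3 i z y.
Hypothesis T3Z2 : forall i s x z, T3 i z (s *: x) = s * T3 i z x.
Hypothesis T4D1 : forall i x y u v, T4 i (x + y) u v = T4 i x u v + T4 i y u v.
Hypothesis T4Z1 : forall i s x u v, T4 i (s *: x) u v = s * T4 i x u v.
Hypothesis T4D2 : forall i x y u v, T4 i u (x + y) v = T4 i u x v + T4 i u y v.
Hypothesis T4Z2 : forall i s x u v, T4 i u (s *: x) v = s * T4 i u x v.
Hypothesis T4D3 : forall i x y u v, T4 i u v (x + y) = T4 i u v x + T4 i u v y.
Hypothesis T4Z3 : forall i s x u v, T4 i u v (s *: x) = s * T4 i u v x.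
Hypothesis T2_bounded : exists2 K, 0 <= K & forall i x, B i -> `|T2 i x| <= K * `|x|.
Hypothesis T3_bounded : exists2 K, 0 <= K &
  forall i x y, B i -> `|T3 i x y| <= K * `|x| * `|y|.
Hypothesis T4_bounded : exists2 K, 0 <= K &
  forall i x y z, B i -> `|T4 i x y z| <= K * `|x| * `|y| * `|z|.
Hypothesis taylor : exists K eta, [/\ 0 <= K, 0 < eta & forall i k, B i -> `|k| < eta ->
  `|F i k - T2 i k - 2^-1 * T3 i k k - T4 i k k k| <= K * `|k| ^+ N].

Variables (h : I -> R -> X) (a b c : I -> X).
Hypothesis a_bounded : exists K : R, forall i, B i -> `|a i| <= K.
Hypothesis b_bounded : exists K : R, forall i, B i -> `|b i| <= K.
Hypothesis c_bounded : exists K : R, forall i, B i -> `|c i| <= K.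
Hypothesis h_expansion :
  uniform_O N (fun i t => h i t - t *: a i - t ^+ 2 *: b i - t ^+ 3 *: c i).

Let h2 i t := h i t - t *: a i.
Let h3 i t := h2 i t - t ^+ 2 *: b i.

Let a_O : uniform_O 1 (fun i t => t *: a i).
Proof. exact: (uniform_O_pow 1 (uniform_O_bounded a_bounded)). Qed.

Let h3_O : uniform_O 3 h3.
Proof.
have := uniform_OD (uniform_O_le N3 h_expansion) (uniform_O_pow 3 (uniform_O_bounded c_bounded)).
by apply: uniform_O_eq => i t; rewrite subrK.
Qed.

Let h2_O : uniform_O 2 h2.
Proof.
have := uniform_OD (uniform_O_le (isT : 2 <= 3)%N h3_O) (uniform_O_pow 2 (uniform_O_bounded b_bounded)).
by apply: uniform_O_eq => i t; rewrite subrK.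
Qed.

Let h_O : uniform_O 1 h.
Proof.
have := uniform_OD (uniform_O_le (isT : 1 <= 2)%N h2_O) a_O.
by apply: uniform_O_eq => i t; rewrite subrK.
Qed.

Lemma curve_expansion : uniform_O N (fun i t => F i (h i t) - t * T2 i (a i)
  - t ^+ 2 * (T2 i (b i) + 2^-1 * T3 i (a i) (a i))
  - t ^+ 3 * (T2 i (c i) + 2^-1 * (T3 i (a i) (b i) + T3 i (b i) (a i))
              + T4 i (a i) (a i) (a i))).
Proof.
pose rr i t := h i t - t *: a i - t ^+ 2 *: b i - t ^+ 3 *: c i.
have O1 : uniform_O N (fun i t => F i (h i t) - T2 i (h i t) - 2^-1 * T3 i (h i t) (h i t)
    - T4 i (h i t) (h i t) (h i t)).
  have [K [eta [K0 eta0 HF]]] := taylor; have [C [t0 [C0 t00 HC]]] := h_O.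
  have C1 : 0 < C + 1 by rewrite ltr_wpDl.
  exists (K * C ^+ N), (Num.min t0 (eta / (C + 1))); split.
  - by rewrite mulr_ge0// exprn_ge0.
  - by rewrite lt_min t00 divr_gt0.
  move=> i t Bi; rewrite lt_min (ltr_pdivlMr _ _ C1) => /andP[tt te].
  have ht := HC i t Bi tt; rewrite expr1 in ht.
  apply: le_trans (HF _ _ Bi _) _.
    apply: le_lt_trans ht (le_lt_trans _ te).
    by rewrite mulrC ler_wpM2l// lerDl.
  rewrite -mulrA -exprMn ler_wpM2l// lerXn2r// nnegrE//.
  by rewrite mulr_ge0.
have O2 := uniform_O_linear T2_bounded h_expansion.
have O3 := uniform_O_le N4 (uniform_O_bilinear T3_bounded a_O h3_O).
have O4 := uniform_O_le N4 (uniform_O_bilinear T3_bounded h3_O a_O).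
have O5 := uniform_O_le N4 (uniform_O_bilinear T3_bounded h2_O h2_O).
have O6 := uniform_O_le N4 (uniform_O_trilinear T4_bounded h2_O h_O h_O).
have O7 := uniform_O_le N4 (uniform_O_trilinear T4_bounded a_O h2_O h_O).
have O8 := uniform_O_le N4 (uniform_O_trilinear T4_bounded a_O a_O h2_O).
have := uniform_OD (uniform_OD O1 O2) (uniform_OD (uniform_O_cstM 2^-1
  (uniform_OD O3 (uniform_OD O4 O5))) (uniform_OD O6 (uniform_OD O7 O8))).
apply: uniform_O_eq => i t.
cbv beta.
have hE2 : h i t = t *: a i + h2 i t by rewrite /h2 addrC subrK.
have hE3 : h2 i t = t ^+ 2 *: b i + h3 i t by rewrite /h3 addrC subrK.
have T2r : T2 i (h i t) = t * T2 i (a i) + t ^+ 2 * T2 i (b i) + t ^+ 3 * T2 i (c i)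
   + T2 i (h i t - t *: a i - t ^+ 2 *: b i - t ^+ 3 *: c i).
  rewrite -!T2Z -!T2D; congr (T2 i _).
  move: (h i t) (t *: a i) (t ^+ 2 *: b i) (t ^+ 3 *: c i) => x u v w.
  have -> : x - u - v - w = x - (u + v + w) by rewrite !opprD !addrA.
  by rewrite addrC subrK.
have T3r : T3 i (h i t) (h i t) = t ^+ 2 * T3 i (a i) (a i)
   + t ^+ 3 * (T3 i (a i) (b i) + T3 i (b i) (a i))
   + (T3 i (t *: a i) (h3 i t) + (T3 i (h3 i t) (t *: a i) + T3 i (h2 i t) (h2 i t))).
  have e1 u : T3 i (h i t) u = t * T3 i (a i) u + T3 i (h2 i t) u.
    by rewrite hE2 T3D1 T3Z1.
  have e2 u : T3 i u (h i t) = t * T3 i u (a i) + T3 i u (h2 i t).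
    by rewrite hE2 T3D2 T3Z2.
  have e3 u : T3 i (h2 i t) u = t ^+ 2 * T3 i (b i) u + T3 i (h3 i t) u.
    by rewrite hE3 T3D1 T3Z1.
  have e4 u : T3 i u (h2 i t) = t ^+ 2 * T3 i u (b i) + T3 i u (h3 i t).
    by rewrite hE3 T3D2 T3Z2.
  rewrite e1 !e2 !T3Z1 !T3Z2 (e3 (a i)) (e4 (a i)); ring.
have T4r : T4 i (h i t) (h i t) (h i t) = t ^+ 3 * T4 i (a i) (a i) (a i) +
   (T4 i (h2 i t) (h i t) (h i t) + (T4 i (t *: a i) (h2 i t) (h i t)
     + T4 i (t *: a i) (t *: a i) (h2 i t))).
  have e1 u v : T4 i (h i t) u v = T4 i (t *: a i) u v + T4 i (h2 i t) u v.
    by rewrite hE2 T4D1.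
  have e2 u v : T4 i u (h i t) v = T4 i u (t *: a i) v + T4 i u (h2 i t) v.
    by rewrite hE2 T4D2.
  have e3 u v : T4 i u v (h i t) = T4 i u v (t *: a i) + T4 i u v (h2 i t).
    by rewrite hE2 T4D3.
  rewrite e1 (e2 (t *: a i)) (e3 (t *: a i) (t *: a i)).
  rewrite (T4Z1 i t (a i) (t *: a i) (t *: a i)) (T4Z2 i t (a i) (a i) (t *: a i))
    (T4Z3 i t (a i) (a i) (a i)).
  by ring.
move: T2r T3r T4r; move: (T2 i (h i t)) (T3 i (h i t) (h i t)) (T4 i (h i t) (h i t) (h i t)).
move: (T2 i (h i t - t *: a i - t ^+ 2 *: b i - t ^+ 3 *: c i))
  (T3 i (t *: a i) (h3 i t)) (T3 i (h3 i t) (t *: a i)) (T3 i (h2 i t) (h2 i t)).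
move: (T4 i (h2 i t) (h i t) (h i t)) (T4 i (t *: a i) (h2 i t) (h i t))
  (T4 i (t *: a i) (t *: a i) (h2 i t)).
move: (F i (h i t)) => f k1 k2 k3 k4 k5 k6 k7 A B' C -> -> ->.
by rewrite /GRing.scale /=; field.
Qed.

End CurveExpansion.

End UniformOrder.

(** * Approximate solution of the transport system *)

Section ApproximateSolution.
Context {R : realType} {V : completeNormedModType R}.
Let E := (V * V)%type.
Variables (B : set V) (g : V -> V -> V -> R) (c1 c2 : R) (N : nat).
Hypothesis N3 : (3 <= N)%N.
Hypothesis N4 : (N <= 4)%N.
Hypothesis (c1_gt0 : 0 < c1) (c2_gt0 : 0 < c2).
Hypothesis g_linear : forall y, B y -> forall u, linear (g y u).
Hypothesis g_sym : forall y, B y -> forall u v, g y u v = g y v u.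
Hypothesis g_coercive : forall y, B y -> forall v,
  c1 * `|v| ^+ 2 <= g y v v <= c2 * `|v| ^+ 2.

(** Boundedness of a family of vectors indexed by the base point. *)
Definition bounded_on (X : normedModType R) (a : V -> X) :=
  exists K : R, forall y, B y -> `|a y| <= K.

Lemma bounded_onD (X : normedModType R) (a b : V -> X) : bounded_on a -> bounded_on b ->
  bounded_on (fun y => a y + b y).
Proof.
move=> [K aK] [L bL]; exists (K + L) => y By.
by apply: le_trans (ler_normD _ _) _; rewrite lerD ?aK ?bL.
Qed.

Lemma bounded_onZ (X : normedModType R) s (a : V -> X) : bounded_on a ->
  bounded_on (fun y => s *: a y).
Proof.
by move=> [K aK]; exists (`|s| * K) => y By; rewrite normrZ ler_wpM2l ?aK.
Qed.

Lemma bounded_on_cst (X : normedModType R) (x : X) : bounded_on (fun _ => x).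
Proof. by exists `|x|. Qed.

Lemma bounded_on_pair (a b : V -> V) : bounded_on a -> bounded_on b ->
  bounded_on (fun y => (a y, b y) : E).
Proof.
move=> [K aK] [L bL]; exists (Num.max K L) => y By.
by rewrite prod_normE /= ge_max !le_max aK//= bL// orbT.
Qed.

(** Linear functionals indexed by the base point, uniformly bounded on [B]. *)
Definition functional_family (phi : V -> V -> R) :=
  (forall y, linear (phi y)) /\
  exists2 K, 0 <= K & forall y r, B y -> `|phi y r| <= K * `|r|.

Lemma functional_familyD phi psi : functional_family phi -> functional_family psi ->
  functional_family (fun y r => phi y r + psi y r).
Proof.
move=> [lp [K K0 pK]] [ls [L L0 sL]]; split.
  by move=> y a u v; rewrite lp ls scalerDr addrACA.
exists (K + L) => [|y r By]; first by rewrite addr_ge0.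
by apply: le_trans (ler_normD _ _) _; rewrite mulrDl lerD ?pK ?sL.
Qed.

Lemma functional_familyZ s phi : functional_family phi ->
  functional_family (fun y r => s * phi y r).
Proof.
move=> [lp [K K0 pK]]; split.
  by move=> y a u v; rewrite lp mulrDr; congr (_ + _); exact: mulrCA.
exists (`|s| * K) => [|y r By]; first by rewrite mulr_ge0.
by rewrite normrM -mulrA ler_wpM2l ?pK.
Qed.

(** The Riesz representation with parameters: the linear equation satisfied by each
    coefficient of the expansion has a uniformly bounded solution. *)
Lemma solve_family (s : R) phi : s != 0 -> functional_family phi ->
  exists2 x : V -> V, bounded_on x &
    forall y r, B y -> s * g y (x y) r + phi y r = 0.
Proof.
move=> s0 [lp [K K0 pK]].
have H y : exists x : V, B y -> `|x| <= `|s|^-1 * K / c1 /\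
    forall r, s * g y x r + phi y r = 0.
  have [By|nBy] := pselect (B y); last by exists 0.
  have cphi : continuous (phi y).
    by apply: (bounded_linear_continuous (k := K)) => // x; exact: pK.
  have [x xr] := riesz c1_gt0 c2_gt0 (g_linear By) (g_sym By) (g_coercive By)
    (- s^-1 *: to_clin (phi y)).
  have xE r : g y x r = - s^-1 * phi y r.
    by rewrite xr clin_scaleE to_clinE//.
  exists x => _; split; last by move=> r; rewrite xE; field.
  apply: (form_dual_bound c1_gt0 (g_coercive By)).
    by rewrite mulr_ge0// invr_ge0.
  move=> r; rewrite xE normrM normrN normfV -mulrA ler_wpM2l ?invr_ge0//.
  exact: pK.
have [x xP] := choice H; exists x.
  by exists (`|s|^-1 * K / c1) => y /xP[].
by move=> y r /xP[].
Qed.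

(** In the application, [F y k] is the differential of the functional at
    [(y, y) + k], and [T2], [T3], [T4] are the terms of its Taylor expansion at
    [(y, y)]; the last argument of type [E] is the test vector. *)
Variables (F : V -> E -> E -> R) (T2 : V -> E -> E -> R) (T3 : V -> E -> E -> E -> R)
  (T4 : V -> E -> E -> E -> E -> R).
Hypothesis F_scale : forall y k s x, F y k (s *: x) = s * F y k x.
Hypothesis T2D : forall i x y r, T2 i (x + y) r = T2 i x r + T2 i y r.
Hypothesis T2Z : forall i s x r, T2 i (s *: x) r = s * T2 i x r.
Hypothesis T3D1 : forall i x y z r, T3 i (x + y) z r = T3 i x z r + T3 i y z r.
Hypothesis T3Z1 : forall i s x z r, T3 i (s *: x) z r = s * T3 i x z r.
Hypothesis T3D2 : forall i x y z r, T3 i z (x + y) r = T3 i z x r + T3 i z y r.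
Hypothesis T3Z2 : forall i s x z r, T3 i z (s *: x) r = s * T3 i z x r.
Hypothesis T4D1 : forall i x y u v r, T4 i (x + y) u v r = T4 i x u v r + T4 i y u v r.
Hypothesis T4Z1 : forall i s x u v r, T4 i (s *: x) u v r = s * T4 i x u v r.
Hypothesis T4D2 : forall i x y u v r, T4 i u (x + y) v r = T4 i u x v r + T4 i u y v r.
Hypothesis T4Z2 : forall i s x u v r, T4 i u (s *: x) v r = s * T4 i u x v r.
Hypothesis T4D3 : forall i x y u v r, T4 i u v (x + y) r = T4 i u v x r + T4 i u v y r.
Hypothesis T4Z3 : forall i s x u v r, T4 i u v (s *: x) r = s * T4 i u v x r.
Hypothesis T2_linear : forall i x, linear (T2 i x).
Hypothesis T3_linear : forall i x y, linear (T3 i x y).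
Hypothesis T4_linear : forall i x y z, linear (T4 i x y z).
Hypothesis T2_bounded : exists2 K, 0 <= K & forall i x r, B i -> `|T2 i x r| <= K * `|x| * `|r|.
Hypothesis T3_bounded : exists2 K, 0 <= K &
  forall i x y r, B i -> `|T3 i x y r| <= K * `|x| * `|y| * `|r|.
Hypothesis T4_bounded : exists2 K, 0 <= K &
  forall i x y z r, B i -> `|T4 i x y z r| <= K * `|x| * `|y| * `|z| * `|r|.
Hypothesis taylor : exists K eta, [/\ 0 <= K, 0 < eta & forall i k r, B i -> `|k| < eta ->
  `|F i k r - T2 i k r - 2^-1 * T3 i k k r - T4 i k k k r| <= K * `|k| ^+ N * `|r|].
Hypothesis T2_metric : forall y a b, B y -> T2 y a b = 2 * g y (a.2 - a.1) (b.2 - b.1).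

Section Slot.
Variable sigma : V -> E.
Hypothesis sigma_linear : linear sigma.
Hypothesis sigma_norm : forall r, `|sigma r| = `|r|.

Lemma functional_family_T2 a : bounded_on a ->
  functional_family (fun y r => T2 y (a y) (sigma r)).
Proof.
move=> [L aL]; have [K K0 TK] := T2_bounded; split.
  by move=> y s u v; rewrite sigma_linear T2_linear.
exists (K * `|L|) => [|y r By]; first by rewrite mulr_ge0.
apply: le_trans (TK _ _ _ By) _; rewrite sigma_norm ler_wpM2r// ler_wpM2l//.
by rewrite (le_trans (aL y By))// ler_norm.
Qed.

Lemma functional_family_T3 a b : bounded_on a -> bounded_on b ->
  functional_family (fun y r => T3 y (a y) (b y) (sigma r)).
Proof.
move=> [L aL] [L' bL]; have [K K0 TK] := T3_bounded; split.
  by move=> y s u v; rewrite sigma_linear T3_linear.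
exists (K * `|L| * `|L'|) => [|y r By]; first by rewrite !mulr_ge0.
apply: le_trans (TK _ _ _ _ By) _; rewrite sigma_norm ler_wpM2r//.
have h1 : `|a y| <= `|L| by rewrite (le_trans (aL y By))// ler_norm.
have h2 : `|b y| <= `|L'| by rewrite (le_trans (bL y By))// ler_norm.
by rewrite ler_pM// ?mulr_ge0// ler_wpM2l.
Qed.

Lemma functional_family_T4 a b c : bounded_on a -> bounded_on b -> bounded_on c ->
  functional_family (fun y r => T4 y (a y) (b y) (c y) (sigma r)).
Proof.
move=> [L aL] [L' bL] [L2 cL]; have [K K0 TK] := T4_bounded; split.
  by move=> y s u v; rewrite sigma_linear T4_linear.
exists (K * `|L| * `|L'| * `|L2|) => [|y r By]; first by rewrite !mulr_ge0.
apply: le_trans (TK _ _ _ _ _ By) _; rewrite sigma_norm ler_wpM2r//.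
have h1 : `|a y| <= `|L| by rewrite (le_trans (aL y By))// ler_norm.
have h2 : `|b y| <= `|L'| by rewrite (le_trans (bL y By))// ler_norm.
have h3 : `|c y| <= `|L2| by rewrite (le_trans (cL y By))// ler_norm.
by rewrite ler_pM// ?mulr_ge0// ler_pM// ?mulr_ge0// ler_wpM2l.
Qed.

End Slot.

(** Embeddings of test vectors for the derivatives with respect to the first and the
    second argument. *)
Definition in_fst (r : V) : E := (r, 0).
Definition in_snd (r : V) : E := (0, r).

Lemma in_fst_linear : linear in_fst.
Proof. by move=> s u v; congr (_, _); rewrite /= scaler0 addr0. Qed.
Lemma in_snd_linear : linear in_snd.
Proof. by move=> s u v; congr (_, _); rewrite /= scaler0 addr0. Qed.
Lemma in_fst_norm r : `|in_fst r| = `|r|. Proof. exact: norm_inl. Qed.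
Lemma in_snd_norm r : `|in_snd r| = `|r|. Proof. exact: norm_inr. Qed.

(** Coefficients of [t^2] and [t^3] in [F] along the curve
    [t a + t^2 b + t^3 c]. *)
Definition order2 (a b : V -> E) y x := T2 y (b y) x + 2^-1 * T3 y (a y) (a y) x.
Definition order3 (a b c : V -> E) y x := T2 y (c y) x +
  2^-1 * (T3 y (a y) (b y) x + T3 y (b y) (a y) x) + T4 y (a y) (a y) (a y) x.

Lemma single_curve (h : V -> R -> E) (a b c : V -> E) :
  bounded_on a -> bounded_on b -> bounded_on c ->
  uniform_O B N (fun i t => h i t - t *: a i - t ^+ 2 *: b i - t ^+ 3 *: c i) ->
  exists K t0, [/\ 0 <= K, 0 < t0 & forall y t x, B y -> `|t| < t0 -> `|x| <= 1 ->
    `|F y (h y t) x - t * T2 y (a y) x - t ^+ 2 * order2 a b y x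
      - t ^+ 3 * order3 a b c y x| <= K * `|t| ^+ N].
Proof.
move=> [Ka aK] [Kb bK] [Kc cK] hO.
(* The test vector [x] becomes part of the index, so that the expansion is
   scalar and uniform for [|x| <= 1]. *)
pose Bj : set (V * E) := [set j | B j.1 /\ `|j.2| <= 1].
have H := @curve_expansion R (V * E)%type Bj E (fun j k => F j.1 k j.2)
  (fun j a => T2 j.1 a j.2) (fun j a b => T3 j.1 a b j.2)
  (fun j a b c => T4 j.1 a b c j.2) N N3 N4
  (fun j x y => T2D j.1 x y j.2) (fun j s x => T2Z j.1 s x j.2)
  (fun j x y z => T3D1 j.1 x y z j.2) (fun j s x z => T3Z1 j.1 s x z j.2)
  (fun j x y z => T3D2 j.1 x y z j.2) (fun j s x z => T3Z2 j.1 s x z j.2)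
  (fun j x y u v => T4D1 j.1 x y u v j.2) (fun j s x u v => T4Z1 j.1 s x u v j.2)
  (fun j x y u v => T4D2 j.1 x y u v j.2) (fun j s x u v => T4Z2 j.1 s x u v j.2)
  (fun j x y u v => T4D3 j.1 x y u v j.2) (fun j s x u v => T4Z3 j.1 s x u v j.2)
  _ _ _ _ (fun j t => h j.1 t) (fun j => a j.1) (fun j => b j.1) (fun j => c j.1).
have {H} [K [t0 [K0 t00 HK]]] : uniform_O Bj N (fun j t => F j.1 (h j.1 t) j.2
   - t * T2 j.1 (a j.1) j.2
   - t ^+ 2 * (T2 j.1 (b j.1) j.2 + 2^-1 * T3 j.1 (a j.1) (a j.1) j.2)
   - t ^+ 3 * (T2 j.1 (c j.1) j.2 + 2^-1 * (T3 j.1 (a j.1) (b j.1) j.2 + T3 j.1 (b j.1) (a j.1) j.2)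
              + T4 j.1 (a j.1) (a j.1) (a j.1) j.2)).
  apply: H.
  - have [K K0 TK] := T2_bounded; exists K => // -[y x] k [/= By x1].
    by apply: le_trans (TK _ _ _ By) _; rewrite ler_piMr// mulr_ge0.
  - have [K K0 TK] := T3_bounded; exists K => // -[y x] k k' [/= By x1].
    by apply: le_trans (TK _ _ _ _ By) _; rewrite ler_piMr// !mulr_ge0.
  - have [K K0 TK] := T4_bounded; exists K => // -[y x] k k' k2 [/= By x1].
    by apply: le_trans (TK _ _ _ _ _ By) _; rewrite ler_piMr// !mulr_ge0.
  - have [K [eta [K0 eta0 TK]]] := taylor; exists K, eta; split => // -[y x] k [/= By x1] ke.
    by apply: le_trans (TK _ _ _ By ke) _; rewrite ler_piMr// mulr_ge0// exprn_ge0.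
  - by exists Ka => -[y x] [/= By _]; exact: aK.
  - by exists Kb => -[y x] [/= By _]; exact: bK.
  - by exists Kc => -[y x] [/= By _]; exact: cK.
  - have [K [t0 [K0 t00 hK]]] := hO; exists K, t0; split => // -[y x] t [/= By _].
    exact: hK.
exists K, t0; split => // y t x By tt x1.
exact: (HK (y, x) t (conj By x1) tt).
Qed.

(** If the first three coefficients of the residual vanish, it is of order [N]. *)
Lemma residual_expansion (h h' : V -> R -> E) (a b c a' b' c' : V -> E) :
  bounded_on a -> bounded_on b -> bounded_on c ->
  bounded_on a' -> bounded_on b' -> bounded_on c' ->
  uniform_O B N (fun i t => h i t - t *: a i - t ^+ 2 *: b i - t ^+ 3 *: c i) ->
  uniform_O B N (fun i t => h' i t - t *: a' i - t ^+ 2 *: b' i - t ^+ 3 *: c' i) ->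
  (forall y r, B y -> T2 y (a y) (in_snd r) + T2 y (a' y) (in_fst r) = 0) ->
  (forall y r, B y -> order2 a b y (in_snd r) + order2 a' b' y (in_fst r) = 0) ->
  (forall y r, B y -> order3 a b c y (in_snd r) + order3 a' b' c' y (in_fst r) = 0) ->
  exists K t0, [/\ 0 <= K, 0 < t0 & forall y t r, B y -> `|t| < t0 ->
    `|F y (h y t) (in_snd r) + F y (h' y t) (in_fst r)| <= K * `|t| ^+ N * `|r|].
Proof.
move=> ab bb cb ab' bb' cb' hO hO' l1 l2 l3.
have [K [t0 [K0 t00 HK]]] := single_curve ab bb cb hO.
have [K' [t0' [K0' t00' HK']]] := single_curve ab' bb' cb' hO'.
exists (K + K'), (Num.min t0 t0'); split; rewrite ?addr_ge0// ?lt_min ?t00//.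
move=> y t r By; rewrite lt_min => /andP[tt tt'].
have H x : `|x| <= 1 -> `|F y (h y t) (in_snd x) + F y (h' y t) (in_fst x)| <= (K + K') * `|t| ^+ N.
  move=> x1; have h1 := HK y t (in_snd x) By tt; have h2 := HK' y t (in_fst x) By tt'.
  rewrite in_snd_norm in h1; rewrite in_fst_norm in h2.
  have {}h1 := h1 x1; have {}h2 := h2 x1.
  have e1 := l1 y x By; have e2 := l2 y x By; have e3 := l3 y x By.
  rewrite mulrDl; apply: le_trans (lerD h1 h2); apply: le_trans (ler_normD _ _).
  rewrite le_eqVlt; apply/orP; left; apply/eqP; congr (`|_|).
  move: e1 e2 e3; move: (T2 _ _ _) (T2 _ _ _) (order2 _ _ _ _) (order2 _ _ _ _)
    (order3 _ _ _ _ _) (order3 _ _ _ _ _) (F _ _ _) (F _ _ _) => A1 A2 A3 A4 A5 A6 A7 A8 e1 e2 e3.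
  have -> : A2 = - A1 by lra.
  have -> : A4 = - A3 by lra.
  have -> : A6 = - A5 by lra.
  ring.
have [->|r0] := eqVneq r 0.
  have z x : in_snd 0 = 0 *: in_snd x by rewrite scale0r.
  have z' x : in_fst 0 = 0 *: in_fst x by rewrite scale0r.
  by rewrite (z 0) (z' 0) !F_scale !mul0r addr0 !normr0 mulr0.
have nr : 0 < `|r| by rewrite normr_gt0.
pose x := `|r|^-1 *: r.
have rx : r = `|r| *: x by rewrite /x scalerA divff ?scale1r// gt_eqF.
have nx : `|x| <= 1 by rewrite /x normrZ normfV normr_id mulVf// gt_eqF.
have es : in_snd r = `|r| *: in_snd x by rewrite {1}rx; congr (_, _); rewrite /= scaler0.
have ef : in_fst r = `|r| *: in_fst x by rewrite {1}rx; congr (_, _); rewrite /= scaler0.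
clearbody x; rewrite es ef !F_scale -mulrDr normrM normr_id mulrC ler_wpM2r//.
exact: H.
Qed.


Section Coefficients.
Variables (v : V) (d : V -> R -> V) (q1 d2 d3 : V -> V).
Hypothesis q1_bounded : bounded_on q1.
Hypothesis d2_bounded : bounded_on d2.
Hypothesis d3_bounded : bounded_on d3.
Let d1 y := v + q1 y.
Hypothesis d_expansion :
  uniform_O B N (fun y t => d y t - t *: d1 y - t ^+ 2 *: d2 y - t ^+ 3 *: d3 y).
(** First coefficient of the midpoint between [y] and [y + d y t]. *)
Let p1 y := 2^-1 *: d1 y.

(** The cubic curve with the given coefficients, as a displacement from [y]. *)
Definition pol (a b c : V -> V) (y : V) (t : R) := t *: a y + t ^+ 2 *: b y + t ^+ 3 *: c y.

Let d1_bounded : bounded_on d1.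
Proof. exact: bounded_onD (bounded_on_cst v) q1_bounded. Qed.
Let p1_bounded : bounded_on p1.
Proof. exact: bounded_onZ. Qed.
Let zero_bounded : bounded_on (fun _ => 0 : V).
Proof. exact: bounded_on_cst. Qed.

Lemma pol_expansion n (a b c : V -> V) :
  uniform_O B n (fun y t => pol a b c y t - t *: a y - t ^+ 2 *: b y - t ^+ 3 *: c y).
Proof.
exists 0, 1; split => // y t By _; rewrite mul0r /pol.
move: (t *: a y) (t ^+ 2 *: b y) (t ^+ 3 *: c y) => x z u.
have -> : x + z + u - x - z - u = x + z + u - (x + z + u) by rewrite !opprD !addrA.
by rewrite subrr normr0.
Qed.

Lemma pair_expansion (h h' : V -> R -> V) (a b c a' b' c' : V -> V) :
  uniform_O B N (fun y t => h y t - t *: a y - t ^+ 2 *: b y - t ^+ 3 *: c y) ->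
  uniform_O B N (fun y t => h' y t - t *: a' y - t ^+ 2 *: b' y - t ^+ 3 *: c' y) ->
  uniform_O B N (fun y t => ((h y t, h' y t) : E) - t *: ((a y, a' y) : E)
    - t ^+ 2 *: ((b y, b' y) : E) - t ^+ 3 *: ((c y, c' y) : E)).
Proof.
move=> [K [t0 [K0 t00 H]]] [K' [t0' [K0' t00' H']]].
exists (K + K'), (Num.min t0 t0'); split; rewrite ?addr_ge0// ?lt_min ?t00//.
move=> y t By; rewrite lt_min => /andP[h1 h2].
have {}h1 := H y t By h1; have {}h2 := H' y t By h2.
have t30 : 0 <= `|t| ^+ N by rewrite exprn_ge0.
rewrite prod_normE /= ge_max; apply/andP; split.
  by apply: le_trans h1 _; rewrite ler_wpM2r// lerDl.
by apply: le_trans h2 _; rewrite ler_wpM2r// lerDr.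
Qed.

Let z0 : V -> V := fun _ => 0.

Lemma zero_expansion :
  uniform_O B N (fun y t => (0 : V) - t *: z0 y - t ^+ 2 *: z0 y - t ^+ 3 *: z0 y).
Proof.
by exists 0, 1; split => // y t By _; rewrite !scaler0 !subr0 normr0 mul0r.
Qed.

Lemma direction_expansion :
  uniform_O B N (fun y t => t *: v - t *: v - t ^+ 2 *: z0 y - t ^+ 3 *: z0 y).
Proof.
by exists 0, 1; split => // y t By _; rewrite !scaler0 !subr0 subrr normr0 mul0r.
Qed.

(** Coefficients of a cubic approximation to the pair [(c, z)]. The first ones are
    [p1] and [q1]; the others are obtained one after the other by annihilating the
    coefficients of [t^2] and [t^3], where the coefficient sought enters only
    through the metric. *)
Lemma approximate_solution : exists p2 p3 q2 q3 : V -> V,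
  [/\ [/\ bounded_on p2, bounded_on p3, bounded_on q2 & bounded_on q3],
   (forall y r, B y ->
      4 * g y (p2 y) r + (2^-1 * T3 y (0, p1 y) (0, p1 y) (in_snd r)
        + 2^-1 * T3 y (p1 y, d1 y) (p1 y, d1 y) (in_fst r)
        + T2 y (0, d2 y) (in_fst r)) = 0),
   (forall y r, B y ->
      - 2 * g y (q2 y) r + (T2 y (0, p2 y) (in_snd r) + T2 y (p2 y, 0) (in_fst r)
        + 2^-1 * T3 y (q1 y, p1 y) (q1 y, p1 y) (in_snd r)
        + 2^-1 * T3 y (p1 y, v) (p1 y, v) (in_fst r)) = 0),
   (exists K t0, [/\ 0 <= K, 0 < t0 & forall y t r, B y -> `|t| < t0 ->
      `|F y (0, pol p1 p2 p3 y t) (in_snd r) + F y (pol p1 p2 p3 y t, d y t) (in_fst r)|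
        <= K * `|t| ^+ N * `|r|]) &
   (exists K t0, [/\ 0 <= K, 0 < t0 & forall y t r, B y -> `|t| < t0 ->
      `|F y (pol q1 q2 q3 y t, pol p1 p2 p3 y t) (in_snd r)
        + F y (pol p1 p2 p3 y t, t *: v) (in_fst r)| <= K * `|t| ^+ N * `|r|])].
Proof.
have s4 : 4 != 0 :> R by rewrite pnatr_eq0.
have s2 : - 2 != 0 :> R by rewrite oppr_eq0 pnatr_eq0.
have pp y : p1 y + p1 y = d1 y.
  have h2 : 2^-1 + 2^-1 = 1 :> R by field.
  by rewrite /p1 -scalerDl h2 scale1r.
have vb := bounded_on_cst v.
have b0 (a : V -> V) : bounded_on a -> bounded_on (fun y => (0, a y) : E).
  by move=> ab; exact: bounded_on_pair.
have b1 (a : V -> V) : bounded_on a -> bounded_on (fun y => (a y, 0) : E).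
  by move=> ab; exact: bounded_on_pair.
pose sF := functional_family_T2 in_fst_linear in_fst_norm.
pose sS := functional_family_T2 in_snd_linear in_snd_norm.
pose tF := functional_family_T3 in_fst_linear in_fst_norm.
pose tS := functional_family_T3 in_snd_linear in_snd_norm.
pose uF := functional_family_T4 in_fst_linear in_fst_norm.
pose uS := functional_family_T4 in_snd_linear in_snd_norm.
have gS y (a b : V) r : B y -> T2 y (a, b) (in_snd r) = 2 * g y (b - a) r.
  by move=> By; rewrite T2_metric//= subr0.
have gF y (a b : V) r : B y -> T2 y (a, b) (in_fst r) = - (2 * g y (b - a) r).
  by move=> By; rewrite T2_metric//= sub0r (formNr (g_linear By)) mulrN.
have pd1 := bounded_on_pair p1_bounded d1_bounded.
have p01 := b0 _ p1_bounded.
have [p2 p2b p2E] := solve_family s4 (functional_familyD (functional_familyD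
  (functional_familyZ 2^-1 (tS _ _ p01 p01)) (functional_familyZ 2^-1 (tF _ _ pd1 pd1)))
  (sF _ (b0 _ d2_bounded))).
have pd2 := bounded_on_pair p2b d2_bounded.
have p02 := b0 _ p2b.
have [p3 p3b p3E] := solve_family s4 (functional_familyD (functional_familyD
  (functional_familyD (functional_familyZ 2^-1 (functional_familyD (tS _ _ p01 p02) (tS _ _ p02 p01)))
    (uS _ _ _ p01 p01 p01))
  (functional_familyD (functional_familyZ 2^-1 (functional_familyD (tF _ _ pd1 pd2) (tF _ _ pd2 pd1)))
    (uF _ _ _ pd1 pd1 pd1)))
  (sF _ (b0 _ d3_bounded))).
have qp1 := bounded_on_pair q1_bounded p1_bounded.
have pv1 := bounded_on_pair p1_bounded vb.
have [q2 q2b q2E] := solve_family s2 (functional_familyD (functional_familyD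
  (functional_familyD (sS _ (b0 _ p2b)) (sF _ (b1 _ p2b)))
  (functional_familyZ 2^-1 (tS _ _ qp1 qp1))) (functional_familyZ 2^-1 (tF _ _ pv1 pv1))).
have qp2 := bounded_on_pair q2b p2b.
have pv2 := b1 _ p2b.
have [q3 q3b q3E] := solve_family s2 (functional_familyD (functional_familyD
  (functional_familyD (sS _ (b0 _ p3b)) (sF _ (b1 _ p3b)))
  (functional_familyD (functional_familyZ 2^-1 (functional_familyD (tS _ _ qp1 qp2) (tS _ _ qp2 qp1)))
    (uS _ _ _ qp1 qp1 qp1)))
  (functional_familyD (functional_familyZ 2^-1 (functional_familyD (tF _ _ pv1 pv2) (tF _ _ pv2 pv1)))
    (uF _ _ _ pv1 pv1 pv1))).
exists p2, p3, q2, q3; split => //.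
- apply: (@residual_expansion (fun y t => (0, pol p1 p2 p3 y t)) (fun y t => (pol p1 p2 p3 y t, d y t))
    (fun y => (0, p1 y)) (fun y => (0, p2 y)) (fun y => (0, p3 y))
    (fun y => (p1 y, d1 y)) (fun y => (p2 y, d2 y)) (fun y => (p3 y, d3 y))) => //.
  + exact: b0.
  + exact: bounded_on_pair.
  + exact: (pair_expansion zero_expansion (pol_expansion _ _ _ _)).
  + exact: (pair_expansion (pol_expansion _ _ _ _) d_expansion).
  + move=> y r By; rewrite gS// gF// subr0.
    have -> : d1 y - p1 y = p1 y by rewrite -pp addrK.
    by rewrite subrr.
  + move=> y r By; have := p2E y r By; rewrite /order2 !gS// !gF// !subr0.
    rewrite (formBl (g_linear By) (g_sym By)) => h; lra.
  + move=> y r By; have := p3E y r By; rewrite /order3 !gS// !gF// !subr0.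
    rewrite (formBl (g_linear By) (g_sym By)) => h; lra.
- apply: (@residual_expansion (fun y t => (pol q1 q2 q3 y t, pol p1 p2 p3 y t))
    (fun y t => (pol p1 p2 p3 y t, t *: v))
    (fun y => (q1 y, p1 y)) (fun y => (q2 y, p2 y)) (fun y => (q3 y, p3 y))
    (fun y => (p1 y, v)) (fun y => (p2 y, 0)) (fun y => (p3 y, 0))) => //.
  + exact: bounded_on_pair.
  + exact: b1.
  + exact: (pair_expansion (pol_expansion _ _ _ _) (pol_expansion _ _ _ _)).
  + exact: (pair_expansion (pol_expansion _ _ _ _) direction_expansion).
  + move=> y r By; rewrite gS// gF// -mulrBr -(formBl (g_linear By) (g_sym By)).
    have -> : p1 y - q1 y - (v - p1 y) = 0; last by rewrite (form0l (g_linear By) (g_sym By)) mulr0.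
    have -> : p1 y - q1 y - (v - p1 y) = p1 y + p1 y - d1 y.
      by rewrite opprB addrACA /d1 opprD [- v - _]addrC.
    by rewrite pp subrr.
  + move=> y r By; have := q2E y r By; rewrite /order2 !gS// !gF// !subr0 !sub0r.
    rewrite (formBl (g_linear By) (g_sym By)) !(formNl (g_linear By) (g_sym By)) => h; lra.
  + move=> y r By; have := q3E y r By; rewrite /order3 !gS// !gF// !subr0 !sub0r.
    rewrite (formBl (g_linear By) (g_sym By)) !(formNl (g_linear By) (g_sym By)) => h; lra.
Qed.

End Coefficients.

End ApproximateSolution.

(** * The second coefficient is the covariant derivative *)

Section SecondCoefficient.
Context {R : realType} {V : completeNormedModType R}.
Let E := (V * V)%type.
Variables (g : V -> V -> R) (Dg : V -> V -> V -> R) (A : V -> V -> V -> R)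
  (T2 : E -> E -> R) (T3 : E -> E -> E -> R).
Hypothesis g_linear : forall u, linear (g u).
Hypothesis g_sym : forall u v, g u v = g v u.
Hypothesis DgD1 : forall x y a b, Dg (x + y) a b = Dg x a b + Dg y a b.
Hypothesis DgZ1 : forall s x a b, Dg (s *: x) a b = s * Dg x a b.
Hypothesis DgD2 : forall x a a' b, Dg x (a + a') b = Dg x a b + Dg x a' b.
Hypothesis DgZ2 : forall s x a b, Dg x (s *: a) b = s * Dg x a b.
Hypothesis DgC : forall x a b, Dg x a b = Dg x b a.
Hypothesis AN : forall x y r, A x y (- r) = - A x y r.
Hypothesis T2E : forall a b, T2 a b = 2 * g (a.2 - a.1) (b.2 - b.1).
Hypothesis T3E : forall a b c, T3 a b c = 2 * Dg a.1 (b.2 - b.1) (c.2 - c.1)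
  + 2 * Dg b.1 (a.2 - a.1) (c.2 - c.1) + 2 * Dg c.1 (a.2 - a.1) (b.2 - b.1)
  + A (a.2 - a.1) (b.2 - b.1) (c.2 - c.1).

Variables (v q d2 p2 q2 : V).
Let d1 := v + q.
Let p := 2^-1 *: d1.
Hypothesis p2E : forall r, 4 * g p2 r + (2^-1 * T3 (0, p) (0, p) (in_snd r)
  + 2^-1 * T3 (p, d1) (p, d1) (in_fst r) + T2 (0, d2) (in_fst r)) = 0.
Hypothesis q2E : forall r, - 2 * g q2 r + (T2 (0, p2) (in_snd r) + T2 (p2, 0) (in_fst r)
  + 2^-1 * T3 (q, p) (q, p) (in_snd r) + 2^-1 * T3 (p, v) (p, v) (in_fst r)) = 0.

(** The symmetric trilinear part [A] cancels, as the arguments of its two occurrences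
    agree in each equation ([d1 - p = p] and [p - q = v - p = s]). What remains is
    the polarization of [p], [s], the half sum and half difference of [v] and [q],
    which produces the Christoffel terms. *)
Lemma second_coefficient r :
  2 * g q2 r = 2 * g d2 r + (Dg v q r - Dg r q v + Dg q v r).
Proof.
pose s := 2^-1 *: (v - q).
have hh (x : V) : 2^-1 *: x + 2^-1 *: x = x.
  have h2 : 2^-1 + 2^-1 = 1 :> R by field.
  by rewrite -scalerDl h2 scale1r.
have d1p : d1 - p = p by rewrite -{1}(hh d1) addrK.
have vp : v - p = s.
  rewrite -{1}(hh v) /p /s /d1 scalerDr scalerBr opprD addrACA.
  by rewrite subrr add0r.
have pq : p - q = s.
  rewrite -{1}(hh q) /p /s /d1 scalerDr scalerBr opprD addrACA.
  by rewrite subrr addr0.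
have Dg0 a b : Dg 0 a b = 0 by rewrite -(scale0r 0) DgZ1 mul0r.
have DgN a b c : Dg a b (- c) = - Dg a b c.
  by rewrite DgC -scaleN1r DgZ2 mulN1r DgC.
have DgD3 x a b b' : Dg x a (b + b') = Dg x a b + Dg x a b'.
  by rewrite DgC DgD2 !(DgC x a).
have DgZ3 t x a b : Dg x a (t *: b) = t * Dg x a b by rewrite DgC DgZ2 (DgC x a).
have DgN2 x a b : Dg x (- a) b = - Dg x a b by rewrite -scaleN1r DgZ2 mulN1r.
have := q2E r; have := p2E r; rewrite !T3E !T2E /= !subr0 !sub0r d1p vp pq !Dg0 !DgN !AN.
rewrite !(formNr g_linear) !(formNl g_linear g_sym).
have e1 : Dg p p r = 4^-1 * (Dg v v r + Dg v q r + Dg q v r + Dg q q r).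
  rewrite /p /d1 DgZ1 DgZ2 !DgD1 !DgD2; by field.
have e2 : Dg s s r = 4^-1 * (Dg v v r - Dg v q r - Dg q v r + Dg q q r).
  rewrite /s DgZ1 DgZ2 -scaleN1r !DgD1 !DgD2 !DgZ1 !DgZ2; by field.
have e3 : Dg r p p - Dg r s s = Dg r q v.
  rewrite /p /s /d1 !DgZ2 !DgZ3 !DgD2 !DgD3 !DgN2 !DgN (DgC r v q); by field.
have e4 : Dg q s r - Dg p s r = - Dg s s r.
  have ps : p = q + s by rewrite -pq addrC subrK.
  by rewrite ps DgD1; ring.
move: (A _ _ _) (A _ _ _) => A1 A2.
move: e1 e2 e3 e4; move: (Dg p p r) (Dg s s r) (Dg r p p) (Dg r s s) (Dg q s r) (Dg p s r).
move: (Dg v v r) (Dg v q r) (Dg q v r) (Dg q q r) (Dg r q v).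
move: (g p2 r) (g d2 r) (g q2 r) => *; lra.
Qed.

End SecondCoefficient.

Section CovariantDerivative.
Context {R : realType} {V : completeNormedModType R}.
Variables (g : V -> V -> V -> R) (y : V) (c1 c2 : R).
Hypothesis (c1_gt0 : 0 < c1) (c2_gt0 : 0 < c2).
Hypothesis g_linear : forall u, linear (g y u).
Hypothesis g_sym : forall u v, g y u v = g y v u.
Hypothesis g_coercive : forall v, c1 * `|v| ^+ 2 <= g y v v <= c2 * `|v| ^+ 2.

(** The vector [q - 'D_v w y] solves the equation defining the Christoffel operator,
    and both defining equations have at most one solution. *)
Lemma cov_deriv_unique (w : V -> V) (v q : V) :
  (forall r, 2 * g y q r = 2 * g y ('D_v w y) r +
    (metric_deriv g y v (w y) r - metric_deriv g y r (w y) v + metric_deriv g y (w y) v r)) ->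
  cov_deriv g w v y = q.
Proof.
move=> qE; set dw := 'D_v w y in qE *.
have chE r : 2 * g y (christoffel g y (w y) v) r = metric_deriv g y v (w y) r
    - metric_deriv g y r (w y) v + metric_deriv g y (w y) v r.
  rewrite /christoffel.
  have H : [set x | forall r, 2 * g y x r = metric_deriv g y v (w y) r
    - metric_deriv g y r (w y) v + metric_deriv g y (w y) v r] (q - dw).
    by move=> r' /=; rewrite (formBl g_linear g_sym) mulrBr qE addrC addKr.
  exact: (getPex (ex_intro _ _ H)).
have H : [set x | forall r, g y x r = g y dw r + g y (christoffel g y (w y) v) r] q.
  move=> r /=; have := qE r; rewrite -chE.
  move: (g y q r) (g y dw r) (g y _ r) => a b c; lra.
apply: (form_inj c1_gt0 g_linear g_sym g_coercive) => r.
have -> := getPex (ex_intro _ _ H) r.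
by rewrite (H r).
Qed.

End CovariantDerivative.

(** * Taylor expansion of the vector field *)

(** Vector-valued Taylor estimates follow from scalar ones by testing with [B r]. *)
Section VectorFieldTaylor.
Context {R : realType} {V : completeNormedModType R}.
Variables (B : V -> V -> R) (c1 c2 : R).
Hypothesis (c1_gt0 : 0 < c1) (c2_gt0 : 0 < c2).
Hypothesis B_linear : forall u, linear (B u).
Hypothesis B_sym : forall u v, B u v = B v u.
Hypothesis B_coercive : forall v, c1 * `|v| ^+ 2 <= B v v <= c2 * `|v| ^+ 2.
Variables (w : V -> V) (Dw : V -> 'L(V, V)) (D2w : V -> 'L(V, 'L(V, V)))
  (D3w : V -> 'L(V, 'L(V, 'L(V, V)))) (y0 : V) (rho K : R).
Hypothesis w_diff : forall x, `|x - y0| < rho -> is_diff x w (Dw x).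
Hypothesis Dw_diff : forall x, `|x - y0| < rho -> is_diff x Dw (D2w x).
Hypothesis D2w_diff : forall x, `|x - y0| < rho -> is_diff x D2w (D3w x).
Hypothesis D3w_bounded : forall x, `|x - y0| < rho -> `|D3w x| <= K.

Lemma is_derive_form (f : V -> V) (df : V -> V) p h r (t : R) :
  is_diff (p + t *: h) f df ->
  is_derive t 1 (fun s : R => B r (f (p + s *: h))) (B r (df h)).
Proof.
move=> fd; pose b : {linear V -> R} := HB.pack (B r) (GRing.isLinear.Build R V R *:%R (B r) (B_linear r)).
have cb : continuous b by exact: (form_continuous c1_gt0 B_linear B_sym B_coercive).
have bd : is_diff (f (p + t *: h)) b b.
  by split; [exact: linear_differentiable|rewrite diff_lin].
have := is_diff_comp fd bd; exact: (@is_derive_line1 _ _ (b \o f) (b \o df)).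
Qed.

Lemma field_taylor y h : `|y - y0| < rho -> `|y + h - y0| < rho ->
  `|w (y + h) - w y - Dw y h - 2^-1 *: D2w y h h| <= c2 * K / c1 * `|h| ^+ 3.
Proof.
move=> yr yhr; have K0 : 0 <= K by exact: le_trans (D3w_bounded yr).
have -> : c2 * K / c1 * `|h| ^+ 3 = (c2 * K * `|h| ^+ 3) / c1 by rewrite mulrAC.
apply: (form_dual_bound c1_gt0 B_coercive).
  by rewrite !mulr_ge0 ?exprn_ge0// ltW.
move=> r; rewrite B_sym.
have seg (t : R) : 0 <= t <= 1 -> `|y + t *: h - y0| < rho by move=> t01; exact: ball_segment.
pose phi (i : nat) (t : R) : R := match i with
  | 0 => B r (w (y + t *: h)) | 1 => B r (Dw (y + t *: h) h)
  | 2 => B r (D2w (y + t *: h) h h) | _ => B r (D3w (y + t *: h) h h h) end.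
have := @taylor_bound _ 3 phi (c2 * K * `|h| ^+ 3 * `|r|) 1.
rewrite ler01 lexx => /(_ isT).
rewrite !big_ord_recl big_ord0 /= /bump /= !scale0r !addr0 scale1r !expr1n !mulr1 /= !divr1.
rewrite !(formBr B_linear) (formZr B_linear).
have -> (a b c d : R) : a - b - c - 2^-1 * d = a - (b + (c + d / 2)) by ring.
apply.
- move=> [|[|[|//]]] t _ t01.
  + by apply: is_derive_form; exact: w_diff (seg _ t01).
  + by have d1 := diff_lin1 h (Dw_diff (seg _ t01)); exact: (is_derive_form r d1).
  + have [d1 e1] := diff_lin1 h (D2w_diff (seg _ t01)).
    have d2 := is_diff_eval h d1; rewrite e1 in d2.
    exact: (is_derive_form r d2).
- move=> t /seg tr /=.
  apply: le_trans (form_bound c1_gt0 B_linear B_sym B_coercive _ _) _.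
  have h3 : `|D3w (y + t *: h) h h h| <= K * `|h| ^+ 3.
    apply: le_trans (clin_le3 _ _ _ _) _; apply: mulr3_le => //; exact: D3w_bounded.
  have -> : c2 * K * `|h| ^+ 3 * `|r| = c2 * `|r| * (K * `|h| ^+ 3) by ring.
  by apply: ler_wpM2l => //; rewrite mulr_ge0// ltW.
Qed.

(** The displacement [t v + t w(y + t v)] gains one order over the expansion of [w]. *)
Lemma field_expansion (v : V) n (n4 : (n <= 4)%N) : 0 < rho ->
  uniform_O [set y | `|y - y0| < rho / 2] n (fun y t =>
    (t *: v + t *: w (y + t *: v)) - t *: (v + w y) - t ^+ 2 *: 'D_v w y
      - t ^+ 3 *: (2^-1 *: D2w y v v)).
Proof.
move=> r0; apply: (uniform_O_le n4).
have v1 : 0 < `|v| + 1 by rewrite ltr_wpDl.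
exists (`|c2 * K / c1| * `|v| ^+ 3), (rho / 2 / (`|v| + 1)); split.
- by rewrite mulr_ge0// exprn_ge0.
- by rewrite !divr_gt0.
move=> y t /= yr; rewrite (ltr_pdivlMr _ _ v1) => tv.
have tv' : `|t *: v| < rho / 2.
  by rewrite normrZ; apply: le_lt_trans tv; rewrite ler_wpM2l// lerDl.
have yr1 : `|y - y0| < rho by rewrite (lt_trans yr)// ltr_pdivrMr// ltr_pMr// ltr1n.
have yr2 : `|y + t *: v - y0| < rho.
  by rewrite addrAC; apply: le_lt_trans (ler_normD _ _) _; rewrite [rho]splitr ltrD.
have wdy := w_diff yr1; have dE : 'D_v w y = Dw y v.
  by case: wdy => d1 e1; rewrite deriveE// e1.
have := field_taylor yr1 yr2; rewrite dE.
rewrite clinZ1 clinZ2 (clinZ1 (D2w y v)).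
move: (w (y + t *: v)) (w y) (Dw y v) (D2w y v v) => a b c e H.
have -> : t *: v + t *: a - t *: (v + b) - t ^+ 2 *: c - t ^+ 3 *: (2^-1 *: e) =
  t *: (a - b - t *: c - 2^-1 *: (t *: (t *: e))).
  rewrite !scalerBr scalerDr opprD addrACA subrr add0r !scalerA.
  by congr (_ - _ *: _ - _ *: _); ring.
rewrite normrZ exprS [leRHS]mulrCA ler_wpM2l//.
apply: le_trans H _; rewrite normrZ; move: (c2 * K / c1) => A.
have -> : `|A| * `|v| ^+ 3 * `|t| ^+ 3 = `|A| * (`|t| * `|v|) ^+ 3 by ring.
by rewrite ler_wpM2r ?ler_norm// exprn_ge0// mulr_ge0.
Qed.

End VectorFieldTaylor.

(** * Expansion of the inverse discrete transport *)

Section RealBounds.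
Context {R : realDomainType}.
Implicit Types a k x y z t : R.

Lemma scale2_le a k x y : a <= k -> 0 <= x -> 0 <= y -> a * x * y <= k * x * y.
Proof. by move=> ak x0 y0; rewrite !ler_wpM2r. Qed.

Lemma scale3_le a k x y z : a <= k -> 0 <= x -> 0 <= y -> 0 <= z ->
  a * x * y * z <= k * x * y * z.
Proof. by move=> ak x0 y0 z0; rewrite !ler_wpM2r. Qed.

Lemma scale4_le s a k x y z t : 0 <= s -> a <= k -> 0 <= x -> 0 <= y -> 0 <= z -> 0 <= t ->
  s * (a * x * y * z * t) <= s * k * x * y * z * t.
Proof. by move=> s0 ak x0 y0 z0 t0; rewrite -!mulrA ler_wpM2l// ler_wpM2r// !mulr_ge0. Qed.

End RealBounds.

Section TransportExpansion.
Context {R : realType} {V : completeNormedModType R}.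
Let E := (V * V)%type.
Variables (W : E -> R) (D1 : E -> 'L(E, R)) (D2 : E -> 'L(E, 'L(E, R)))
  (D3 : E -> 'L(E, 'L(E, 'L(E, R)))) (D4 : E -> 'L(E, 'L(E, 'L(E, 'L(E, R))))).
Variables (y0 : V) (rho : R) (g : V -> V -> V -> R) (c1 c2 : R) (N : nat) (s Kb : R).
Let P : E := (y0, y0).
Hypothesis N3 : (3 <= N)%N.
Hypothesis N4 : (N <= 4)%N.
Hypothesis rho_gt0 : 0 < rho.
Hypothesis (c1_gt0 : 0 < c1) (c2_gt0 : 0 < c2).
Hypothesis g_linear : forall y, `|y - y0| < rho -> forall u, linear (g y u).
Hypothesis g_sym : forall y, `|y - y0| < rho -> forall u v, g y u v = g y v u.
Hypothesis g_coercive : forall y, `|y - y0| < rho -> forall v,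
  c1 * `|v| ^+ 2 <= g y v v <= c2 * `|v| ^+ 2.
Hypothesis W_diff : forall x, `|x - P| < rho -> is_diff x W (D1 x).
Hypothesis D1_diff : forall x, `|x - P| < rho -> is_diff x D1 (D2 x).
Hypothesis D2_diff : forall x, `|x - P| < rho -> is_diff x D2 (D3 x).
Hypothesis D2_close : forall x, `|x - P| < rho -> `|D2 x - D2 P| <= c1.
Hypothesis D2_bounded : forall x, `|x - P| < rho -> `|D2 x| <= Kb.
Hypothesis D3_bounded : forall x, `|x - P| < rho -> `|D3 x| <= Kb.
Hypothesis D4_bounded : forall x, `|x - P| < rho -> `|D4 x| <= Kb.
Hypothesis W_expansion : forall y, `|y - y0| < rho -> forall h e, 0 < e ->
  exists2 s0, 0 < s0 & forall t : R, `|t| < s0 ->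
    `|W (y, y + t *: h) - t ^+ 2 * g y h h| <= e * t ^+ 2.
Hypothesis taylor : exists K eta, [/\ 0 <= K, 0 < eta &
  forall y k r, `|y - y0| < rho / 2 -> `|k| < eta ->
  `|D1 ((y, y) + k) r - D2 (y, y) k r - 2^-1 * D3 (y, y) k k r
     - s * D4 (y, y) k k k r| <= K * `|k| ^+ N * `|r|].

Variables (w : V -> V) (v : V) (d3 : V -> V).
Let B : set V := [set y | `|y - y0| < rho / 2].
Hypothesis w_bounded : bounded_on B w.
Hypothesis Dw_bounded : bounded_on B ('D_v w).
Hypothesis d3_bounded : bounded_on B d3.
Hypothesis w_expansion : uniform_O B N (fun y t => (t *: v + t *: w (y + t *: v))
  - t *: (v + w y) - t ^+ 2 *: 'D_v w y - t ^+ 3 *: d3 y).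

Let rho0 : `|y0 - y0| < rho. Proof. by rewrite subrr normr0. Qed.
Let P0 : `|P - P| < rho. Proof. by rewrite subrr normr0. Qed.
Let B_in y : B y -> `|y - y0| < rho.
Proof. by move=> yB; rewrite (lt_trans yB)// ltr_pdivrMr// ltr_pMr// ltr1n. Qed.
Let D3b : exists K, forall x, `|x - P| < rho -> `|D3 x| <= K.
Proof. by exists Kb. Qed.
Let D2E y a b : `|y - y0| < rho -> D2 (y, y) a b = 2 * g y (a.2 - a.1) (b.2 - b.1).
Proof. exact: (D2_diag W_diff D1_diff D2_diff D3b g_linear g_sym W_expansion). Qed.
Let D2PE a b : D2 P a b = 2 * g y0 (a.2 - a.1) (b.2 - b.1).
Proof. exact: D2E. Qed.
Let D1_0 y : `|y - y0| < rho -> D1 (y, y) = 0.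
Proof. exact: (D1_diag W_diff D1_diff D2_diff D3b W_expansion). Qed.
Let Kb0 : 0 <= Kb. Proof. exact: le_trans (D2_bounded P0). Qed.

Let F y (k : E) (x : E) : R := D1 ((y, y) + k) x.
Let T2 y (k : E) (x : E) : R := D2 (y, y) k x.
Let T3 y (k l : E) (x : E) : R := D3 (y, y) k l x.
Let T4 y (k l m : E) (x : E) : R := s * D4 (y, y) k l m x.

Lemma uniform_O_small (X : normedModType R) (e : V -> R -> X) (eta : R) :
  uniform_O B 1 e -> 0 < eta ->
  exists2 t1, 0 < t1 & forall y t, B y -> `|t| < t1 -> `|e y t| < eta.
Proof.
move=> [K [t0 [K0 t00 H]]] eta0; have K1 : 0 < K + 1 by rewrite ltr_wpDl.
exists (Num.min t0 (eta / (K + 1))); first by rewrite lt_min t00 divr_gt0.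
move=> y t By; rewrite lt_min (ltr_pdivlMr _ _ K1) => /andP[tt te].
apply: le_lt_trans (H y t By tt) _; rewrite expr1.
by apply: le_lt_trans te; rewrite mulrC ler_wpM2l// lerDl.
Qed.

Lemma pol_small (a b c : V -> V) : bounded_on B a -> bounded_on B b -> bounded_on B c ->
  uniform_O B 1 (pol a b c).
Proof.
move=> ab bb cb; apply: uniform_OD; first apply: uniform_OD.
- exact: (uniform_O_pow 1 (uniform_O_bounded ab)).
- by apply: (@uniform_O_le _ _ _ _ 2) => //; exact: (uniform_O_pow 2 (uniform_O_bounded bb)).
- by apply: (@uniform_O_le _ _ _ _ 3) => //; exact: (uniform_O_pow 3 (uniform_O_bounded cb)).
Qed.

Lemma metric_deriv_D3 y k a b : B y ->
  metric_deriv g y k a b = 2^-1 * D3 (y, y) (k, k) (0, a) (0, b).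
Proof.
by move=> By; exact: (metric_derivE W_diff D1_diff D2_diff D3b g_linear g_sym W_expansion _ _ _ (B_in By)).
Qed.

(** The approximate solution for the Taylor data of [W] at [(y, y)]. *)
Lemma transport_coefficients : exists p2 p3 q2 q3 : V -> V,
  let p1 := fun y => 2^-1 *: (v + w y) in
  [/\ [/\ bounded_on B p2, bounded_on B p3, bounded_on B q2 & bounded_on B q3],
   (forall y, B y -> q2 y = cov_deriv g w v y),
   (exists K t0, [/\ 0 <= K, 0 < t0 & forall y t r, B y -> `|t| < t0 ->
      `|F y (0, pol p1 p2 p3 y t) (in_snd r)
         + F y (pol p1 p2 p3 y t, t *: v + t *: w (y + t *: v)) (in_fst r)|
        <= K * `|t| ^+ N * `|r|]) &
   (exists K t0, [/\ 0 <= K, 0 < t0 & forall y t r, B y -> `|t| < t0 ->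
      `|F y (pol w q2 q3 y t, pol p1 p2 p3 y t) (in_snd r)
        + F y (pol p1 p2 p3 y t, t *: v) (in_fst r)| <= K * `|t| ^+ N * `|r|])].
Proof.
have gl y : B y -> forall u, linear (g y u) by move=> /B_in; exact: g_linear.
have gs y : B y -> forall u u', g y u u' = g y u' u by move=> /B_in; exact: g_sym.
have gc y : B y -> forall u, c1 * `|u| ^+ 2 <= g y u u <= c2 * `|u| ^+ 2.
  by move=> /B_in; exact: g_coercive.
have T2D i x y r : T2 i (x + y) r = T2 i x r + T2 i y r by rewrite /T2 clinD2.
have T2Z i t x r : T2 i (t *: x) r = t * T2 i x r by rewrite /T2 clinZ2.
have T3D1 i x y z r : T3 i (x + y) z r = T3 i x z r + T3 i y z r by rewrite /T3 clinD3.
have T3Z1 i t x z r : T3 i (t *: x) z r = t * T3 i x z r by rewrite /T3 clinZ3.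
have T3D2 i x y z r : T3 i z (x + y) r = T3 i z x r + T3 i z y r by rewrite /T3 clinD2.
have T3Z2 i t x z r : T3 i z (t *: x) r = t * T3 i z x r by rewrite /T3 clinZ2.
have T3D3 i x y z r : T3 i z r (x + y) = T3 i z r x + T3 i z r y by rewrite /T3 clinD1.
have T3Z3 i t x z r : T3 i z r (t *: x) = t * T3 i z r x by rewrite /T3 clinZ1.
have T4D1 i x y u u' r : T4 i (x + y) u u' r = T4 i x u u' r + T4 i y u u' r.
  by rewrite /T4 clinD4 mulrDr.
have T4Z1 i t x u u' r : T4 i (t *: x) u u' r = t * T4 i x u u' r.
  by rewrite /T4 clinZ4; exact: mulrCA.
have T4D2 i x y u u' r : T4 i u (x + y) u' r = T4 i u x u' r + T4 i u y u' r.
  by rewrite /T4 clinD3 mulrDr.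
have T4Z2 i t x u u' r : T4 i u (t *: x) u' r = t * T4 i u x u' r.
  by rewrite /T4 clinZ3; exact: mulrCA.
have T4D3 i x y u u' r : T4 i u u' (x + y) r = T4 i u u' x r + T4 i u u' y r.
  by rewrite /T4 clinD2 mulrDr.
have T4Z3 i t x u u' r : T4 i u u' (t *: x) r = t * T4 i u u' x r.
  by rewrite /T4 clinZ2; exact: mulrCA.
have T2l i x : linear (T2 i x) by move=> t a b; rewrite /T2 clinD1 clinZ1.
have T3l i x y : linear (T3 i x y) by move=> t a b; rewrite /T3 clinD1 clinZ1.
have T4l i x y z : linear (T4 i x y z).
  by move=> t a b; rewrite /T4 clinD1 clinZ1 mulrDr; congr (_ + _); exact: mulrCA.
have Fs y k t x : F y k (t *: x) = t * F y k x by rewrite /F clinZ1.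
have yP y : B y -> `|((y, y) : E) - P| < rho.
  by move=> /B_in; exact: diag_ball.
have T2b : exists2 K, 0 <= K & forall i x r, B i -> `|T2 i x r| <= K * `|x| * `|r|.
  exists Kb => // i x r Bi; apply: le_trans (clin_le2 _ _ _) _.
  by have H := D2_bounded (yP _ Bi); exact: scale2_le.
have T3b : exists2 K, 0 <= K & forall i x y r, B i -> `|T3 i x y r| <= K * `|x| * `|y| * `|r|.
  exists Kb => // i x y r Bi; apply: le_trans (clin_le3 _ _ _ _) _.
  by have H := D3_bounded (yP _ Bi); exact: scale3_le.
have T4b : exists2 K, 0 <= K & forall i x y z r, B i ->
    `|T4 i x y z r| <= K * `|x| * `|y| * `|z| * `|r|.
  exists (`|s| * Kb); first by rewrite mulr_ge0.
  move=> i x y z r Bi; rewrite /T4 normrM.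
  have h := clin_le4 (D4 (i, i)) x y z r.
  have H := D4_bounded (yP _ Bi).
  apply: le_trans (ler_wpM2l (normr_ge0 s) h) _; exact: scale4_le.
have tay : exists K eta, [/\ 0 <= K, 0 < eta & forall i k r, B i -> `|k| < eta ->
    `|F i k r - T2 i k r - 2^-1 * T3 i k k r - T4 i k k k r| <= K * `|k| ^+ N * `|r|].
  exact: taylor.
have T2m y a b : B y -> T2 y a b = 2 * g y (a.2 - a.1) (b.2 - b.1).
  by move=> /B_in; exact: D2E.
have [p2 [p3 [q2 [q3 [bds eqp eqq resp resq]]]]] :=
  approximate_solution N3 N4 c1_gt0 c2_gt0 gl gs gc Fs T2D T2Z T3D1 T3Z1 T3D2 T3Z2
    T4D1 T4Z1 T4D2 T4Z2 T4D3 T4Z3 T2l T3l T4l T2b T3b T4b tay T2m w_bounded Dw_bounded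
    d3_bounded w_expansion.
exists p2, p3, q2, q3; split => // y By; have yr := B_in By.
have mdE k a b := metric_deriv_D3 k a b By.
apply: esym; apply: (@cov_deriv_unique _ _ g y c1 c2 c1_gt0 (gl _ By) (gs _ By) (gc _ By)) => r.
apply: (@second_coefficient _ _ (g y) (metric_deriv g y)
  (fun a b c => T3 y (0, a) (0, b) (0, c)) (T2 y) (T3 y) (gl _ By) (gs _ By)
  _ _ _ _ _ _ _ _ v (w y) ('D_v w y) (p2 y) (q2 y)).
- move=> k k' a b; rewrite !mdE -mulrDr -[D3 _ _ _ _]/(T3 y _ _ _).
  rewrite -[D3 _ (k, k) _ _]/(T3 y _ _ _) -[D3 _ (k', k') _ _]/(T3 y _ _ _).
  by rewrite -T3D1.
- move=> t k a b; rewrite !mdE mulrCA; congr (_ * _).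
  exact: (T3Z1 y t (k, k) (0, a) (0, b)).
- move=> k a a' b; rewrite !mdE -mulrDr; congr (_ * _).
  have -> : ((0, a + a') : E) = (0, a) + (0, a') by congr (_, _); rewrite /= addr0.
  exact: (T3D2 y (0, a) (0, a') (k, k) (0, b)).
- move=> t k a b; rewrite !mdE mulrCA; congr (_ * _).
  have -> : ((0, t *: a) : E) = t *: ((0, a) : E) by congr (_, _); rewrite /= scaler0.
  exact: (T3Z2 y t (0, a) (k, k) (0, b)).
- by move=> k a b; rewrite (metric_derivC W_diff D1_diff D2_diff D3b g_linear g_sym W_expansion).
- move=> a b c; have -> : ((0, - c) : E) = (-1) *: ((0, c) : E).
    by rewrite scaleN1r; congr (_, _); rewrite /= oppr0.
  by rewrite T3Z3 mulN1r.
- by move=> a b; exact: T2m.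
- move=> a b c; exact: (D3_diag_formula W_diff D1_diff D2_diff D3b g_linear g_sym W_expansion a b c yr).
- by move=> r'; exact: eqp.
- by move=> r'; exact: eqq.
Qed.


Let p1 y := 2^-1 *: (v + w y).

Let p1_bounded : bounded_on B p1.
Proof. exact: bounded_onZ (bounded_onD (bounded_on_cst B v) w_bounded). Qed.

Let Cst := (1 + (`|D2 P| + c1) / c1) / c1.
Let Cst0 : 0 <= Cst.
Proof.
apply: divr_ge0 (ltW c1_gt0); apply: addr_ge0 => //.
by apply: divr_ge0 (ltW c1_gt0); apply: addr_ge0 (ltW c1_gt0).
Qed.

Lemma residual_le (a b c : V) (X : R) (k l : E) y : `|y - y0| < rho ->
  `|a - y0| < rho -> `|b - y0| < rho -> `|c - y0| < rho ->
  (y, y) + k = (a, b) -> (y, y) + l = (b, c) -> 0 <= X ->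
  (forall r, `|F y k (in_snd r) + F y l (in_fst r)| <= X * `|r|) ->
  `|residual W a b c| <= X.
Proof.
move=> yr ar br cr ek el X0 H; apply: clin_opnorm_le => // r.
change (`|res W a b c r| <= X * `|r|).
by rewrite (resE W_diff)// -ek -el; exact: H.
Qed.

(** The expansion holds for both signs of [t], and its constant does not depend on
    the radius [r]. *)
Lemma transport_expansion : exists q3 : V -> V, exists2 K : R, 0 <= K &
  bounded_on B q3 /\ forall r, 0 < r <= rho / 2 ->
  inv_transport_well_defined W (ball y0 (rho / 2)) r /\
  exists2 t1 : R, 0 < t1 & forall y t, B y -> `|t| < t1 ->
    `|inv_transport W r y (t *: v) (t *: w (y + t *: v)) - t *: w y
       - t ^+ 2 *: cov_deriv g w v y - t ^+ 3 *: q3 y| <= K * `|t| ^+ N.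
Proof.
have [p2 [p3 [q2 [q3 [[p2b p3b q2b q3b] q2E [Ka [ta [Ka0 ta0 HA]]] [Kq [tq [Kq0 tq0 HQ]]]]]]]] :=
  transport_coefficients.
exists q3, (Cst * (Ka + Kq)); first by apply: mulr_ge0 => //; exact: addr_ge0.
split=> // r rr; have wd := transport_well_defined rho_gt0 c1_gt0 c2_gt0 (g_linear rho0)
  (g_sym rho0) (g_coercive rho0) W_diff D1_diff D2PE D2_close D1_0 rr.
split=> //; have [del del0 Hdel] := wd.
move/andP: (rr) => [r0 r1].
have rho4 : 0 < rho / 4 by rewrite divr_gt0.
have [t1 t10 H1] := uniform_O_small (pol_small p1_bounded p2b p3b) r0.
have [t2 t20 H2] := uniform_O_small (pol_small w_bounded q2b q3b) r0.
have Ov : uniform_O B 1 (fun (_ : V) t => t *: v).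
  exact: (uniform_O_pow 1 (uniform_O_bounded (bounded_on_cst B v))).
have m0 : 0 < Num.min del (rho / 4) by rewrite lt_min del0.
have [t3 t30 H3] := uniform_O_small Ov m0.
have Ow : uniform_O B 1 (fun y t => t *: w (y + t *: v)).
  have h := uniform_O_le (leq_trans (isT : 1 <= 3)%N N3) w_expansion.
  have hp := pol_small (bounded_onD (bounded_on_cst B v) w_bounded) Dw_bounded d3_bounded.
  have := uniform_OD (uniform_OD h hp) (uniform_ON Ov); apply: uniform_O_eq => y t.
  rewrite /pol; move: (t *: (v + w y)) (t ^+ 2 *: _) (t ^+ 3 *: _) (t *: v) (t *: w _) => a b c x z.
  have -> : x + z - a - b - c = x + z - (a + b + c) by rewrite !opprD !addrA.
  by rewrite subrK addrC addKr.
have [t4 t40 H4] := uniform_O_small Ow m0.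
exists (Num.min (Num.min ta tq) (Num.min (Num.min t1 t2) (Num.min t3 t4))).
  by rewrite !lt_min ta0 tq0 t10 t20 t30 t40.
move=> y t By; rewrite !lt_min => /andP[/andP[tta ttq] /andP[/andP[tt1 tt2] /andP[tt3 tt4]]].
have c1r := H1 y t By tt1; have z1r := H2 y t By tt2.
have := H3 y t By tt3; rewrite lt_min => /andP[u1 u2].
have := H4 y t By tt4; rewrite lt_min => /andP[ze1 ze2].
set u := t *: v in u1 u2 *; set zeta := t *: w (y + u) in ze1 ze2 *.
have yb : ball y0 (rho / 2) y by rewrite -ball_normE /= distrC.
have [cz0 [cz0P _]] := Hdel y u zeta yb u1 ze1.
have czP := getPex (ex_intro _ _ cz0P) : transport_pair W r y u zeta (get (transport_pair W r y u zeta)).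
rewrite /inv_transport; move: (get _) czP => cz czP.
pose ch := y + pol p1 p2 p3 y t; pose zh := y + pol w q2 q3 y t.
have chr : `|ch - y| < r by rewrite /ch addrC addKr.
have zhr : `|zh - y| < r by rewrite /zh addrC addKr.
have By' : `|y - y0| < rho / 2 by exact: By.
have st := transport_stable rho_gt0 c1_gt0 c2_gt0 (g_linear rho0) (g_sym rho0) (g_coercive rho0)
  W_diff D1_diff D2PE D2_close By' r0 r1 u2 ze2 czP chr zhr.
have yr := B_in By.
have chy : `|ch - y0| < rho := near_y By' r1 chr.
have zhy : `|zh - y0| < rho := near_y By' r1 zhr.
have ra : `|residual W y ch (y + u + zeta)| <= Ka * `|t| ^+ N.
  apply: (@residual_le _ _ _ _ (0, pol p1 p2 p3 y t) (pol p1 p2 p3 y t, u + zeta) y) => //.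
  - exact: (in_yuz By' u2 ze2).
  - by congr (_, _); rewrite /= addr0.
  - by congr (_, _); rewrite /= addrA.
  - by rewrite mulr_ge0// exprn_ge0.
  - by move=> r'; exact: HA.
have rq : `|residual W zh ch (y + u)| <= Kq * `|t| ^+ N.
  apply: (@residual_le _ _ _ _ (pol w q2 q3 y t, pol p1 p2 p3 y t) (pol p1 p2 p3 y t, u) y) => //.
  - exact: (in_yu rho_gt0 By' u2).
  - by rewrite mulr_ge0// exprn_ge0.
  - by move=> r'; exact: HQ.
have -> : cz.2 - y - t *: w y - t ^+ 2 *: cov_deriv g w v y - t ^+ 3 *: q3 y = cz.2 - zh.
  by rewrite -(q2E y By) /zh /pol !opprD !addrA.
apply: le_trans st _; rewrite -/Cst -[leRHS]mulrA; apply: ler_wpM2l => //.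
by rewrite mulrDl; exact: lerD ra rq.
Qed.

End TransportExpansion.

(** * Difference quotients of smooth data *)

Section QuotientEstimates.
Context {R : realType} {V : normedModType R}.
Implicit Types z b c q : V.

Lemma one_sided_quotient z b c q (t K L : R) : 0 < t -> `|q| <= L ->
  `|z - t *: b - t ^+ 2 *: c - t ^+ 3 *: q| <= K * `|t| ^+ 3 ->
  `|(t ^+ 2)^-1 *: (z - t *: b) - c| <= (K + L) * t.
Proof.
move=> t0 qL; rewrite (gtr0_norm t0) => H; have t2 : 0 < t ^+ 2 by rewrite exprn_gt0.
have -> : (t ^+ 2)^-1 *: (z - t *: b) - c =
    (t ^+ 2)^-1 *: ((z - t *: b - t ^+ 2 *: c - t ^+ 3 *: q) + t ^+ 3 *: q).
  by rewrite subrK [RHS]scalerBr (scalerA _ (t ^+ 2)) mulVf ?gt_eqF// scale1r.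
rewrite normrZ ger0_norm ?invr_ge0 ?(ltW t2)// mulrC ler_pdivrMr//.
apply: le_trans (ler_normD _ _) _; rewrite normrZ ger0_norm ?exprn_ge0 ?(ltW t0)//.
have -> : (K + L) * t * t ^+ 2 = K * t ^+ 3 + t ^+ 3 * L by ring.
by rewrite lerD// ler_wpM2l// exprn_ge0// ltW.
Qed.

(** The terms of odd order cancel in the sum. *)
Lemma two_sided_quotient z z' b c q (t K : R) : 0 < t ->
  `|z - t *: b - t ^+ 2 *: c - t ^+ 3 *: q| <= K * `|t| ^+ 4 ->
  `|z' - (- t) *: b - (- t) ^+ 2 *: c - (- t) ^+ 3 *: q| <= K * `|- t| ^+ 4 ->
  `|(2 * t ^+ 2)^-1 *: (z + z') - c| <= K * t ^+ 2.
Proof.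
move=> t0; rewrite normrN (gtr0_norm t0) => H H'.
have t2 : 0 < 2 * t ^+ 2 by rewrite mulr_gt0// exprn_gt0.
have -> : (2 * t ^+ 2)^-1 *: (z + z') - c = (2 * t ^+ 2)^-1 *:
    ((z - t *: b - t ^+ 2 *: c - t ^+ 3 *: q) +
     (z' - (- t) *: b - (- t) ^+ 2 *: c - (- t) ^+ 3 *: q)).
  have -> : (- t) ^+ 3 = - t ^+ 3 by ring.
  rewrite sqrrN !scaleNr !opprK.
  have -> : z - t *: b - t ^+ 2 *: c - t ^+ 3 *: q +
      (z' + t *: b - t ^+ 2 *: c + t ^+ 3 *: q) = z + z' - (2 * t ^+ 2) *: c.
    rewrite addrACA addNr addr0 addrACA -opprD -scalerDl -mulr2n mulr_natl; congr (_ - _).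
    by rewrite addrACA addNr addr0.
  by rewrite [RHS]scalerBr (scalerA _ (2 * t ^+ 2)) mulVf ?gt_eqF// scale1r.
rewrite normrZ ger0_norm ?invr_ge0 ?(ltW t2)// mulrC ler_pdivrMr//.
apply: le_trans (ler_normD _ _) _; apply: le_trans (lerD H H') _.
by rewrite le_eqVlt; apply/orP; left; apply/eqP; ring.
Qed.

End QuotientEstimates.

Section Smoothness.
Context {R : realType}.

Lemma Ck_pred k (V W : normedModType R) (A : set V) (f : V -> W) : Ck k.+1 A f -> Ck k A f.
Proof.
elim: k V W A f => [|k IH] V W A f [cf [df [Df DfE CDf]]]; first by split.
by split => //; split => //; exists Df => //; exact: IH.
Qed.

Lemma Ck_le j k (V W : normedModType R) (A : set V) (f : V -> W) : (j <= k)%N ->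
  Ck k A f -> Ck j A f.
Proof.
move=> /subnK <-; elim: (k - j)%N => [//|n IH]; rewrite addSn => /Ck_pred; exact: IH.
Qed.

Lemma is_diff_eval4 (V A1 A2 A3 A4 U : normedModType R)
    (f df : V -> 'L(A1, 'L(A2, 'L(A3, 'L(A4, U))))) x a b c d :
  is_diff x f df -> is_diff x (fun z => f z a b c d) (fun k => df k a b c d).
Proof.
move=> [d0 e0]; have [d1 e1] := is_diff_eval a d0; have [d2 e2] := is_diff_eval b d1.
have [d3 e3] := is_diff_eval c d2; have := is_diff_eval d d3.
by rewrite e3 e2 e1 e0.
Qed.

Lemma interior_setM (V : normedModType R) (M : set V) (x : V * V) :
  M° x.1 -> M° x.2 -> (M `*` M)° x.
Proof. by move=> h1 h2; exists (M, M). Qed.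

Lemma scale5_le (a k h r : R) : a <= k -> 0 <= h -> 0 <= r ->
  a * h * h * h * h * r <= k * h ^+ 4 * r.
Proof.
move=> ak h0 r0; rewrite ler_wpM2r//.
by rewrite !exprSr expr0 mul1r !mulrA !ler_wpM2r.
Qed.

End Smoothness.

Section SmoothData.
Context {R : realType} {V Y : completeNormedModType R}.
Let E := (V * V)%type.
Variables (iota : 'L(V, Y)) (M : set V) (g : V -> V -> V -> R)
  (G : Y * V * V -> R) (c1 c2 : R) (W : E -> R) (w : V -> V) (v y0 : V) (N : nat).
Hypothesis g_metric : riemannian_metric M g.
Hypothesis (c1_gt0 : 0 < c1) (c2_gt0 : 0 < c2).
Hypothesis g_bounds : forall y v, M y -> c1 * `|v| ^+ 2 <= g y v v <= c2 * `|v| ^+ 2.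
Hypothesis G_smooth : Ck 3 setT G.
Hypothesis Gg : forall y v w, M y -> G (iota y, v, w) = g y v w.
Hypothesis W_consistent : locally_consistent M g W.
Hypothesis N34 : N = 3%N \/ N = 4%N.
Hypothesis W_smooth : Ck N.+1 (M `*` M) W.
Hypothesis w_smooth : Ck 3 M w.
Hypothesis y0_interior : M° y0.
Let P : E := (y0, y0).

Lemma pair_near (y : V) (k : E) (rho : R) : `|y - y0| < rho / 2 -> `|k| < rho / 2 ->
  `|((y, y) : E) + k - P| < rho.
Proof.
move=> yr kr; rewrite addrAC; apply: le_lt_trans (ler_normD _ _) _.
by rewrite [rho]splitr ltrD// prod_normE /= gt_max yr.
Qed.

(** Derivatives of [W] near [(y0, y0)] with common bounds, together with a Taylor
    estimate of order [N]. For [N = 3] the trilinear term is dropped ([s = 0]); for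
    [N = 4] it is kept ([s = 1/6]) and the remainder uses a fifth derivative. *)
Lemma derivatives_exist : exists D1 D2 D3 D4 (s rho Kb : R),
  [/\ 0 < rho, ball y0 rho `<=` M°,
   [/\ forall x : E, `|x - P| < rho -> is_diff x W (D1 x : 'L(E, R)),
       forall x : E, `|x - P| < rho -> is_diff x D1 (D2 x : 'L(E, 'L(E, R))) &
       forall x : E, `|x - P| < rho -> is_diff x D2 (D3 x : 'L(E, 'L(E, 'L(E, R))))],
   [/\ forall x : E, `|x - P| < rho -> `|D2 x - D2 P| <= c1,
       forall x : E, `|x - P| < rho -> `|D2 x| <= Kb,
       forall x : E, `|x - P| < rho -> `|D3 x| <= Kb &
       forall x : E, `|x - P| < rho -> `|D4 x : 'L(E, 'L(E, 'L(E, 'L(E, R))))| <= Kb] &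
   exists K eta, [/\ 0 <= K, 0 < eta &
     forall y k r, `|y - y0| < rho / 2 -> `|k| < eta ->
     `|D1 ((y, y) + k) r - D1 (y, y) r - D2 (y, y) k r - 2^-1 * D3 (y, y) k k r
       - s * D4 (y, y) k k k r| <= K * `|k| ^+ N * `|r|]].
Proof.
have [rM rM0 MrM] : exists2 r : R, 0 < r & forall x, `|x - y0| < r -> M° x.
  have /nbhs_ballP[r /= r0 H] : nbhs y0 M° by exact: nbhs_interior.
  by exists r => // x xy; apply: H; rewrite -ball_normE /= distrC.
have inM (x : E) : `|x - P| < rM -> (M `*` M)° x.
  by rewrite prod_normE /= gt_max => /andP[h1 h2]; apply: interior_setM; exact: MrM.
have PM : (M `*` M)° P by apply: inM; rewrite subrr normr0.
have [D1 [D2 [D3 [D4 [sc [[c2' c3' c4'] [dW dD1 dD2] [K [rt [K0 rt0 HT]]]]]]]]] :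
  exists D1 D2 D3 D4 (sc : R),
  [/\ [/\ {for P, continuous D2}, {for P, continuous D3} & {for P, continuous D4}],
   [/\ forall x, (M `*` M)° x -> is_diff x W (D1 x : 'L(E, R)),
       forall x, (M `*` M)° x -> is_diff x D1 (D2 x : 'L(E, 'L(E, R))) &
       forall x, (M `*` M)° x -> is_diff x D2 (D3 x : 'L(E, 'L(E, 'L(E, R))))] &
   exists K rt : R, [/\ 0 <= K, 0 < rt &
     forall y k r, `|y - y0| < rt -> `|k| < rt ->
     `|D1 ((y, y) + k) r - D1 (y, y) r - D2 (y, y) k r - 2^-1 * D3 (y, y) k k r
       - sc * (D4 (y, y) : 'L(E, 'L(E, 'L(E, 'L(E, R))))) k k k r| <= K * `|k| ^+ N * `|r|]].
  have W_smooth1 := W_smooth; case: N34 => NE; rewrite NE in W_smooth1 *.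
  - have [D1 CD1 dW] := Ck_succ W_smooth1.
    have [D2 CD2 dD1] := Ck_succ CD1.
    have [D3 CD3 dD2] := Ck_succ CD2.
    have [D4 CD4 dD3] := Ck_succ CD3.
    have C4 := Ck_continuous CD4 PM.
    have [r4 [K4 [r40 K40 B4]]] := continuous_bounded C4.
    exists D1, D2, D3, D4, 0; split.
    + split; [exact: (Ck_continuous CD2 PM)|exact: (Ck_continuous CD3 PM)|exact: C4].
    + by split.
    pose ra := Num.min rM r4.
    have ra0 : 0 < ra by rewrite lt_min rM0.
    exists K4, (ra / 2); split=> // [|y k r yr kr]; first by rewrite divr_gt0.
    have inr (x : E) : `|x - P| < ra -> (M `*` M)° x.
      by rewrite lt_min => /andP[h _]; exact: inM.
    have yk := pair_near yr kr.
    have y1 : `|((y, y) : E) - P| < ra.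
      rewrite prod_normE /= gt_max; apply/andP.
      by split; rewrite (lt_trans yr)// ltr_pdivrMr// ltr_pMr// ltr1n.
    have B4' (x : E) : `|x - P| < ra -> `|D4 x| <= K4.
      by rewrite lt_min => /andP[_ h]; exact: B4.
    have T := taylor_order3 (fun x h => dD1 x (inr x h)) (fun x h => dD2 x (inr x h))
      (fun x h => dD3 x (inr x h)) B4' y1 yk.
    rewrite mul0r subr0.
    apply: le_trans (le_trans (clin_le _ r) (ler_wpM2r (normr_ge0 r) T)).
    by [].
  - have [D1 CD1 dW] := Ck_succ W_smooth1.
    have [D2 CD2 dD1] := Ck_succ CD1.
    have [D3 CD3 dD2] := Ck_succ CD2.
    have [D4 CD4 dD3] := Ck_succ CD3.
    have [D5 CD5 dD4] := Ck_succ CD4.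
    have C5 := Ck_continuous CD5 PM.
    have [r5 [K5 [r50 K50 B5]]] := continuous_bounded C5.
    exists D1, D2, D3, D4, 6^-1; split.
    + split; [exact: (Ck_continuous CD2 PM)|exact: (Ck_continuous CD3 PM)|exact: (Ck_continuous CD4 PM)].
    + by split.
    pose ra := Num.min rM r5.
    have ra0 : 0 < ra by rewrite lt_min rM0.
    exists K5, (ra / 2); split=> // [|y k r yr kr]; first by rewrite divr_gt0.
    have inr (x : E) : `|x - P| < ra -> (M `*` M)° x.
      by rewrite lt_min => /andP[h _]; exact: inM.
    have yk := pair_near yr kr.
    have y1 : `|((y, y) : E) - P| < ra.
      rewrite prod_normE /= gt_max; apply/andP.
      by split; rewrite (lt_trans yr)// ltr_pdivrMr// ltr_pMr// ltr1n.
    have B5' (x : E) h r' : `|x - P| < ra -> `|D5 x h h h h r'| <= K5 * `|h| ^+ 4 * `|r'|.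
      rewrite lt_min => /andP[_ /B5 hx]; apply: le_trans (clin_le5 _ _ _ _ _ _) _.
      exact: scale5_le.
    have dE (x : E) h r' : `|x - P| < ra ->
        is_diff x (fun z => D4 z h h h r') (fun k => D5 x k h h h r').
      by move=> /inr/dD4; exact: is_diff_eval4.
    have T := taylor_order4 (fun x h => dD1 x (inr x h)) (fun x h => dD2 x (inr x h))
      (fun x h => dD3 x (inr x h)) dE K50 B5' y1 yk.
    apply: le_trans (le_trans (clin_le _ r) (ler_wpM2r (normr_ge0 r) T)).
    by [].
have [r2 [K2 [r20 K20 B2]]] := continuous_bounded c2'.
have [r3 [K3 [r30 K30 B3]]] := continuous_bounded c3'.
have [r4 [K4 [r40 K40 B4]]] := continuous_bounded c4'.
have [rc rc0 Bc] := continuous_dist c2' c1_gt0.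
pose rho := Num.min (Num.min rM (Num.min r2 r3)) (Num.min (Num.min r4 rc) rt).
have rho0 : 0 < rho by rewrite !lt_min rM0 r20 r30 r40 rc0 rt0.
have rhoM : rho <= rM by rewrite /rho !ge_min lexx.
have rho2 : rho <= r2 by rewrite /rho !ge_min lexx ?orbT.
have rho3 : rho <= r3 by rewrite /rho !ge_min lexx ?orbT.
have rho4 : rho <= r4 by rewrite /rho !ge_min lexx ?orbT.
have rhoc : rho <= rc by rewrite /rho !ge_min lexx ?orbT.
have rhot : rho <= rt by rewrite /rho !ge_min lexx ?orbT.
clearbody rho.
exists D1, D2, D3, D4, sc, rho, (Num.max K2 (Num.max K3 K4)); split => //.
- move=> x; rewrite -ball_normE /= distrC => h; apply: MrM; exact: lt_le_trans h rhoM.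
- split=> x h; have hM := inM x (lt_le_trans h rhoM); [exact: dW|exact: dD1|exact: dD2].
- split=> x h.
  + exact: Bc (lt_le_trans h rhoc).
  + by apply: le_trans (B2 x (lt_le_trans h rho2)) _; rewrite !le_max lexx.
  + by apply: le_trans (B3 x (lt_le_trans h rho3)) _; rewrite !le_max lexx orbT.
  + by apply: le_trans (B4 x (lt_le_trans h rho4)) _; rewrite !le_max lexx !orbT.
- exists K, rt; split => // y k r yr kr; apply: HT => //.
  by rewrite (lt_le_trans yr)// (le_trans _ rhot)// ler_pdivrMr// ler_pMr// ler1n.
Qed.

(** Three derivatives of [w] near [y0] with common bounds. *)
Lemma field_data : exists (Dw : V -> 'L(V, V)) (D2w : V -> 'L(V, 'L(V, V)))
    (D3w : V -> 'L(V, 'L(V, 'L(V, V)))) (rho K : R),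
  [/\ 0 < rho,
   [/\ forall x, `|x - y0| < rho -> is_diff x w (Dw x),
       forall x, `|x - y0| < rho -> is_diff x Dw (D2w x) &
       forall x, `|x - y0| < rho -> is_diff x D2w (D3w x)] &
   [/\ forall x, `|x - y0| < rho -> `|w x| <= K,
       forall x, `|x - y0| < rho -> `|Dw x| <= K,
       forall x, `|x - y0| < rho -> `|D2w x| <= K &
       forall x, `|x - y0| < rho -> `|D3w x| <= K]].
Proof.
have [rM rM0 MrM] : exists2 r : R, 0 < r & forall x, `|x - y0| < r -> M° x.
  have /nbhs_ballP[r /= r0 H] : nbhs y0 M° by exact: nbhs_interior.
  by exists r => // x xy; apply: H; rewrite -ball_normE /= distrC.
have [Dw CD1 dw] := Ck_succ w_smooth.
have [D2w CD2 dD1] := Ck_succ CD1.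
have [D3w CD3 dD2] := Ck_succ CD2.
have [r1 [K1 [r10 K10 B1]]] := continuous_bounded (Ck_continuous w_smooth y0_interior).
have [r2 [K2 [r20 K20 B2]]] := continuous_bounded (Ck_continuous CD1 y0_interior).
have [r3 [K3 [r30 K30 B3]]] := continuous_bounded (Ck_continuous CD2 y0_interior).
have [r4 [K4 [r40 K40 B4]]] := continuous_bounded (Ck_continuous CD3 y0_interior).
pose rho := Num.min rM (Num.min (Num.min r1 r2) (Num.min r3 r4)).
have rho0 : 0 < rho by rewrite !lt_min rM0 r10 r20 r30 r40.
have rhoM : rho <= rM by rewrite /rho !ge_min lexx.
have rho1 : rho <= r1 by rewrite /rho !ge_min lexx ?orbT.
have rho2 : rho <= r2 by rewrite /rho !ge_min lexx ?orbT.
have rho3 : rho <= r3 by rewrite /rho !ge_min lexx ?orbT.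
have rho4 : rho <= r4 by rewrite /rho !ge_min lexx ?orbT.
clearbody rho.
exists Dw, D2w, D3w, rho, (Num.max (Num.max K1 K2) (Num.max K3 K4)); split => //.
- split=> x h; have hM := MrM x (lt_le_trans h rhoM); [exact: dw|exact: dD1|exact: dD2].
- split=> x h.
  + by apply: le_trans (B1 x (lt_le_trans h rho1)) _; rewrite !le_max lexx.
  + by apply: le_trans (B2 x (lt_le_trans h rho2)) _; rewrite !le_max lexx ?orbT.
  + by apply: le_trans (B3 x (lt_le_trans h rho3)) _; rewrite !le_max lexx ?orbT.
  + by apply: le_trans (B4 x (lt_le_trans h rho4)) _; rewrite !le_max lexx !orbT.
Qed.

(** One expansion serves both quotients: four derivatives of [W] give the error
    [t^3], five give [t^4]. *)
Lemma manifold_expansion : exists (rho : R) (q3 : V -> V) (K L : R),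
  [/\ 0 < rho, 0 <= K, ball y0 rho `<=` M°, (forall y, ball y0 rho y -> `|q3 y| <= L) &
   forall r, 0 < r <= rho -> inv_transport_well_defined W (ball y0 rho) r /\
   exists2 t1 : R, 0 < t1 & forall y t, ball y0 rho y -> `|t| < t1 ->
    `|inv_transport W r y (t *: v) (t *: w (y + t *: v)) - t *: w y
       - t ^+ 2 *: cov_deriv g w v y - t ^+ 3 *: q3 y| <= K * `|t| ^+ N].
Proof.
have [D1 [D2 [D3 [D4 [s [rW [Kb [rW0 rWM [dW dD1 dD2] [Bc B2 B3 B4] [Kt [eta [Kt0 eta0 HT]]]]]]]]]]] :=
  derivatives_exist.
have [Dw [D2w [D3w [rw [Kw [rw0 [dw dDw dD2w] [Bw B1w B2w B3w]]]]]]] := field_data.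
pose rho := Num.min rW rw.
have rho0 : 0 < rho by rewrite lt_min rW0.
have rhoW : rho <= rW by rewrite ge_min lexx.
have rhow : rho <= rw by rewrite ge_min lexx orbT.
clearbody rho.
have lW (x : E) : `|x - P| < rho -> `|x - P| < rW by move=> h; exact: lt_le_trans h rhoW.
have lw (x : V) : `|x - y0| < rho -> `|x - y0| < rw by move=> h; exact: lt_le_trans h rhow.
have inM y : `|y - y0| < rho -> M° y.
  move=> yr; apply: rWM; rewrite -ball_normE /= distrC; exact: lt_le_trans yr rhoW.
have inM' y : `|y - y0| < rho -> M y by move=> /inM/interior_subset.
have half y : `|y - y0| < rho / 2 -> `|y - y0| < rho.
  by move=> h; rewrite (lt_trans h)// ltr_pdivrMr// ltr_pMr// ltr1n.
have yy : `|y0 - y0| < rho by rewrite subrr normr0.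
have N3 : (3 <= N)%N by case: N34 => ->.
have N4 : (N <= 4)%N by case: N34 => ->.
have gl y : `|y - y0| < rho -> forall u, linear (g y u) by move=> /inM'; exact: metric_linear.
have gs y : `|y - y0| < rho -> forall u u', g y u u' = g y u' u.
  by move=> /inM'; exact: metric_sym.
have gc y : `|y - y0| < rho -> forall u, c1 * `|u| ^+ 2 <= g y u u <= c2 * `|u| ^+ 2.
  by move=> /inM' My u; exact: g_bounds.
have Wexp y : `|y - y0| < rho -> forall h e, 0 < e -> exists2 s0, 0 < s0 &
    forall t : R, `|t| < s0 -> `|W (y, y + t *: h) - t ^+ 2 * g y h h| <= e * t ^+ 2.
  move=> yr h e e0.
  have [L [eta' [L0 eta'0 HL]]] := metric_locally_lipschitz g_metric G_smooth Gg (inM' _ yr).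
  exact: (consistent_expansion g_metric c1_gt0 c2_gt0 g_bounds (inM _ yr) L0 eta'0 HL W_consistent h e0).
have dE y : `|y - y0| < rho -> 'D_v w y = Dw y v.
  by move=> /lw/dw[d1 e1]; rewrite deriveE// e1.
have wexp := field_expansion c1_gt0 c2_gt0 (gl _ yy) (gs _ yy) (gc _ yy)
  (fun x h => dw x (lw x h)) (fun x h => dDw x (lw x h)) (fun x h => dD2w x (lw x h))
  (fun x h => B3w x (lw x h)) v N4 rho0.
have wb : bounded_on [set y | `|y - y0| < rho / 2] w.
  by exists Kw => y /half/lw; exact: Bw.
have Dwb : bounded_on [set y | `|y - y0| < rho / 2] ('D_v w).
  exists (Kw * `|v|) => y /half yr; rewrite dE//; apply: le_trans (clin_le _ _) _.
  by rewrite ler_wpM2r// B1w//; exact: lw.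
have d3b : bounded_on [set y | `|y - y0| < rho / 2] (fun y => 2^-1 *: D2w y v v).
  apply: bounded_onZ; exists (Kw * `|v| * `|v|) => y /half yr.
  apply: le_trans (clin_le2 _ _ _) _; rewrite ler_wpM2r// ler_wpM2r//.
  by apply: B2w; exact: lw.
have tay : exists K eta, [/\ 0 <= K, 0 < eta &
  forall y k r, `|y - y0| < rho / 2 -> `|k| < eta ->
  `|D1 ((y, y) + k) r - D2 (y, y) k r - 2^-1 * D3 (y, y) k k r
     - s * D4 (y, y) k k k r| <= K * `|k| ^+ N * `|r|].
  exists Kt, eta; split => // y k r yr ke.
  have yrW : `|y - y0| < rW / 2 by rewrite (lt_le_trans yr)// ler_pM2r.
  have := HT y k r yrW ke.
  have -> := D1_diag (fun x h => dW x (lW x h)) (fun x h => dD1 x (lW x h))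
    (fun x h => dD2 x (lW x h)) (ex_intro _ Kb (fun x h => B3 x (lW x h))) Wexp (half _ yr).
  by rewrite clin_zeroE subr0.
have [q3 [K K0 [[L qL] H]]] := transport_expansion N3 N4 rho0 c1_gt0 c2_gt0 gl gs gc
  (fun x h => dW x (lW x h)) (fun x h => dD1 x (lW x h)) (fun x h => dD2 x (lW x h))
  (fun x h => Bc x (lW x h)) (fun x h => B2 x (lW x h)) (fun x h => B3 x (lW x h))
  (fun x h => B4 x (lW x h)) Wexp tay wb Dwb d3b wexp.
have bE y : ball y0 (rho / 2) y -> `|y - y0| < rho / 2 by rewrite -ball_normE /= distrC.
exists (rho / 2), q3, K, L; split => //.
- by rewrite divr_gt0.
- by move=> y /bE/half; exact: inM.
- by move=> y /bE; exact: qL.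
move=> r rr; have [h1 [t1 t10 h2]] := H r rr; split => //.
by exists t1 => // y t /bE yB; exact: h2.
Qed.

End SmoothData.

Theorem theorem4p1 (R : realType) (V Y : completeNormedModType R)
    (V_separable : separable V) (V_reflexive : reflexive_space V)
    (iota : 'L(V, Y)) (iota_compact : compact_embedding iota)
    (M : set V)
    (M_weak_closure : exists O : set V,
      [/\ open O, path_connected (R := R) O & M = weak_closure O])
    (M_boundary : smooth_boundary M)
    (g : V -> V -> V -> R) (g_metric : riemannian_metric M g)
    (g_bounds : exists c1 c2 : R, [/\ 0 < c1, 0 < c2 & forall y v, M y ->
      c1 * `|v| ^+ 2 <= g y v v <= c2 * `|v| ^+ 2])
    (g_smooth : exists2 G : Y * V * V -> R, Ck 3 setT G &
      forall y v w, M y -> G (iota y, v, w) = g y v w)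
    (m : nat)
    (W : V * V -> R) (W_smooth : Ck m (M `*` M) W)
    (W_lsc : weakly_lsc (extend_pinfty iota M W))
    (W_consistent : locally_consistent M g W)
    (w : V -> V) (w_smooth : Ck m.-1 M w)
    (v y0 : V) (y0_interior : M° y0) :
  ((4 <= m)%N -> exists rho r0 C : R,
    [/\ 0 < rho, 0 < r0, 0 < C, ball y0 rho `<=` M° &
     forall r, 0 < r <= r0 ->
       inv_transport_well_defined W (ball y0 rho) r /\
       exists2 tau0 : R, 0 < tau0 & forall y tau,
         ball y0 rho y -> 0 < tau < tau0 ->
         `|cov_quot W r tau w v y - cov_deriv g w v y| <= C * tau]) /\
  ((5 <= m)%N -> exists rho r0 C : R,
    [/\ 0 < rho, 0 < r0, 0 < C, ball y0 rho `<=` M° &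
     forall r, 0 < r <= r0 ->
       inv_transport_well_defined W (ball y0 rho) r /\
       exists2 tau0 : R, 0 < tau0 & forall y tau,
         ball y0 rho y -> 0 < tau < tau0 ->
         `|cov_quot_sym W r tau w v y - cov_deriv g w v y| <= C * tau ^+ 2]).
Proof.
have [c1 [c2 [c1_gt0 c2_gt0 gb]]] := g_bounds.
have [G G_smooth Gg] := g_smooth.
split=> hm.
- have W4 : Ck 4 (M `*` M) W by exact: Ck_le hm W_smooth.
  have w3 : Ck 3 M w by apply: Ck_le w_smooth; rewrite -ltnS prednK ?(leq_trans _ hm)//; exact: leq_trans hm.
  have [rho [q3 [K [L [rho0 K0 rhoM qL H]]]]] := manifold_expansion v g_metric c1_gt0 c2_gt0 gb
    G_smooth Gg W_consistent (or_introl erefl) W4 w3 y0_interior.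
  have L0 : 0 <= L by apply: le_trans (normr_ge0 _) (qL y0 (ballxx _ rho0)).
  have C0 : 0 < K + L + 1 by rewrite ltr_wpDl// addr_ge0.
  exists rho, rho, (K + L + 1); split => // r rr; have [wd [t1 t10 Ht]] := H r rr.
  split => //; exists t1 => // y tau yB /andP[tau0 taut].
  have ta : `|tau| < t1 by rewrite gtr0_norm.
  have := one_sided_quotient tau0 (qL y yB) (Ht y tau yB ta).
  by move=> h; apply: le_trans h _; rewrite ler_wpM2r ?(ltW tau0)// lerDl.
- have W5 : Ck 5 (M `*` M) W by exact: (Ck_le hm W_smooth).
  have w3 : Ck 3 M w by apply: Ck_le w_smooth; rewrite -ltnS prednK ?(leq_trans _ hm)//; exact: leq_trans hm.
  have [rho [q3 [K [L [rho0 K0 rhoM qL H]]]]] := manifold_expansion v g_metric c1_gt0 c2_gt0 gb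
    G_smooth Gg W_consistent (or_intror erefl) W5 w3 y0_interior.
  have C0 : 0 < K + 1 by rewrite ltr_wpDl.
  exists rho, rho, (K + 1); split => // r rr; have [wd [t1 t10 Ht]] := H r rr.
  split => //; exists t1 => // y tau yB /andP[tau0 taut].
  have ta : `|tau| < t1 by rewrite gtr0_norm.
  have ta' : `|- tau| < t1 by rewrite normrN.
  have := two_sided_quotient tau0 (Ht y tau yB ta) (Ht y (- tau) yB ta').
  rewrite !scaleNr => h; apply: le_trans h _.
  by rewrite ler_wpM2r ?sqr_ge0// lerDl.
Qed.
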